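(* Let $T$ be a tree with $k$ edges and let $E \subset \mathbb{R}^d$ be compact with Hausdorff dimension $\dim_{\mathcal{H}}(E) > (d+1)/2$. Let $\sigma(T)$ be a symmetric tree cover of $T$, with edge set $\mathcal{E}(\sigma(T))$, let $m$ be the number of edges of $\sigma(T)$, and label its vertices $1,\dots,m+1$. Then for every Frostman measure $\mu$ with exponent $s > (d + 1)/2$ supported on $E$, there are a constant $c > 0$ independent of $\epsilon$ and an open interval $I$ such that for each $t \in I$ and each $\epsilon > 0$, $$\mu^{m+1}\left(\{(x_1,\ldots, x_{m+1}) \in E^{m+1}: t - \epsilon < x_i \cdot x_j < t + \epsilon,\ (i,j) \in \mathcal{E}(\sigma(T)) \}\right) > c\,\epsilon^m.$$
   Context: A Frostman measure with exponent $s$ supported on $E$ is a finite nonzero Borel measure $\mu$ supported on $E$ for which there is a constant $A$ with $\mu(B(x,r)) \le A r^s$ for all $x \in \mathbb{R}^d$ and $r > 0$. Here $\mu^{m+1}$ denotes the $(m+1)$-fold product measure, and $x\cdot y$ is the Euclidean dot product. Symmetric tree cover (defined by induction on the number of edges): let $T$ be a finite tree with $k \ge 1$ edges. If $k = 1$ then $\sigma(T) = T$. Otherwise let $u$ be a non-leaf vertex of $T$. Let $T_u$ be the tree obtained from $T$ by collapsing every neighbor of $u$ to a single vertex and reattaching $u$ to this vertex (so $T_u$ has $k-\deg(u)+1<k$ edges). Join $\deg(u)$ copies of $\sigma(T_u)$ at $u$, where $u$ is viewed as a vertex of $\sigma(T_u)$ via the inclusion $T_u\subset\sigma(T_u)$;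 the copies have only $u$ in common. The resulting tree is $\sigma(T)$. The tree $\sigma(T)$ may depend on the choice of the vertex $u$ at each stage; any choice is allowed.
   Formalization: ''For each ε > 0'' is replaced by 0 < ε ≤ ε0 for an arbitrary ε0, with c depending on ε0 but not on t or ε, and I independent of ε0; for unbounded ε the claim fails, since μ is finite while c ε^m is unbounded. *)

(* Defs.v *)
From mathcomp Require Import all_boot all_order all_algebra.
From mathcomp Require Import all_classical all_reals all_analysis.
Set Implicit Arguments.
Unset Strict Implicit.
Unset Printing Implicit Defensive.
Import Order.TTheory GRing.Theory Num.Theory.
Import numFieldNormedType.Exports.
Local Open Scope classical_set_scope.
Local Open Scope ring_scope.

Section Trees.

(* A cycle needs at least three vertices: [ucycle] also accepts [:: x; y]
   for an edge x -- y. *)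
Definition is_tree (V : finType) (e : rel V) : Prop :=
  [/\ (0 < #|V|)%N, symmetric e, irreflexive e,
      (forall x y, connect e x y) &
      (forall c : seq V, ucycle e c -> (size c <= 2)%N)].

Definition edge_set (V : finType) (e : rel V) : {set {set V}} :=
  [set A | [exists x, exists y, e x y && (A == [set x; y]%SET)]].

Definition degree (V : finType) (e : rel V) (u : V) : nat :=
  #|[pred v | e u v]|.

Definition image_rel (V W : finType) (p : V -> W) (e : rel V) : rel W :=
  fun x y => [exists v, exists w, [&& p v == x, p w == y & e v w]].

(* T_u: the neighbours of u all become [None], and every other vertex v
   (u included) is kept as [Some v].  Taking the image of the edges
   automatically reattaches u to [None]. *)
Definition collapse_vertex (V : finType) (e : rel V) (u v : V) :
  option {v : V | ~~ e u v} := insub v.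
Arguments collapse_vertex {V} e u v.

Definition collapse (V : finType) (e : rel V) (u : V) :
  rel (option {v : V | ~~ e u v}) := image_rel (collapse_vertex e u) e.
Arguments collapse {V} e u _ _.

(* Copies of a graph on W, indexed by I, with their vertices r identified to
   the single vertex [None]; [glue_vertex r (i, w)] is the vertex w of the
   i-th copy. *)
Definition glue_vertex (I W : finType) (r : W) (p : I * W) :
  option (I * {w : W | w != r}) := omap (pair p.1) (insub p.2).
Arguments glue_vertex {I W} r p.

Definition join (I W : finType) (f : rel W) (r : W) :
  rel (option (I * {w : W | w != r})) :=
  image_rel (glue_vertex r) (fun p q => (p.1 == q.1) && f p.2 q.2).
Arguments join I {W} f r _ _.

(* [sym_cover e f iota]: the graph f is a symmetric tree cover sigma(T) of the
   tree T = e, for some choice of the vertices u, and iota : V -> W is the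
   inclusion of T in sigma(T).  In the inductive step the deg(u) copies of
   sigma(T_u) are indexed by the neighbours of u, and [b] maps a vertex v <> u
   to the neighbour of u in whose branch (component of T - u) v lies; the
   inclusion sends v to its image under T_u in the copy of index [b v].  The
   value of [b] at u is irrelevant, since u is sent to the common vertex. *)
Inductive sym_cover : forall (V : finType) (e : rel V) (W : finType)
    (f : rel W), (V -> W) -> Prop :=
| sym_cover_edge (V : finType) (e : rel V) :
    is_tree e -> #|edge_set e| = 1%N -> @sym_cover V e V e id
| sym_cover_join (V : finType) (e : rel V) (u : V)
    (b : V -> {v : V | e u v}) (W : finType) (f : rel W)
    (iota : option {v : V | ~~ e u v} -> W) :
    is_tree e -> (1 < degree e u)%N ->
    (forall n : {v : V | e u v}, b (val n) = n) ->
    (forall v w, v != u -> w != u -> e v w -> b v = b w) ->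
    sym_cover (collapse e u) f iota ->
    let r := iota (collapse_vertex e u u) in
    sym_cover e (join {v : V | e u v} f r)
      (fun v => glue_vertex r (b v, iota (collapse_vertex e u v))).

Definition symmetric_tree_cover (V : finType) (e : rel V) (W : finType)
  (f : rel W) : Prop := exists iota : V -> W, sym_cover e f iota.

End Trees.

Section Euclidean.
Context {R : realType} {d : nat}.
Implicit Types (x y : 'rV[R]_d) (E U : set 'rV[R]_d).

Definition dot x y : R := \sum_i x ord0 i * y ord0 i.

(* The library's norm on 'rV[R]_d is the sup norm. *)
Definition enorm x : R := Num.sqrt (dot x x).

Definition eball x (r : R) : set 'rV[R]_d := [set y | enorm (y - x) < r].

Definition diam U : \bar R :=
  ereal_sup (0%E |` [set (enorm (p.1 - p.2))%:E | p in U `*` U]).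

(* Meaningful for s > 0: an empty U i then contributes 0 to the sum. *)
Definition hausdorff_premeasure (s delta : R) E : \bar R :=
  ereal_inf [set (\sum_(0 <= i <oo) (diam (U i) `^ s))%E |
    U in [set U : nat -> set 'rV[R]_d |
      E `<=` \bigcup_i U i /\ forall i, (diam (U i) <= delta%:E)%E]].

Definition hausdorff_measure (s : R) E : \bar R :=
  ereal_sup [set hausdorff_premeasure s delta E | delta in [set x | 0 < x]].

Definition hausdorff_dim E : \bar R :=
  ereal_inf [set s%:E | s in [set s : R | 0 < s /\ hausdorff_measure s E = 0%E]].

End Euclidean.

Definition borel_rV (R : realType) (d : nat) :=
  g_sigma_algebraType (@open 'rV[R]_d).

(* For E closed, [mu (~` E) = 0] says that the support of mu lies in E. *)
Definition frostman (R : realType) (d : nat) (E : set 'rV[R]_d) (s : R)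
    (mu : {finite_measure set (borel_rV R d) -> \bar R}) : Prop :=
  [/\ mu setT != 0%E, mu (~` E) = 0%E &
      exists A : R, forall (x : 'rV[R]_d) (r : R), 0 < r ->
        (mu (eball x r) <= (A * r `^ s)%:E)%E].

Fixpoint power_measure (dsp : measure_display) (T : measurableType dsp)
    (R : realType) (mu : set T -> \bar R) (n : nat) :
    set (n.-tuple T) -> \bar R :=
  match n with
  | 0 => fun A => \d_[tuple] A
  | n'.+1 => pushforward (mu \x @power_measure dsp T R mu n')%E
               (fun p : T * n'.-tuple T => cons_tuple p.1 p.2)
  end.
Arguments power_measure {dsp T R} mu n A.

(* Main.v *)
(** Write nu for the law of x.y under mu x mu. The oscillatory integral of
  exp (i lam tau (x.y - t)) over lam in [1, 2] and tau in a dyadic block [T, 2T]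
  pairs the vectors lam (x, -t) and tau (y, 1) of dimension d + 1; a duality
  (TT* ) estimate bounds it by the masses of pairs of nearby vectors, and the
  Frostman condition turns this into C T^((d + 1)/2 - s), summable over the
  blocks. Hence the Poisson means of nu are bounded and uniformly
  equicontinuous in t and in the scale. By pigeonhole some mean is bounded below
  at a fine scale, so all finer means are bounded below near that t, and so is
  nu [t - r, t + r] / r: this is the theorem for one edge. The density of
  homomorphisms into the join of p copies is the p-th moment of the density
  rooted at the common vertex, and Jensen's inequality finishes the induction. *)

From HB Require Import structures.
Require Import Defs.
From mathcomp Require Import all_boot all_order all_algebra.
From mathcomp Require Import all_classical all_reals all_analysis.
From mathcomp Require Import measurable_realfun ring lra.
Set Implicit Arguments.
Unset Strict Implicit.
Unset Printing Implicit Defensive.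
Import Order.TTheory GRing.Theory Num.Theory.
Import numFieldNormedType.Exports.
Local Open Scope classical_set_scope.
Local Open Scope ring_scope.

(** * Bounded measurable functions *)

(** The dilation [lam] is what brings the exponent down to (d + 1)/2. In dimension d + 1 the duality
    bound for the square of a block is of order T^(d + 1) times the masses of the near pairs on the
    two sides. Two Frostman balls of radius of order 1/T contribute T^(- 2 s), and the length of the
    frequency block contributes T; with [lam] fixed this would only give T^((d + 2)/2 - s). The last
    coordinate of lam (x, -t) is - lam t, so near pairs also have their [lam] within O(1/T) of each
    other, which cancels the extra T. This gain needs t bounded away from 0, so nu must charge an
    interval of positive t: [small_positive_piece] provides one, from a small cube of positive mass
    away from the origin. Averaging over [lam] in [1, 2] is harmless, since the Poisson kernels at w
    and at lam w are comparable. The density of nu is never constructed: the estimates are made at a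
    positive scale [del], and the resulting bounds do not depend on [del]. *)

Section BoundedMeasurable.
Context {d : measure_display} {T : measurableType d} {R : realType}.
Implicit Types f g : T -> R.

(** Unlike integrability, global boundedness is stable under products and sections, and it gives
    integrability against every finite measure. *)
Definition bmeas f := measurable_fun setT f /\ exists C : R, forall x, `|f x| <= C.

Lemma bmeas_cst (c : R) : bmeas (fun=> c).
Proof. by split; [exact: measurable_cst | exists `|c|]. Qed.

Lemma bmeasD f g : bmeas f -> bmeas g -> bmeas (fun x => f x + g x).
Proof.
move=> [mf [C Cf]] [mg [D Dg]]; split; first exact: measurable_funD.
by exists (C + D) => x; apply: (le_trans (ler_normD _ _)); exact: lerD.
Qed.

Lemma bmeasN f : bmeas f -> bmeas (fun x => - f x).
Proof.
move=> [mf [C Cf]]; split; first exact: measurableT_comp.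
by exists C => x; rewrite normrN.
Qed.

Lemma bmeasB f g : bmeas f -> bmeas g -> bmeas (fun x => f x - g x).
Proof. by move=> bf bg; apply: bmeasD => //; exact: bmeasN. Qed.

Lemma bmeasM f g : bmeas f -> bmeas g -> bmeas (fun x => f x * g x).
Proof.
move=> [mf [C Cf]] [mg [D Dg]]; split; first exact: measurable_funM.
by exists (C * D) => x; rewrite normrM ler_pM.
Qed.

Lemma bmeas_sum (I : Type) (r : seq I) (P : pred I) (F : I -> T -> R) :
  (forall i, bmeas (F i)) -> bmeas (fun x => \sum_(i <- r | P i) F i x).
Proof.
move=> bF; elim: r => [|i r IH].
  by under eq_fun do rewrite big_nil; exact: bmeas_cst.
under eq_fun do rewrite big_cons; case: (P i) => //; exact: bmeasD.
Qed.

Lemma bmeas_prod (I : Type) (r : seq I) (P : pred I) (F : I -> T -> R) :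
  (forall i, bmeas (F i)) -> bmeas (fun x => \prod_(i <- r | P i) F i x).
Proof.
move=> bF; elim: r => [|i r IH].
  by under eq_fun do rewrite big_nil; exact: bmeas_cst.
under eq_fun do rewrite big_cons; case: (P i) => //; exact: bmeasM.
Qed.

Lemma bmeas_indic (A : set T) : measurable A -> bmeas (\1_A : T -> R).
Proof.
move=> mA; split; first exact: measurable_indic.
by exists 1 => x; rewrite indicE; case: (_ \in _); rewrite ?normr1 ?normr0.
Qed.

Lemma bmeas_comp (h : R -> R) (C : R) f : continuous h ->
  (forall y, `|h y| <= C) -> measurable_fun setT f -> bmeas (h \o f).
Proof.
move=> ch hC mf; split; last by exists C => x; exact: hC.
by apply: measurableT_comp => //; exact: continuous_measurable_fun.
Qed.

Lemma bmeas_cos f : measurable_fun setT f -> bmeas (fun x => cos (f x)).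
Proof. exact: (bmeas_comp (@continuous_cos R) (@cos_max R)). Qed.

Lemma bmeas_sin f : measurable_fun setT f -> bmeas (fun x => sin (f x)).
Proof. exact: (bmeas_comp (@continuous_sin R) (@sin_max R)). Qed.

End BoundedMeasurable.

Lemma bmeas_compr {d d' : measure_display} {T : measurableType d}
  {T' : measurableType d'} {R : realType} (h : T -> T') (f : T' -> R) :
  measurable_fun setT h -> bmeas f -> bmeas (fun x => f (h x)).
Proof.
move=> mh [mf [C Cf]]; split; last by exists C => x; exact: Cf.
exact: measurableT_comp.
Qed.

Lemma bmeas_fst {d d' : measure_display} {T : measurableType d}
  {T' : measurableType d'} {R : realType} (f : T -> R) :
  bmeas f -> bmeas (fun p : T * T' => f p.1).
Proof. exact: bmeas_compr. Qed.

Lemma bmeas_snd {d d' : measure_display} {T : measurableType d}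
  {T' : measurableType d'} {R : realType} (f : T' -> R) :
  bmeas f -> bmeas (fun p : T * T' => f p.2).
Proof. exact: bmeas_compr. Qed.

Section FiniteIntegral.
Context {d : measure_display} {T : measurableType d} {R : realType}.
Variable P : {finite_measure set T -> \bar R}.
Implicit Types f g : T -> R.

Definition mass : R := fine (P setT).

Lemma massE : P setT = mass%:E.
Proof. by rewrite fineK// fin_num_measure. Qed.

Lemma mass_ge0 : 0 <= mass.
Proof. exact: fine_ge0. Qed.

Lemma bmeas_integrable f : bmeas f -> P.-integrable setT (EFin \o f).
Proof.
move=> [mf [C Cf]]; apply: (@le_integrable _ _ _ _ _ measurableT _ (EFin \o cst C)).
- exact/measurable_EFinP.
- move=> x _ /=; rewrite lee_fin; apply: le_trans (Cf x) _; exact: ler_norm.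
- exact: finite_measure_integrable_cst.
Qed.

Lemma fintD f g : bmeas f -> bmeas g ->
  \int[P]_x (f x + g x) = \int[P]_x f x + \int[P]_x g x.
Proof. by move=> bf bg; rewrite RintegralD//; exact: bmeas_integrable. Qed.

Lemma fintB f g : bmeas f -> bmeas g ->
  \int[P]_x (f x - g x) = \int[P]_x f x - \int[P]_x g x.
Proof. by move=> bf bg; rewrite RintegralB//; exact: bmeas_integrable. Qed.

Lemma fintZl f (c : R) : bmeas f -> \int[P]_x (c * f x) = c * \int[P]_x f x.
Proof. by move=> bf; rewrite RintegralZl//; exact: bmeas_integrable. Qed.

Lemma fintZr f (c : R) : bmeas f -> \int[P]_x (f x * c) = (\int[P]_x f x) * c.
Proof. by move=> bf; rewrite RintegralZr//; exact: bmeas_integrable. Qed.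

Lemma fint_le f g : bmeas f -> bmeas g -> (forall x, f x <= g x) ->
  \int[P]_x f x <= \int[P]_x g x.
Proof.
by move=> bf bg fg; apply: le_Rintegral => //; exact: bmeas_integrable.
Qed.

Lemma fint_sum (I : Type) (r : seq I) (F : I -> T -> R) :
  (forall i, bmeas (F i)) ->
  \int[P]_x (\sum_(i <- r) F i x) = \sum_(i <- r) \int[P]_x F i x.
Proof.
move=> bF; elim: r => [|i r IH].
  under eq_Rintegral do rewrite big_nil.
  by rewrite big_nil Rintegral_cst// mul0r.
under eq_Rintegral do rewrite big_cons.
by rewrite big_cons fintD ?IH//; exact: bmeas_sum.
Qed.

Lemma fint_cst (c : R) : \int[P]_x c = c * mass.
Proof. by rewrite Rintegral_cst. Qed.

Lemma fint_normle f (C : R) : bmeas f -> (forall x, `|f x| <= C) ->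
  `|\int[P]_x f x| <= C * mass.
Proof.
move=> bf fC; apply: (le_trans (le_normr_Rintegral _ (bmeas_integrable bf))) => //.
rewrite -fint_cst; apply: fint_le => //; last exact: bmeas_cst.
by split; [exact: measurableT_comp bf.1 | exists C => x; rewrite normr_id].
Qed.

Lemma fint_indic (A : set T) : measurable A -> \int[P]_x (\1_A x) = fine (P A).
Proof. by move=> mA; rewrite /Rintegral integral_indic// setIT. Qed.

Lemma EFin_fint f : bmeas f -> (\int[P]_x f x)%:E = (\int[P]_x (f x)%:E)%E.
Proof.
by move=> bf; rewrite fineK//; apply: integrable_fin_num => //; exact: bmeas_integrable.
Qed.

End FiniteIntegral.

Section FiniteProduct.
Context {d1 d2 : measure_display} {T1 : measurableType d1} {T2 : measurableType d2}
  {R : realType}.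
Variables (P : {finite_measure set T1 -> \bar R})
  (Q : {finite_measure set T2 -> \bar R}).

(** A name of its own carries the finite-measure instance, so that products can be iterated. *)
Definition finprod : set (T1 * T2) -> \bar R := (P \x Q)%E.

HB.instance Definition _ := Measure.on finprod.

Let finprod_fin : fin_num_fun finprod.
Proof.
move=> U mU; rewrite ge0_fin_numE//.
apply: (@le_lt_trans _ _ (finprod setT)); first by rewrite le_measure ?inE.
rewrite /finprod -setXTT product_measure1E//.
by rewrite lte_mul_pinfty// ?fin_num_measure// ltey_eq fin_num_measure.
Qed.

HB.instance Definition _ := Measure_isFinite.Build _ _ _ finprod finprod_fin.

Lemma finprodX A B : measurable A -> measurable B -> finprod (A `*` B) = (P A * Q B)%E.
Proof. by move=> mA mB; rewrite /finprod product_measure1E. Qed.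

Lemma mass_finprod : mass finprod = mass P * mass Q.
Proof.
have := finprodX measurableT measurableT; rewrite setXTT /mass /= => ->.
by rewrite fineM// fin_num_measure.
Qed.

End FiniteProduct.

Section Fubini.
Context {d1 d2 : measure_display} {T1 : measurableType d1} {T2 : measurableType d2}
  {R : realType}.
Variables (P : {finite_measure set T1 -> \bar R})
  (Q : {sigma_finite_measure set T2 -> \bar R}).
Variables (f : T1 * T2 -> R) (G : T2 -> R).
Hypothesis mf : measurable_fun setT f.
Hypothesis iG : Q.-integrable setT (EFin \o G).
Hypothesis fG : forall x y, `|f (x, y)| <= G y.

Let G_ge0 y : 0 <= G y.
Proof. by apply: le_trans (fG point y). Qed.

Lemma section_integrable x : Q.-integrable setT (fun y => (f (x, y))%:E).
Proof.
apply: (le_integrable _ _ _ iG) => //.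
  by apply/measurable_EFinP; apply: measurableT_comp mf _.
by move=> y _ /=; rewrite lee_fin (ger0_norm (G_ge0 y)).
Qed.

Let iGfin : (\int[Q]_y (G y)%:E < +oo)%E.
Proof.
move/integrableP: iG => [_]; under eq_integral do rewrite gee0_abs ?lee_fin//.
by [].
Qed.

(** The majorant depends on y alone and [P] is finite, so the double integral of |f| is at most the
    mass of [P] times the integral of [G]. [Q] is allowed to be sigma-finite because it will be
    Lebesgue measure on the line in [duality]. *)
Lemma dominated_integrable_prod : (P \x Q)%E.-integrable setT (EFin \o f).
Proof.
apply/integrable12ltyP; first exact/measurable_EFinP.
apply: (@le_lt_trans _ _ (\int[P]_x (\int[Q]_y (G y)%:E))%E).
  apply: ge0_le_integral => //.
  - by move=> x _; apply: integral_ge0.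
  - apply: (measurable_fun_fubini_tonelli_F (fun p => `|(f p)%:E|%E)) => //.
    by apply: measurableT_comp => //; exact/measurable_EFinP.
  - move=> x _; apply: ge0_le_integral => //.
    + apply: measurableT_comp => //; apply/measurable_EFinP.
      exact: measurableT_comp mf _.
    + by case/integrableP: iG.
    + by move=> y _ /=; rewrite lee_fin.
rewrite integral_cst//; apply: lte_mul_pinfty => //.
- by apply: integral_ge0 => y _; rewrite lee_fin.
- by rewrite ge0_fin_numE//; apply: integral_ge0 => y _; rewrite lee_fin.
- by rewrite ltey_eq fin_num_measure.
Qed.

Lemma bmeas_fubini_F : bmeas (fun x => \int[Q]_y f (x, y)).
Proof.
split.
  apply: (@measurableT_comp _ _ _ _ _ _ fine); first exact: fine_measurable.
  exact: (measurable_fubini_F dominated_integrable_prod).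
exists (\int[Q]_y G y) => x.
apply: le_trans (le_normr_Rintegral _ (section_integrable x)) _ => //.
apply: le_Rintegral => //.
  by have := integrable_norm (section_integrable x).
Qed.

Lemma measurable_fubini_snd : measurable_fun setT (fun y => \int[P]_x f (x, y)).
Proof.
apply: (@measurableT_comp _ _ _ _ _ _ fine); first exact: fine_measurable.
exact: (measurable_fubini_G dominated_integrable_prod).
Qed.

Let bsec y : bmeas (fun x => f (x, y)).
Proof. by split; [exact: measurableT_comp mf _ | exists (G y)]. Qed.

Lemma fubini_G_integrable : Q.-integrable setT (fun y => (\int[P]_x f (x, y))%:E).
Proof.
apply: (@le_integrable _ _ _ _ _ measurableT _ (fun y => (G y * mass P)%:E)).
- exact/measurable_EFinP/measurable_fubini_snd.
- move=> y _ /=; rewrite lee_fin [leRHS]ger0_norm ?mulr_ge0 ?mass_ge0//.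
  exact: fint_normle.
- under eq_fun do rewrite mulrC EFinM.
  exact: integrableZl.
Qed.

Lemma Rfubini : \int[P]_x (\int[Q]_y f (x, y)) = \int[Q]_y (\int[P]_x f (x, y)).
Proof.
rewrite {1}/Rintegral [RHS]/Rintegral; congr fine.
under eq_integral do rewrite fineK ?(integrable_fin_num _ (section_integrable _))//.
under [RHS]eq_integral do rewrite (EFin_fint _ (bsec _)).
exact: (Fubini dominated_integrable_prod).
Qed.

End Fubini.

Section FiniteFubini.
Context {d1 d2 : measure_display} {T1 : measurableType d1} {T2 : measurableType d2}
  {R : realType}.
Variables (P : {finite_measure set T1 -> \bar R})
  (Q : {finite_measure set T2 -> \bar R}).
Variable f : T1 * T2 -> R.
Hypothesis bf : bmeas f.

Lemma bmeas_fint_snd : bmeas (fun x => \int[Q]_y f (x, y)).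
Proof.
have [mf [C Cf]] := bf.
apply: (bmeas_fubini_F P mf (G := cst C)) => //.
exact: finite_measure_integrable_cst.
Qed.

Lemma fint_finprod : \int[finprod P Q]_z f z = \int[P]_x (\int[Q]_y f (x, y)).
Proof.
have [mf [C Cf]] := bf.
rewrite {1}/Rintegral -integral12_prod_meas1; last exact: (bmeas_integrable (finprod P Q)).
congr fine; apply: eq_integral => x _.
rewrite (EFin_fint Q)//; split; first exact: measurableT_comp mf _.
by exists C.
Qed.

End FiniteFubini.

Lemma fint_mul {d1 d2 : measure_display} {T1 : measurableType d1}
  {T2 : measurableType d2} {R : realType}
  (P : {finite_measure set T1 -> \bar R}) (Q : {finite_measure set T2 -> \bar R})
  (f : T1 -> R) (g : T2 -> R) : bmeas f -> bmeas g ->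
  \int[finprod P Q]_p (f p.1 * g p.2) = (\int[P]_x f x) * (\int[Q]_x g x).
Proof.
move=> bf bg; rewrite fint_finprod/=; last by apply: bmeasM; [exact: bmeas_fst|exact: bmeas_snd].
under eq_Rintegral do rewrite fintZl//.
by rewrite fintZr.
Qed.

Lemma fint_swap {d1 d2 : measure_display} {T1 : measurableType d1}
  {T2 : measurableType d2} {R : realType}
  (P : {finite_measure set T1 -> \bar R}) (Q : {finite_measure set T2 -> \bar R})
  (f : T1 * T2 -> R) : bmeas f ->
  \int[P]_x (\int[Q]_y f (x, y)) = \int[Q]_y (\int[P]_x f (x, y)).
Proof.
move=> [mf [C Cf]]; apply: (@Rfubini _ _ _ _ _ P Q f (cst C)) => //.
exact: finite_measure_integrable_cst.
Qed.

(** * The Fejer kernel *)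

Section OneVariable.
Context {R : realType}.
Local Notation leb := (@lebesgue_measure R).
Implicit Types x y z a c h : R.

Lemma Rintegral_derive (F f : R -> R) (a b : R) : a <= b ->
  (forall x, is_derive x 1 F (f x)) -> continuous f ->
  \int[leb]_(x in `[a, b]) f x = F b - F a.
Proof.
rewrite le_eqVlt => /predU1P[->|ab] dF cf.
  by rewrite set_itv1 Rintegral_set1 subrr.
have cF : continuous F.
  by move=> x; apply: differentiable_continuous; apply/derivable1_diffP; exact: ex_derive.
rewrite /Rintegral (@continuous_FTC2 _ f F) => //.
- exact: continuous_subspaceT.
- split; first by move=> x _; exact: ex_derive.
  + by apply: cvg_at_right_filter; exact: cF.
  + by apply: cvg_at_left_filter; exact: cF.
- by move=> x _; rewrite derive1E; exact: derive_val.
Qed.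

Definition sinc y : R := if y == 0 then 1 else sin y / y.

Lemma sincE y : sinc y * y = sin y.
Proof.
by rewrite /sinc; case: eqP => [->|/eqP y0]; rewrite ?mulr0 ?sin0 ?divfK.
Qed.

Lemma sincN y : sinc (- y) = sinc y.
Proof. by rewrite /sinc oppr_eq0 sinN invrN mulrNN. Qed.

Lemma sinc_continuous : continuous sinc.
Proof.
move=> y; have [->|y0] := eqVneq y 0; last first.
  have : {for y, continuous (fun z => sin z / z)}.
    by apply: cvgM; [exact: continuous_sin | exact: cvgV].
  rewrite /continuous_at {2}/sinc (negbTE y0) => H.
  apply: cvg_trans H; apply: near_eq_cvg.
  near=> z; rewrite /sinc ifN//.
  by near: z; apply: (@open_neq R 0 y y0) => //.
rewrite /continuous_at {2}/sinc eqxx.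
apply/cvgrPdist_lt => e e0.
have : (h^-1 *: (sin (h *: 1 + 0) - sin 0)) @[h --> 0^'] --> (cos 0 : R).
  have := is_derive_sin (0 : R); case=> dv <-; exact: dv.
rewrite cos0 => /cvgrPdist_lt/(_ _ e0).
rewrite near_withinE => H.
near=> z; rewrite /sinc; case: eqP => [_|/eqP z0]; first by rewrite subrr normr0.
have : z != 0 -> `|1 - z^-1 *: (sin (z *: 1 + 0) - sin 0)| < e by near: z.
by move=> /(_ z0); rewrite sin0 subr0 addr0 /GRing.scale/= mulr1 mulrC.
Unshelve. all: by end_near. Qed.

Lemma norm_sin_le y : `|sin y| <= `|y|.
Proof.
wlog y0 : y / 0 <= y.
  move=> H; have [|/ltW] := leP 0 y; first exact: H.
  by move=> yN; rewrite -normrN -sinN -[`|y|]normrN; apply: H; rewrite oppr_ge0.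
have cs : {within `[0, y], continuous (@sin R)}.
  by apply: continuous_subspaceT; exact: continuous_sin.
have [c _] := @MVT_segment R sin cos 0 y y0 (fun x _ => is_derive_sin x) cs.
rewrite sin0 !subr0 => ->.
by rewrite normrM ler_piMl// cos_max.
Qed.

Lemma sinc_le1 y : `|sinc y| <= 1.
Proof.
rewrite /sinc; case: eqP => [_|/eqP y0]; first by rewrite normr1.
by rewrite normrM normfV ler_pdivrMr ?normr_gt0// mul1r norm_sin_le.
Qed.

(** Continuity at 0. This bounds from below both the amplitudes created by averaging over boxes and
    the Fejer kernel near the origin. *)
Lemma sinc_half : exists2 r : R, 0 < r & forall y, `|y| <= r -> 2^-1 <= sinc y.
Proof.
have := @sinc_continuous 0; rewrite /continuous_at {2}/sinc eqxx.
move=> /cvgrPdist_lt/(_ 2^-1); rewrite invr_gt0 ltr0n => /(_ isT).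
move=> /nbhs_ballP[e /= e0 He].
exists (e / 2); first by rewrite divr_gt0.
move=> y ye; have /He /= : ball 0 e y.
  by rewrite /ball/= sub0r normrN; apply: le_lt_trans ye _; rewrite ltr_pdivrMr// ltr_pMr// ltr1n.
rewrite ltr_norml => /andP[_]; lra.
Qed.

Lemma cos_mul_sin2 x : 1 - cos x = 2 * sin (x / 2) ^+ 2.
Proof.
have {1}-> : x = (x / 2) *+ 2 by rewrite mulr2n -splitr.
by rewrite cos_mulr2n cos2sin2; ring.
Qed.

(* The Fejer kernel (1 - cos (a z)) / z ^ 2, with its limit value at z = 0. *)
Definition fejer a z : R := a ^+ 2 / 2 * sinc (a * z / 2) ^+ 2.

Lemma fejerE a z : fejer a z * z ^+ 2 = 1 - cos (a * z).
Proof.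
by rewrite /fejer cos_mul_sin2 -sincE; field.
Qed.

Lemma fejer_neq0 a z : z != 0 -> fejer a z = (1 - cos (a * z)) / z ^+ 2.
Proof. by move=> z0; rewrite -fejerE mulfK// expf_neq0. Qed.

Lemma fejer_ge0 a z : 0 <= fejer a z.
Proof. by rewrite mulr_ge0 ?sqr_ge0// divr_ge0 ?sqr_ge0. Qed.

Lemma fejer0 z : fejer 0 z = 0.
Proof. by rewrite /fejer expr0n/= !mul0r. Qed.

Lemma fejerNl a z : fejer (- a) z = fejer a z.
Proof. by rewrite /fejer sqrrN !mulNr sincN. Qed.

Lemma fejerNr a z : fejer a (- z) = fejer a z.
Proof. by rewrite /fejer mulrN mulNr sincN. Qed.

Lemma fejer_scale a z : fejer a z = a ^+ 2 * fejer 1 (a * z).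
Proof. by rewrite /fejer mul1r expr1n; ring. Qed.

Lemma continuous_fejer a : continuous (fejer a).
Proof.
move=> z; apply: cvgM; first exact: cvg_cst.
have cs : sinc (a * x / 2) @[x --> z] --> sinc (a * z / 2).
  apply: (continuous_comp (f := fun z => a * z / 2)); last exact: sinc_continuous.
  by apply: cvgM; [apply: cvgM; [exact: cvg_cst | exact: cvg_id] | exact: cvg_cst].
exact: (cvgM cs cs).
Qed.

(** Product-to-sum formula for cos (c z) cos (t z). It reduces the cosine transform of the kernel to
    the total masses given by [integral_fejer]. *)
Lemma fejer_cos c t z :
  fejer c z * cos (z * t) =
  2^-1 * (fejer (t + c) z + fejer (t - c) z) - fejer t z.
Proof.
have [->|z0] := eqVneq z 0.
  by rewrite /fejer mul0r cos0 !mulr0 !mul0r /sinc eqxx; field.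
rewrite !fejer_neq0// (mulrDl t c) (mulrBl z t c) cosD cosB (mulrC z t).
by field.
Qed.

(** The kernel is at most a ^ 2 / 2 everywhere, and its product with z ^ 2 is at most 2; the two
    bounds add up to [K]. *)
Lemma fejer_le_invD a : exists2 K : R, 0 <= K & forall z, fejer a z <= K * (1 + z ^+ 2)^-1.
Proof.
exists (a ^+ 2 / 2 + 2); first by rewrite addr_ge0// divr_ge0 ?sqr_ge0.
move=> z; rewrite ler_pdivlMr ?ltr_wpDr ?sqr_ge0// mulrDr mulr1 lerD//.
  rewrite /fejer ler_piMr ?divr_ge0 ?sqr_ge0//.
  by rewrite -[leLHS]ger0_norm ?sqr_ge0// normrX exprn_ile1 ?sinc_le1.
by rewrite fejerE; have := cos_geN1 (a * z); lra.
Qed.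

Lemma fejer_integrable a : leb.-integrable setT (EFin \o fejer a).
Proof.
have [K K0 HK] := fejer_le_invD a.
have m1 : measurable_fun setT (fun z : R => (1 + z ^+ 2)^-1).
  by apply: continuous_measurable_fun; exact: continuous_oneDsqrV.
apply: (@le_integrable _ _ _ leb _ measurableT _ (fun z => (K * (1 + z ^+ 2)^-1)%:E)).
- apply/measurable_EFinP; apply: continuous_measurable_fun; exact: continuous_fejer.
- move=> z _ /=; rewrite lee_fin ger0_norm ?fejer_ge0//.
  by apply: le_trans (HK z) _; exact: ler_norm.
- under eq_fun do rewrite EFinM.
  apply: integrableZl => //.
  apply/integrableP; split; first exact/measurable_EFinP.
  under eq_integral.
    move=> z _; rewrite /= ger0_norm ?invr_ge0 ?addr_ge0 ?sqr_ge0//; over.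
  rewrite ge0_symfun_integralT; first last.
  - by move=> z /=; rewrite sqrrN.
  - exact: continuous_oneDsqrV.
  - by move=> z; rewrite invr_ge0 addr_ge0 ?sqr_ge0.
  by rewrite -set_itvcy integral0y_oneDsqr -EFinM ltry.
Qed.

Lemma fejer_mulr_integrable a (f : R -> R) : measurable_fun setT f ->
  (forall z, `|f z| <= 1) -> leb.-integrable setT (fun z => (fejer a z * f z)%:E).
Proof.
move=> mf f1; apply: (le_integrable _ _ _ (fejer_integrable a)) => //.
  apply/measurable_EFinP; apply: measurable_funM => //.
  by apply: continuous_measurable_fun; exact: continuous_fejer.
move=> z _ /=; rewrite lee_fin normrM ler_piMr//.
Qed.

(** The number pi, which enters only through constants. *)
Definition fejer_mass : R := \int[leb]_z fejer 1 z.

Lemma fejer_mass_ge0 : 0 <= fejer_mass.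
Proof. by apply: Rintegral_ge0 => z _; exact: fejer_ge0. Qed.

Lemma integral_fejer a : \int[leb]_z fejer a z = `|a| * fejer_mass.
Proof.
wlog a0 : a / 0 <= a.
  move=> H; have [|/ltW aN] := leP 0 a; first exact: H.
  rewrite -normrN -H ?oppr_ge0//.
  by apply: eq_Rintegral => z _; rewrite fejerNl.
move: a0; rewrite le_eqVlt => /predU1P[<-|a0].
  rewrite normr0 mul0r; under eq_Rintegral do rewrite fejer0.
  by rewrite Rintegral_cst// mul0r.
rewrite (gtr0_norm a0).
have dF x : is_derive x 1 (fun x : R => a * x) a.
  have := is_deriveZ a (is_derive_id x (1 : R)).
  by rewrite /GRing.scale/= mulr1.
have dE : derive1 (fun x : R => a * x) = cst a.
  by apply/funext => x; rewrite derive1E; exact: derive_val.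
rewrite /fejer_mass {2}/Rintegral.
rewrite (@increasing_ge0_integration_by_substitutionT _ (fun x => a * x) (fejer 1)); last 9 first.
- by move=> x y; rewrite ltr_pM2l.
- by rewrite dE => x; exact: cvg_cst.
- by rewrite dE; exact: is_cvg_cst.
- by rewrite dE; exact: is_cvg_cst.
- by move=> x; exact: ex_derive.
- by under eq_fun do rewrite mulrC; apply: gt0_cvgMlNy => //; exact: cvg_id.
- by under eq_fun do rewrite mulrC; apply: gt0_cvgMly => //; exact: cvg_id.
- exact: continuous_fejer.
- exact: fejer_ge0.
rewrite dE -/(Rintegral _ _ _) /= -RintegralZl//.
  apply: eq_Rintegral => z _; rewrite /= fejer_scale /cst; ring.
have := integrableZl measurableT a^-1 (fejer_integrable a).
congr (_.-integrable _ _); apply/funext => z /=.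
by rewrite fejer_scale -EFinM /cst; congr EFin; field; rewrite gt_eqF.
Qed.

Lemma ge0_integral_opp (G : R -> R) : continuous G -> (forall x, 0 <= G x) ->
  (\int[leb]_x (G x)%:E = \int[leb]_x (G (- x))%:E)%E.
Proof.
have split_int (g : R -> R) : continuous g -> (forall x, 0 <= g x) ->
  (\int[leb]_x (g x)%:E = \int[leb]_(x in `[0%R, +oo[) (g x)%:E
                     + \int[leb]_(x in `[0%R, +oo[) (g (- x))%:E)%E.
  move=> cg g0; have mg := continuous_measurable_fun cg.
  rewrite -(setUv `[0%R, +oo[%classic) ge0_integral_setU//=; last 4 first.
  - exact: measurableC.
  - by apply/measurable_EFinP; rewrite setUv.
  - by move=> x _; rewrite lee_fin.
  - exact/disj_setPCl.
  congr (_ + _)%E; rewrite setCitvr.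
  rewrite integral_itv_bndo_bndc; last exact/measurable_EFinP/measurable_funTS.
  rewrite -{1}oppr0 ge0_integration_by_substitutionNy//.
  exact: continuous_subspaceT.
move=> cG G0; rewrite split_int// [RHS]split_int//.
- by rewrite addeC; congr (_ + _)%E; apply: eq_integral => x _; rewrite opprK.
- by move=> x; apply: (continuous_comp (f := -%R)); [exact: opp_continuous|exact: cG].
Qed.

(** The integrand is odd. Reflection is applied to the nonnegative function [G], the kernel times 1
    + sin, and the kernel itself is then subtracted from both sides. *)
Lemma integral_fejer_sin c t : \int[leb]_z (fejer c z * sin (z * t)) = 0.
Proof.
have ms : measurable_fun setT (fun z => sin (z * t)).
  by apply: measurableT_comp; [exact: (continuous_measurable_fun (@continuous_sin R)) | exact: mulrr_measurable].
have is_ := @fejer_mulr_integrable c (fun z => sin (z * t)) ms (fun z => sin_max (z * t)).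
have i1 := fejer_integrable c.
pose G z := fejer c z + fejer c z * sin (z * t).
have cG : continuous G.
  move=> z; apply: cvgD; first exact: continuous_fejer.
  apply: cvgM; first exact: continuous_fejer.
  apply: (continuous_comp (f := fun z => z * t)); last exact: continuous_sin.
  by apply: cvgM; [exact: cvg_id | exact: cvg_cst].
have G0 z : 0 <= G z.
  rewrite /G -{1}[fejer c z]mulr1 -mulrDr mulr_ge0 ?fejer_ge0//.
have /(congr1 fine) E := ge0_integral_opp cG G0.
have E1 : \int[leb]_z (fejer c z + fejer c z * sin (z * t)) =
    \int[leb]_z (fejer c z - fejer c z * sin (z * t)).
  rewrite /Rintegral E; congr fine; apply: eq_integral => z _.
  by rewrite /G fejerNr mulNr sinN mulrN.
by move: E1; rewrite RintegralD// RintegralB//; lra.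
Qed.

(** The cosine transform of [fejer c]. For c >= 0 it is the triangle function of height
    [c * fejer_mass] supported in [- c, c]; this compact support is what localises the dual form to
    near pairs. *)
Definition fejer_hat c t : R := 2^-1 * (`|t + c| + `|t - c| - 2 * `|t|) * fejer_mass.

Lemma integral_fejer_cos c p t :
  \int[leb]_z (fejer c z * cos (p + z * t)) = fejer_hat c t * cos p.
Proof.
have m_ (f : R -> R) : continuous f -> measurable_fun setT (fun z => f (z * t)).
  by move=> cf; apply: measurableT_comp; [exact: continuous_measurable_fun cf | exact: mulrr_measurable].
have ic := @fejer_mulr_integrable c (fun z => cos (z * t)) (m_ _ (@continuous_cos R)) (fun z => cos_max (z * t)).
have is_ := @fejer_mulr_integrable c (fun z => sin (z * t)) (m_ _ (@continuous_sin R)) (fun z => sin_max (z * t)).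
under eq_Rintegral.
  move=> z _; have -> : fejer c z * cos (p + z * t) =
      cos p * (fejer c z * cos (z * t)) - sin p * (fejer c z * sin (z * t)).
    by rewrite cosD; ring.
  over.
have iZ (k : R) (f : R -> R) : leb.-integrable setT (fun z => (f z)%:E) ->
    leb.-integrable setT (EFin \o (fun z => k * f z)).
  by move=> fi; have := integrableZl measurableT k fi; apply: eq_integrable.
rewrite RintegralB//; [|exact: iZ|exact: iZ].
rewrite !RintegralZl// integral_fejer_sin mulr0 subr0 mulrC; congr (_ * _).
under eq_Rintegral do rewrite fejer_cos.
have iF a := fejer_integrable a.
have iD : leb.-integrable setT (fun z => (fejer (t + c) z + fejer (t - c) z)%:E).
  by have := integrableD measurableT (iF (t + c)) (iF (t - c)); apply: eq_integrable.
rewrite RintegralB//; last exact: iZ.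
rewrite RintegralZl//.
rewrite RintegralD// !integral_fejer /fejer_hat; by field.
Qed.

Lemma fejer_hat_eq0 c t : 0 <= c -> c <= `|t| -> fejer_hat c t = 0.
Proof.
move=> c0 ct; rewrite /fejer_hat (_ : _ - _ = 0) ?mulr0 ?mul0r//.
have [t0|/ltW t0] := leP 0 t.
  rewrite (ger0_norm t0) in ct *; rewrite !ger0_norm ?subr_ge0 ?addr_ge0//; ring.
rewrite (ler0_norm t0) in ct *; rewrite (@ler0_norm _ (t + c)); last by lra.
by rewrite (@ler0_norm _ (t - c)); [ring | lra].
Qed.

Lemma fejer_hat_le c t : 0 <= c -> `|fejer_hat c t| <= c * fejer_mass.
Proof.
move=> c0; rewrite /fejer_hat normrM (ger0_norm fejer_mass_ge0).
rewrite ler_wpM2r ?fejer_mass_ge0// normrM ger0_norm// ler_pdivrMl//.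
rewrite ler_norml.
have h1 := ler_normD t c; have h2 := ler_normD t (- c); rewrite normrN in h2.
have h3 := ler_normD (t + c) (t - c); rewrite (ger0_norm c0) in h1 h2.
have h4 : `|t + c + (t - c)| = 2 * `|t|.
  have -> : t + c + (t - c) = 2 * t by ring.
  by rewrite normrM ger0_norm.
by apply/andP; split; lra.
Qed.

Lemma fejer_hat_continuous c : continuous (fejer_hat c).
Proof.
move=> t; apply: cvgM; last exact: cvg_cst.
apply: cvgM; first exact: cvg_cst.
apply: cvgB; last by apply: cvgM; [exact: cvg_cst | exact: norm_continuous].
apply: cvgD; apply: cvg_norm.
- by apply: cvgD; [exact: cvg_id | exact: cvg_cst].
- by apply: cvgB; [exact: cvg_id | exact: cvg_cst].
Qed.

(** Averaging a wave over an interval gives the wave at the centre times an amplitude;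
    [duality_bound] divides by the amplitudes to recover the pure cosine. *)
Lemma integral_box_cos x h p t : 0 <= h ->
  \int[leb]_(z in `[x - h, x + h]) cos (p + z * t) =
  2 * h * sinc (h * t) * cos (p + x * t).
Proof.
move=> h0; have xh : x - h <= x + h by lra.
have [->|t0] := eqVneq t 0.
  under eq_Rintegral do rewrite mulr0 addr0.
  rewrite Rintegral_cst// (_ : fine _ = 2 * h); last first.
    transitivity (fine (leb `[x - h, x + h])) => //.
    rewrite lebesgue_measure_itv/= lte_fin.
    by case: ltP => [_|hx]; rewrite -?EFinB/=; lra.
  by rewrite !mulr0 addr0 /sinc eqxx; ring.
pose F z := sin (p + z * t) / t.
have dF z : is_derive z 1 F (cos (p + z * t)).
  have d1 : is_derive z 1 (fun z => p + z * t) t.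
    have d0 := is_deriveD (is_derive_cst p z (1 : R)) (is_deriveM (is_derive_id z 1) (is_derive_cst t z 1)).
    by apply: (is_derive_eq d0); rewrite /GRing.scale/=; ring.
  have d2 := @is_derive1_comp R sin (fun z => p + z * t) z _ _ (is_derive_sin (p + z * t)) d1.
  have d3 := is_deriveM d2 (is_derive_cst t^-1 z (1 : R)).
  by apply: (is_derive_eq d3); rewrite /GRing.scale/=; field.
rewrite (Rintegral_derive xh dF); last first.
  move=> z; apply: (continuous_comp (f := fun z => p + z * t)); last exact: continuous_cos.
  by apply: cvgD; [exact: cvg_cst | apply: cvgM; [exact: cvg_id|exact: cvg_cst]].
have -> : 2 * h * sinc (h * t) * cos (p + x * t) = 2 * sin (h * t) * cos (p + x * t) / t.
  by rewrite -sincE; field.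
rewrite /F -mulrBl; congr (_ / _).
rewrite (_ : p + (x + h) * t = (p + x * t) + h * t); last by ring.
rewrite (_ : p + (x - h) * t = (p + x * t) - h * t); last by ring.
by rewrite sinD sinB; ring.
Qed.

End OneVariable.

(** * Duality *)

Section Box.
Context {R : realType}.
Local Notation leb := (@lebesgue_measure R).
Implicit Types x y z h : R.

Definition box h x z : R := (`|z - x| <= h)%R%:R.

Lemma boxE h x z : box h x z = \1_(`[x - h, x + h]%classic) z.
Proof.
rewrite /box indicE; congr (nat_of_bool _)%:R.
by rewrite mem_setE in_itv/= ler_distl.
Qed.

Lemma box_ge0 h x z : 0 <= box h x z. Proof. exact: ler0n. Qed.

Lemma box_le1 h x z : box h x z <= 1. Proof. by rewrite /box lern1 leq_b1. Qed.

Lemma norm_box_le1 h x z : `|box h x z| <= 1.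
Proof. by rewrite ger0_norm ?box_ge0// box_le1. Qed.

Lemma Rintegral_box h x (f : R -> R) :
  \int[leb]_z (box h x z * f z) = \int[leb]_(z in `[x - h, x + h]) f z.
Proof.
rewrite [RHS]Rintegral_mkcond; apply: eq_Rintegral => z _.
by rewrite boxE patchE indicE; case: (_ \in _); rewrite ?mul1r ?mul0r.
Qed.

Lemma integrable_box h x : leb.-integrable setT (EFin \o box h x).
Proof.
have -> : EFin \o box h x = EFin \o \1_(`[x - h, x + h]%classic).
  by apply/funext => z /=; rewrite boxE.
exact: (integrable_indic_itv (x - h) (x + h) true false).
Qed.

Lemma Rintegral_box1 h x : 0 <= h -> \int[leb]_z box h x z = 2 * h.
Proof.
move=> h0; under eq_Rintegral do rewrite -[box _ _ _]mulr1.
rewrite Rintegral_box Rintegral_cst// mul1r.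
transitivity (fine (leb `[x - h, x + h])) => //.
rewrite lebesgue_measure_itv/= lte_fin.
by case: ltP => [_|hx]; rewrite -?EFinB/=; lra.
Qed.

Lemma measurable_box d (T : measurableType d) h (f g : T -> R) :
  measurable_fun setT f -> measurable_fun setT g ->
  measurable_fun setT (fun t => box h (f t) (g t)).
Proof.
move=> mf mg; have mb : measurable_fun setT (fun t => `|g t - f t| <= h).
  apply: measurable_fun_ler; last exact: measurable_cst.
  by apply: measurableT_comp => //; exact: measurable_funB.
have -> : (fun t => box h (f t) (g t)) = (fun t => if `|g t - f t| <= h then 1 else 0).
  by apply/funext => t; rewrite /box; case: ifP.
by apply: measurable_fun_ifT.
Qed.

(** The length of the overlap of two intervals of radius h. *)
Definition boxker h x y : R := \int[leb]_z (box h x z * box h y z).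

Lemma integrable_boxM h x (f : R -> R) : measurable_fun setT f ->
  (forall z, `|f z| <= 1) -> leb.-integrable setT (fun z => (box h x z * f z)%:E).
Proof.
move=> mf f1; apply: (le_integrable _ _ _ (integrable_box h x)) => //.
  apply/measurable_EFinP; by apply: measurable_funM => //; apply: measurable_box.
by move=> z _ /=; rewrite lee_fin normrM ler_piMr.
Qed.

Lemma integrable_box2 h x y : leb.-integrable setT (fun z => (box h x z * box h y z)%:E).
Proof.
apply: integrable_boxM; last by move=> z; exact: norm_box_le1.
by apply: measurable_box => //; exact: measurable_cst.
Qed.

Lemma boxker_ge0 h x y : 0 <= boxker h x y.
Proof. by apply: Rintegral_ge0 => z _; rewrite mulr_ge0 ?box_ge0. Qed.

Lemma boxker_le h x y : 0 <= h -> boxker h x y <= 2 * h * (`|x - y| <= 2 * h)%R%:R.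
Proof.
move=> h0; case: (leP `|x - y| (2 * h)) => [_|xy].
  rewrite mulr1 -(Rintegral_box1 x h0); apply: le_Rintegral => //.
    exact: integrable_box2.
    exact: integrable_box.
  by move=> z _; rewrite ler_piMr ?box_ge0 ?box_le1.
rewrite mulr0 /boxker; under eq_Rintegral.
  move=> z _; have -> : box h x z * box h y z = 0.
    rewrite /box; case: (leP `|z - x| h) => [zx|]; last by rewrite mul0r.
    case: (leP `|z - y| h) => [zy|]; last by rewrite mulr0.
    move: xy; rewrite ltNge (_ : x - y = (z - y) - (z - x)); last by ring.
    move=> /negP[]; apply: le_trans (ler_normB _ _) _; lra.
  over.
by rewrite Rintegral_cst// mul0r.
Qed.

Lemma measurable_boxker d (T : measurableType d) h (f g : T -> R) :
  measurable_fun setT f -> measurable_fun setT g ->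
  measurable_fun setT (fun t => boxker h (f t) (g t)).
Proof.
move=> mf mg.
apply: (@measurableT_comp _ _ _ _ _ _ fine); first exact: fine_measurable.
pose F (p : T * R) : \bar R := (box h (f p.1) p.2 * box h (g p.1) p.2)%:E.
have := @measurable_fun_fubini_tonelli_F _ _ T _ R leb F; apply.
  apply/measurable_EFinP; apply: measurable_funM.
    exact: (measurable_box _ (measurableT_comp mf measurable_fst) measurable_snd).
  exact: (measurable_box _ (measurableT_comp mg measurable_fst) measurable_snd).
by move=> p; rewrite lee_fin mulr_ge0 ?box_ge0.
Qed.

Lemma bmeas_boxker d (T : measurableType d) h (f g : T -> R) : 0 <= h ->
  measurable_fun setT f -> measurable_fun setT g ->
  bmeas (fun t => boxker h (f t) (g t)).
Proof.
move=> h0 mf mg; split; first exact: measurable_boxker.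
exists (2 * h) => t; rewrite ger0_norm ?boxker_ge0//.
apply: le_trans (boxker_le _ _ h0) _; rewrite ler_piMr ?mulr_ge0//.
by rewrite lern1 leq_b1.
Qed.

End Box.

Section Duality.
Context {d1 d2 : measure_display} {O1 : measurableType d1} {O2 : measurableType d2}
  {R : realType}.
Local Notation leb := (@lebesgue_measure R).
Variables (n : {finite_measure set O1 -> \bar R}) (m : {finite_measure set O2 -> \bar R}).
Variables (X : nat -> O1 -> R) (xi : nat -> O2 -> R) (h r c b : R).
Hypotheses (mX : forall i, measurable_fun setT (X i))
  (mxi : forall i, measurable_fun setT (xi i)).
Hypotheses (h_ge0 : 0 <= h) (c_ge0 : 0 <= c) (b_ge0 : 0 <= b).
Hypothesis X_le : forall i o, `|X i o| <= r.
Hypothesis fejer_ge1 : forall z, `|z| <= r + h -> 1 <= b * fejer c z.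

Let amp D (q : O2) : R := \prod_(i < D) (2 * h * sinc (h * xi i q)).
Let phase D (p : O1 * O2) : R := \sum_(i < D) X i p.1 * xi i p.2.
Let kerX D (p : O1 * O1) : R := \prod_(i < D) boxker h (X i p.1) (X i p.2).
Let kerxi D (p : O2 * O2) : R :=
  \prod_(i < D) (b * fejer_hat c (xi i p.1 - xi i p.2)).

Let osc D (f : O2 -> R) (u : O1 -> R) (w : O2 -> R) (p : O1 * O2) : R :=
  amp D p.2 * cos (f p.2 + phase D p) * (u p.1 * w p.2).
Let formX D (u : O1 -> R) (p : O1 * O1) : R := kerX D p * (u p.1 * u p.2).
Let formxi D (f w : O2 -> R) (p : O2 * O2) : R :=
  kerxi D p * cos (f p.1 - f p.2) * (w p.1 * w p.2).

Let bamp D : bmeas (amp D).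
Proof.
apply: bmeas_prod => i; apply: bmeasM; first exact: bmeas_cst.
apply: (bmeas_comp sinc_continuous sinc_le1).
by apply: measurable_funM => //; exact: mxi.
Qed.

Let mphase D : measurable_fun setT (phase D).
Proof.
apply: measurable_sum => i; apply: measurable_funM.
  exact: measurableT_comp (mX i) measurable_fst.
exact: measurableT_comp (mxi i) measurable_snd.
Qed.

Let bkerX D : bmeas (kerX D).
Proof.
apply: bmeas_prod => i; apply: bmeas_boxker => //.
  exact: measurableT_comp (mX i) measurable_fst.
exact: measurableT_comp (mX i) measurable_snd.
Qed.

Let bkerxi D : bmeas (kerxi D).
Proof.
apply: bmeas_prod => i; apply: bmeasM; first exact: bmeas_cst.
apply: (bmeas_comp (@fejer_hat_continuous R c) (fun t => @fejer_hat_le R c t c_ge0)).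
apply: measurable_funB.
  exact: measurableT_comp (mxi i) measurable_fst.
exact: measurableT_comp (mxi i) measurable_snd.
Qed.

Let bformxi D f w : measurable_fun setT f -> bmeas w -> bmeas (formxi D f w).
Proof.
move=> mf bw; apply: bmeasM; last by apply: bmeasM; [exact: bmeas_fst|exact: bmeas_snd].
apply: bmeasM => //; apply: bmeas_cos; apply: measurable_funB.
  exact: measurableT_comp mf measurable_fst.
exact: measurableT_comp mf measurable_snd.
Qed.

Let duality_base f u w : measurable_fun setT f -> bmeas u -> bmeas w ->
  2 * \int[finprod n m]_p osc 0 f u w p <=
  \int[finprod n n]_p formX 0 u p + \int[finprod m m]_p formxi 0 f w p.
Proof.
move=> mf bu bw.
have bc : bmeas (fun q => cos (f q) * w q) by apply: bmeasM => //; exact: bmeas_cos.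
have bs : bmeas (fun q => sin (f q) * w q) by apply: bmeasM => //; exact: bmeas_sin.
pose U := \int[n]_x u x; pose C := \int[m]_q (cos (f q) * w q).
pose S := \int[m]_q (sin (f q) * w q).
have -> : \int[finprod n m]_p osc 0 f u w p = U * C.
  rewrite -fint_mul//; apply: eq_Rintegral => p _.
  by rewrite /osc /amp /phase !big_ord0 addr0 mul1r; ring.
have -> : \int[finprod n n]_p formX 0 u p = U * U.
  rewrite -fint_mul//; apply: eq_Rintegral => p _.
  by rewrite /formX /kerX big_ord0 mul1r.
have -> : \int[finprod m m]_p formxi 0 f w p = C * C + S * S.
  rewrite -!fint_mul// -fintD.
  - apply: eq_Rintegral => p _.
    by rewrite /formxi /kerxi big_ord0 cosB mul1r; ring.
  - exact: bmeasM (bmeas_fst bc) (bmeas_snd bc).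
  - exact: bmeasM (bmeas_fst bs) (bmeas_snd bs).
by have := sqr_ge0 (U - C); have := sqr_ge0 S; nra.
Qed.

(* A TT* argument without Fourier transforms: in each of the three kernels, the
   factor of index D is an integral over z (of a box times a cosine, of two
   boxes, of a Fejer kernel times a cosine), so the claim for D.+1 is the claim
   for D integrated over z, with f q + z * xi D q for f and u restricted to
   |X D - z| <= h. For D = 0 it is 2 U C <= U^2 + C^2 + S^2. *)
Theorem duality D f u w : measurable_fun setT f -> bmeas u -> bmeas w ->
  2 * \int[finprod n m]_p osc D f u w p <=
  \int[finprod n n]_p formX D u p + \int[finprod m m]_p formxi D f w p.
Proof.
elim: D f u w => [|D IH] f u w mf bu bw; first exact: duality_base.
pose uz z o := u o * box h (X D o) z.
pose fz z q := f q + z * xi D q.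
have muz z : bmeas (uz z).
  apply: bmeasM => //; split; last by exists 1 => o; exact: norm_box_le1.
  by apply: measurable_box.
have mfz z : measurable_fun setT (fz z).
  by apply: measurable_funD => //; exact: measurable_funM.
(* With u = 0 the first two forms vanish, so the induction hypothesis says that the third form is
   nonnegative. *)
have pos2 g v : measurable_fun setT g -> bmeas v -> 0 <= \int[finprod m m]_p formxi D g v p.
  move=> mg bv; have := IH g (cst 0) v mg (bmeas_cst 0) bv.
  have -> : \int[finprod n m]_p osc D g (cst 0) v p = 0.
    under eq_Rintegral do rewrite /osc mul0r mulr0.
    by rewrite fint_cst mul0r.
  have -> : \int[finprod n n]_p formX D (cst 0) p = 0.
    under eq_Rintegral do rewrite /formX mul0r mulr0.
    by rewrite fint_cst mul0r.
  by rewrite mulr0 add0r.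
have iG K : leb.-integrable setT (EFin \o (fun z => K * box (r + h) 0 z)).
  have := integrableZl measurableT K (integrable_box (r + h) 0).
  by apply: eq_integrable.
(* Since |X| <= r, all the boxes lie in [- (r + h), r + h]; this is the common majorant for the
   exchanges of integrals below. *)
have box_dom o z : box h (X D o) z <= box (r + h) 0 z.
  rewrite /box subr0; case: (leP `|z - X D o| h) => [zX|_]; last exact: ler0n.
  rewrite (_ : `|z| <= _)//.
  by rewrite -(subrK (X D o) z) addrC; apply: le_trans (ler_normD _ _) _; exact: lerD.
have mg (d : measure_display) (T : measurableType d) (g : T -> R) :
    bmeas g -> measurable_fun setT g by case.
have fubini d (T : measurableType d) (P : {finite_measure set T -> \bar R})
    (F : T * R -> R) (G : R -> R) : measurable_fun setT F ->
    leb.-integrable setT (EFin \o G) -> (forall x z, `|F (x, z)| <= G z) ->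
    leb.-integrable setT (fun z => (\int[P]_x F (x, z))%:E) /\
    \int[P]_x (\int[leb]_z F (x, z)) = \int[leb]_z (\int[P]_x F (x, z)).
  move=> mF iG' FG; split; first exact: (@fubini_G_integrable _ _ _ _ _ P leb F G mF iG' FG).
  exact: (@Rfubini _ _ _ _ _ P leb F G mF iG' FG).
pose F0 (p : (O1 * O2) * R) := osc D (fz p.2) (uz p.2) w p.1.
pose F1 (p : (O1 * O1) * R) := formX D (uz p.2) p.1.
(* The extra weight [b * fejer c z], integrated against the cosine, produces the new factor
   [b * fejer_hat c] of the kernel. *)
pose F2 (p : (O2 * O2) * R) := b * fejer c p.2 * formxi D (fz p.2) w p.1.
have mbox d (T : measurableType d) (g : T -> O1) : measurable_fun setT g ->
    measurable_fun setT (fun p : T * R => box h (X D (g p.1)) p.2).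
  move=> mg'; apply: measurable_box => //.
  by do 2 apply: measurableT_comp => //.
have [[Mu uM] [Mw wM]] := (bu.2, bw.2).
have [Ma aM] := (bamp D).2; have [Mk kM] := (bkerX D).2; have [Mx xM] := (bkerxi D).2.
have [i0 E0] : leb.-integrable setT (fun z => (\int[finprod n m]_p F0 (p, z))%:E) /\
    \int[finprod n m]_p (\int[leb]_z F0 (p, z)) = \int[leb]_z (\int[finprod n m]_p F0 (p, z)).
  apply: (fubini _ _ _ _ (fun z => Ma * (Mu * Mw) * box (r + h) 0 z)).
  - apply: measurable_funM; first apply: measurable_funM.
    + exact: measurableT_comp (mg _ _ _ (bamp D)) (measurableT_comp measurable_snd measurable_fst).
    + apply: (measurableT_comp (continuous_measurable_fun (@continuous_cos R))).
      apply: measurable_funD; last exact: measurableT_comp (mphase D) measurable_fst.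
      apply: measurable_funD; first exact: measurableT_comp mf (measurableT_comp measurable_snd measurable_fst).
      apply: measurable_funM => //.
      exact: measurableT_comp (mxi D) (measurableT_comp measurable_snd measurable_fst).
    + apply: measurable_funM; last first.
        exact: measurableT_comp (mg _ _ _ bw) (measurableT_comp measurable_snd measurable_fst).
      apply: measurable_funM; last exact: mbox.
      exact: measurableT_comp (mg _ _ _ bu) (measurableT_comp measurable_fst measurable_fst).
  - exact: iG.
  - move=> p z; rewrite /F0 /osc /uz /= !normrM.
    rewrite (ger0_norm (box_ge0 _ _ _)) (_ : _ * _ =
      `|amp D p.2| * `|cos (fz z p.2 + phase D p)| * (`|u p.1| * `|w p.2|) * box h (X D p.1) z); last by ring.
    rewrite ler_pM ?mulr_ge0 ?box_ge0// ler_pM ?mulr_ge0 ?ler_pM//.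
    by rewrite -[leRHS]mulr1 ler_pM// cos_max.
have [i1 E1] : leb.-integrable setT (fun z => (\int[finprod n n]_p F1 (p, z))%:E) /\
    \int[finprod n n]_p (\int[leb]_z F1 (p, z)) = \int[leb]_z (\int[finprod n n]_p F1 (p, z)).
  apply: (fubini _ _ _ _ (fun z => Mk * (Mu * Mu) * box (r + h) 0 z)).
  - apply: measurable_funM; first exact: measurableT_comp (mg _ _ _ (bkerX D)) measurable_fst.
    apply: measurable_funM; (apply: measurable_funM; last exact: mbox).
      exact: measurableT_comp (mg _ _ _ bu) (measurableT_comp measurable_fst measurable_fst).
    exact: measurableT_comp (mg _ _ _ bu) (measurableT_comp measurable_snd measurable_fst).
  - exact: iG.
  - move=> p z; rewrite /F1 /formX /uz /= !normrM.
    rewrite !(ger0_norm (box_ge0 _ _ _)) (_ : _ * _ =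
      `|kerX D p| * (`|u p.1| * `|u p.2|) * (box h (X D p.1) z * box h (X D p.2) z)); last by ring.
    rewrite ler_pM ?mulr_ge0 ?box_ge0//; first by rewrite ler_pM ?mulr_ge0 ?ler_pM.
    by rewrite -[leRHS]mulr1 ler_pM ?box_ge0 ?box_le1.
have [i2 E2] : leb.-integrable setT (fun z => (\int[finprod m m]_p F2 (p, z))%:E) /\
    \int[finprod m m]_p (\int[leb]_z F2 (p, z)) = \int[leb]_z (\int[finprod m m]_p F2 (p, z)).
  apply: (fubini _ _ _ _ (fun z => b * (Mx * (Mw * Mw)) * fejer c z)).
  - apply: measurable_funM.
      apply: measurable_funM; first exact: measurable_cst.
      exact: measurableT_comp (continuous_measurable_fun (@continuous_fejer R c)) measurable_snd.
    apply: measurable_funM; last first.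
      apply: measurable_funM; first exact: measurableT_comp (mg _ _ _ bw) (measurableT_comp measurable_fst measurable_fst).
      exact: measurableT_comp (mg _ _ _ bw) (measurableT_comp measurable_snd measurable_fst).
    apply: measurable_funM; first exact: measurableT_comp (mg _ _ _ (bkerxi D)) measurable_fst.
    apply: (measurableT_comp (continuous_measurable_fun (@continuous_cos R))).
    apply: measurable_funB; apply: measurable_funD.
    + exact: measurableT_comp mf (measurableT_comp measurable_fst measurable_fst).
    + apply: measurable_funM => //.
      exact: measurableT_comp (mxi D) (measurableT_comp measurable_fst measurable_fst).
    + exact: measurableT_comp mf (measurableT_comp measurable_snd measurable_fst).
    + apply: measurable_funM => //.
      exact: measurableT_comp (mxi D) (measurableT_comp measurable_snd measurable_fst).
  - by have := integrableZl measurableT (b * (Mx * (Mw * Mw))) (fejer_integrable c); apply: eq_integrable.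
  - move=> p z; rewrite /F2 /formxi /=.
    move: (fejer c z) (fejer_ge0 c z) => y y0; rewrite !normrM.
    rewrite (ger0_norm b_ge0) (ger0_norm y0).
    rewrite [leRHS](_ : _ = b * y * (Mx * (Mw * Mw))); last by ring.
    rewrite ler_wpM2l ?mulr_ge0// ler_pM ?mulr_ge0 ?ler_pM//.
    by rewrite -[leRHS]mulr1 ler_pM// cos_max.
have -> : \int[finprod n m]_p osc D.+1 f u w p = \int[leb]_z (\int[finprod n m]_p F0 (p, z)).
  rewrite -E0; apply: eq_Rintegral => p _.
  under eq_Rintegral.
    move=> z _; rewrite /F0 /osc /uz /fz /=.
    have -> : amp D p.2 * cos (f p.2 + z * xi D p.2 + phase D p) *
      (u p.1 * box h (X D p.1) z * w p.2) =
      (amp D p.2 * (u p.1 * w p.2)) * (box h (X D p.1) z * cos ((f p.2 + phase D p) + z * xi D p.2)).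
      by rewrite addrAC; ring.
    over.
  rewrite RintegralZl//; last first.
    apply: integrable_boxM => [|z]; last exact: cos_max.
    apply: (measurableT_comp (continuous_measurable_fun (@continuous_cos R))).
    by apply: measurable_funD; [exact: measurable_cst | exact: mulrr_measurable].
  rewrite Rintegral_box integral_box_cos// /osc /amp /phase !big_ord_recr/= !addrA; ring.
have -> : \int[finprod n n]_p formX D.+1 u p = \int[leb]_z (\int[finprod n n]_p F1 (p, z)).
  rewrite -E1; apply: eq_Rintegral => p _.
  under eq_Rintegral.
    move=> z _; rewrite /F1 /formX /uz /=.
    have -> : kerX D p * (u p.1 * box h (X D p.1) z * (u p.2 * box h (X D p.2) z)) =
      (kerX D p * (u p.1 * u p.2)) * (box h (X D p.1) z * box h (X D p.2) z) by ring.
    over.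
  rewrite RintegralZl//; last exact: integrable_box2.
  rewrite -/(boxker _ _ _) /formX /kerX big_ord_recr/=; ring.
have -> : \int[finprod m m]_p formxi D.+1 f w p = \int[leb]_z (\int[finprod m m]_p F2 (p, z)).
  rewrite -E2; apply: eq_Rintegral => p _.
  under eq_Rintegral.
    move=> z _; rewrite /F2 /formxi /fz /=.
    have -> : b * fejer c z * (kerxi D p * cos (f p.1 + z * xi D p.1 - (f p.2 + z * xi D p.2)) *
       (w p.1 * w p.2)) = (b * kerxi D p * (w p.1 * w p.2)) *
       (fejer c z * cos ((f p.1 - f p.2) + z * (xi D p.1 - xi D p.2))).
      rewrite (_ : f p.1 + z * xi D p.1 - _ = (f p.1 - f p.2) + z * (xi D p.1 - xi D p.2)); ring.
    over.
  rewrite RintegralZl//; last first.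
    apply: fejer_mulr_integrable => [|z]; last exact: cos_max.
    apply: (measurableT_comp (continuous_measurable_fun (@continuous_cos R))).
    by apply: measurable_funD; [exact: measurable_cst | exact: mulrr_measurable].
  rewrite integral_fejer_cos /formxi /kerxi big_ord_recr/=; ring.
rewrite -RintegralZl// -RintegralD//; apply: le_Rintegral => //.
- by have := integrableZl measurableT 2 i0; apply: eq_integrable.
- by have := integrableD measurableT i1 i2; apply: eq_integrable.
move=> z _; rewrite /F0 /F1 /F2 /= fintZl; last exact: bformxi.
(* On |z| <= r + h the weight is at least 1, and it multiplies a nonnegative form, so it only
   weakens the induction hypothesis. Beyond r + h the restricted u vanishes, and only the
   nonnegative third form remains. *)
have [zr|zr] := leP `|z| (r + h).
  apply: le_trans (IH (fz z) (uz z) w (mfz z) (muz z) bw) _.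
  rewrite lerD2l ler_peMl ?pos2//; exact: fejer_ge1.
have uz0 o : uz z o = 0.
  rewrite /uz; suff -> : box h (X D o) z = 0 by rewrite mulr0.
  apply/eqP; rewrite eq_le box_ge0 andbT; apply: le_trans (box_dom o z) _.
  by rewrite /box subr0 (leNgt `|z|) zr.
rewrite (@eq_Rintegral _ _ _ (finprod n m) _ (cst 0)); last first.
  by move=> p _; rewrite /osc uz0 mul0r mulr0.
rewrite (@eq_Rintegral _ _ _ (finprod n n) _ (cst 0)); last first.
  by move=> p _; rewrite /formX uz0 mul0r mulr0.
rewrite !fint_cst !mul0r mulr0 add0r; apply: mulr_ge0; last exact: pos2.
by rewrite (mulr_ge0 b_ge0)// fejer_ge0.
Qed.

End Duality.

(** Optimising over the scaling t of one function turns a bound by the sum of two forms into a bound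
    by their product. *)
Lemma discriminant_le (R : realFieldType) (x y z : R) : 0 <= x -> 0 <= y ->
  (forall t, 2 * (t * z) <= t ^+ 2 * x + y) -> z ^+ 2 <= x * y.
Proof.
move=> x0 y0 H; move: x0; rewrite le_eqVlt => /predU1P[x0|x0]; last first.
  have := H (z / x); rewrite -(@ler_pM2r _ x)// => H1.
  have -> : z ^+ 2 = 2 * (z / x * z) * x - z ^+ 2 by field; rewrite gt_eqF.
  rewrite lerBlDr; apply: le_trans H1 _.
  by rewrite le_eqVlt; apply/orP; left; apply/eqP; field; rewrite gt_eqF.
(* If x = 0 the hypothesis bounds a linear function of t, so z must vanish: otherwise the chosen t
   gives y + 1 <= y. *)
rewrite -x0 mul0r; have [->|z0] := eqVneq z 0; first by rewrite expr0n.
have := H ((y + 1) / (2 * z)); rewrite -x0 mulr0 add0r.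
have -> : 2 * ((y + 1) / (2 * z) * z) = y + 1 by field.
by rewrite gerDl ler10.
Qed.

Section NearPairs.
Context {d : measure_display} {O : measurableType d} {R : realType}.
Variable n : {finite_measure set O -> \bar R}.

Definition near_pairs D (X : nat -> O -> R) h (p : O * O) : R :=
  \prod_(i < D) box h (X i p.2) (X i p.1).

Lemma bmeas_near_pairs D X h : (forall i, measurable_fun setT (X i)) ->
  bmeas (near_pairs D X h).
Proof.
move=> mX; apply: bmeas_prod => i; split; last by exists 1 => p; exact: norm_box_le1.
apply: measurable_box; first exact: measurableT_comp (mX i) measurable_snd.
exact: measurableT_comp (mX i) measurable_fst.
Qed.

Lemma near_pairs_ge0 D X h p : 0 <= near_pairs D X h p.
Proof. by apply: prodr_ge0 => i _; exact: box_ge0. Qed.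

Lemma near_pairs_int_ge0 D X h : 0 <= \int[finprod n n]_p near_pairs D X h p.
Proof. by apply: Rintegral_ge0 => p _; exact: near_pairs_ge0. Qed.

(** For fixed x the near y lie in [A x], so the inner integral is at most [K]. The Frostman
    condition will enter through [K]. *)
Lemma near_pairs_bound D (X : nat -> O -> R) h K (A : O -> set O) :
  (forall i, measurable_fun setT (X i)) -> 0 <= K ->
  (forall x, measurable (A x)) -> (forall x, (n (A x) <= K%:E)%E) ->
  (forall x y, (forall i, (i < D)%N -> `|X i x - X i y| <= h) -> A x y) ->
  \int[finprod n n]_p near_pairs D X h p <= K * mass n.
Proof.
move=> mX K0 mA nA sub; have bn := bmeas_near_pairs D h mX.
rewrite fint_finprod// -fint_cst; apply: fint_le.
- exact: bmeas_fint_snd.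
- exact: bmeas_cst.
move=> x; apply: (@le_trans _ _ (\int[n]_y \1_(A x) y)).
  apply: fint_le.
  - by apply: (bmeas_compr (h := fun y => (x, y))) => //; exact: measurable_pair1.
  - exact: bmeas_indic.
  move=> y; rewrite indicE; case: (boolP (y \in A x)) => [_|yA].
    by apply: prodr_ile1 => i _; rewrite box_ge0 box_le1.
  rewrite le_eqVlt; apply/orP; left; apply/eqP; apply/eqP.
  apply: contraNT yA => /prodf_neq0 H; apply/mem_set/sub => i iD.
  by have := H (Ordinal iD) isT; rewrite /box/=; case: (_ <= h)%R; rewrite ?eqxx.
rewrite fint_indic//; have := nA x.
by rewrite -[X in (X <= _)%E]fineK ?fin_num_measure// lee_fin.
Qed.

End NearPairs.

Section DualityBound.
Context {d1 d2 : measure_display} {O1 : measurableType d1} {O2 : measurableType d2}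
  {R : realType}.
Variables (n : {finite_measure set O1 -> \bar R}) (m : {finite_measure set O2 -> \bar R}).
Variables (X : nat -> O1 -> R) (xi : nat -> O2 -> R) (h r c b : R).
Hypotheses (mX : forall i, measurable_fun setT (X i))
  (mxi : forall i, measurable_fun setT (xi i)).
Hypotheses (h_gt0 : 0 < h) (c_ge0 : 0 <= c) (b_ge0 : 0 <= b).
Hypothesis X_le : forall i o, `|X i o| <= r.
Hypothesis fejer_ge1 : forall z, `|z| <= r + h -> 1 <= b * fejer c z.
Hypothesis sinc_ge : forall i o, 2^-1 <= sinc (h * xi i o).

(** This is [duality] with [u] a constant t and [w = g / amp], optimised over t. The two kernels
    vanish off near pairs: [boxker] beyond distance 2 h, [fejer_hat] beyond c. The division by h ^ 2
    comes from the two factors [w], each at most 1 / h ^ D. *)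
Lemma duality_bound D (g : O2 -> R) : bmeas g -> (forall q, `|g q| <= 1) ->
  (\int[finprod n m]_p (g p.2 * cos (\sum_(i < D) X i p.1 * xi i p.2))) ^+ 2 <=
  ((2 * h) ^+ D * \int[finprod n n]_p near_pairs D X (2 * h) p) *
  ((b * (c * fejer_mass) / h ^+ 2) ^+ D * \int[finprod m m]_p near_pairs D xi c p).
Proof.
move=> bg g1; have h_ge0 := ltW h_gt0.
pose amp q := \prod_(i < D) (2 * h * sinc (h * xi i q)).
(* Each factor is at least 2 h times 1/2. *)
have amp_ge q : h ^+ D <= amp q.
  rewrite -[D in h ^+ D]card_ord -prodr_const; apply: ler_prod => i _.
  by rewrite h_ge0/=; have := sinc_ge i q; have := h_gt0; nra.
have amp_gt0 q : 0 < amp q by apply: lt_le_trans (amp_ge q); rewrite exprn_gt0.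
pose w q := g q / amp q.
have mamp : measurable_fun setT amp.
  apply: measurable_prod => i _; apply: measurable_funM => //.
  apply: (measurableT_comp (continuous_measurable_fun (@sinc_continuous R))).
  by apply: measurable_funM => //; exact: mxi.
have wle q : `|w q| <= (h ^+ D)^-1.
  rewrite normrM normfV (gtr0_norm (amp_gt0 q)) -[leRHS]mul1r ler_pM//.
    by rewrite invr_ge0 ltW.
  by rewrite lef_pV2 ?posrE ?exprn_gt0.
have bw : bmeas w.
  split; last by exists (h ^+ D)^-1.
  apply: measurable_funM; first exact: bg.1.
  have -> : (fun q => (amp q)^-1) = (fun q => powR (amp q) (-1)).
    by apply/funext => q; rewrite powR_inv1// ltW.
  exact: (measurableT_comp (@measurable_powR R (-1)) mamp).
pose kX p := \prod_(i < D) boxker h (X i p.1) (X i p.2).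
pose kxi p := \prod_(i < D) (b * fejer_hat c (xi i p.1 - xi i p.2)) * (w p.1 * w p.2).
have bkX : bmeas kX.
  apply: bmeas_prod => i; apply: bmeas_boxker => //.
    exact: measurableT_comp (mX i) measurable_fst.
  exact: measurableT_comp (mX i) measurable_snd.
have bkxi : bmeas kxi.
  apply: bmeasM; last by apply: bmeasM; [exact: bmeas_fst | exact: bmeas_snd].
  apply: bmeas_prod => i; apply: bmeasM; first exact: bmeas_cst.
  apply: (bmeas_comp (@fejer_hat_continuous R c) (fun t => @fejer_hat_le R c t c_ge0)).
  apply: measurable_funB.
    exact: measurableT_comp (mxi i) measurable_fst.
  exact: measurableT_comp (mxi i) measurable_snd.
set I := \int[_]_p _; pose A := \int[finprod n n]_p kX p; pose B := \int[finprod m m]_p kxi p.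
have A0 : 0 <= A by apply: Rintegral_ge0 => p _; apply: prodr_ge0 => i _; exact: boxker_ge0.
have key t : 2 * (t * I) <= t ^+ 2 * A + B.
  have H := duality n m mX mxi h_ge0 c_ge0 b_ge0 X_le fejer_ge1 D
    (measurable_cst (0 : R)) (bmeas_cst t) bw.
  have bI : bmeas (fun p : O1 * O2 => g p.2 * cos (\sum_(i < D) X i p.1 * xi i p.2)).
    apply: bmeasM; first exact: bmeas_snd.
    apply: bmeas_cos; apply: measurable_sum => i; apply: measurable_funM.
      exact: measurableT_comp (mX i) measurable_fst.
    exact: measurableT_comp (mxi i) measurable_snd.
  rewrite -(fintZl _ _ bI) -(fintZl _ _ bkX); apply: etrans H.
  congr (2 * _ <= _ + _); apply: eq_Rintegral => p _ /=.
  - by rewrite add0r /w -/(amp p.2); field; exact: lt0r_neq0.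
  - by rewrite /kX; ring.
  - by rewrite subrr cos0 /kxi; ring.
have B0 : 0 <= B by have := key 0; rewrite !(mul0r, mulr0) expr0n/= mul0r add0r.
apply: le_trans (discriminant_le A0 B0 key) _.
apply: ler_pM => //.
- rewrite -fintZl; last exact: bmeas_near_pairs.
  apply: fint_le => //.
    by apply: bmeasM; [exact: bmeas_cst | exact: bmeas_near_pairs].
  move=> p; rewrite /near_pairs -[D in _ ^+ D]card_ord -prodr_const -big_split/=.
  by apply: ler_prod => i _; rewrite boxker_ge0/= /box boxker_le.
- rewrite -fintZl; last exact: bmeas_near_pairs.
  apply: fint_le => //.
    by apply: bmeasM; [exact: bmeas_cst | exact: bmeas_near_pairs].
  move=> p; apply: le_trans (ler_norm _) _; rewrite /kxi normrM normr_prod (normrM (w p.1)).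
  have -> : (b * (c * fejer_mass) / h ^+ 2) ^+ D * near_pairs D xi c p =
      (\prod_(i < D) ((b * (c * fejer_mass)) * box c (xi i p.2) (xi i p.1))) *
      ((h ^+ D)^-1 * (h ^+ D)^-1).
    rewrite big_split/= prodr_const card_ord -/(near_pairs D xi c p) expr_div_n -exprM mulnC exprM.
    by field; rewrite expf_neq0// gt_eqF.
  apply: ler_pM => //; first by apply: prodr_ge0.
    apply: ler_prod => i _; rewrite normr_ge0/= normrM (ger0_norm b_ge0) -mulrA ler_wpM2l//.
    rewrite /box; case: (leP `|_ - _| c) => [_|].
      by rewrite mulr1 fejer_hat_le.
    by move=> /ltW ct; rewrite fejer_hat_eq0// normr0 mulr0.
  by rewrite ler_pM.
Qed.

End DualityBound.

(** * Dyadic blocks for a Frostman measure *)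

Section Clamp.
Context {R : realType}.
Local Notation leb := (@lebesgue_measure R).
Implicit Types a b t : R.

(* The measure leb_itv a b lives on the whole line; clamp a b turns a variable
   into a globally bounded function that agrees with it on [a, b]. *)
Definition clamp a b t : R := Num.max a (Num.min b t).

Lemma clamp_itv a b t : a <= b -> a <= clamp a b t <= b.
Proof. by move=> ab; rewrite /clamp le_max lexx/= ge_max ab ge_min lexx. Qed.

Lemma clamp_id a b t : a <= t <= b -> clamp a b t = t.
Proof. by move=> /andP[at_ tb]; rewrite /clamp min_r// max_r. Qed.

Lemma measurable_clamp a b : measurable_fun [set: measurableTypeR R] (clamp a b).
Proof.
apply: measurable_maxr; first exact: measurable_cst.
by apply: measurable_minr; first exact: measurable_cst.
Qed.

Lemma leb_itv_lty a b : (leb `[a, b] < +oo)%E.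
Proof. by rewrite lebesgue_measure_itv/=; case: ifP => _; rewrite -?EFinB ltry. Qed.

Definition leb_itv a b : {finite_measure set (measurableTypeR R) -> \bar R} :=
  @mfrestr _ (measurableTypeR R) R `[a, b] leb (measurable_itv `[a, b]) (leb_itv_lty a b).

Lemma mass_leb_itv a b : a <= b -> mass (leb_itv a b) = b - a.
Proof.
move=> ab; transitivity (fine (leb ([set: measurableTypeR R] `&` `[a, b]))) => //.
rewrite setTI.
rewrite lebesgue_measure_itv/= lte_fin; move: ab; rewrite le_eqVlt => /predU1P[->|->].
  by rewrite ltxx subrr.
by rewrite -EFinB.
Qed.

Lemma fint_leb_itv a b (f : measurableTypeR R -> R) : bmeas f ->
  \int[leb_itv a b]_x f x = \int[leb]_(x in `[a, b]) f x.
Proof.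
move=> bf; rewrite /Rintegral; congr fine.
rewrite (@negligible_integral _ _ _ (leb_itv a b) setT (~` `[a, b]%classic))//; last 3 first.
- exact: measurableC.
- exact: bmeas_integrable.
- by rewrite /leb_itv/= /mfrestr /mrestr setICl measure0.
rewrite setTD setCK; apply: eq_measure_integral => A mA Aab.
by rewrite /leb_itv/= /mfrestr /mrestr setIidl.
Qed.

Lemma measurable_clamp_near a b u r :
  measurable ([set t | `|u - clamp a b t| <= r] : set (measurableTypeR R)).
Proof.
rewrite -[X in measurable X]setTI.
apply: (measurable_fun_ler _ _ measurableT) => //.
apply: measurableT_comp => //; apply: measurable_funB => //.
exact: measurable_clamp.
Qed.

Lemma leb_itv_near a b u r : a <= b -> 0 <= r ->
  (leb_itv a b [set t | `|u - clamp a b t| <= r]%R <= (2 * r)%:E)%E.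
Proof.
move=> ab r0; rewrite /leb_itv/= /mfrestr /mrestr.
apply: (@le_trans _ _ (leb `[u - r, u + r])).
  apply: le_measure; rewrite ?inE//.
    by apply: measurableI => //; exact: measurable_clamp_near.
  move=> t [/= tu]; rewrite !in_itv/= => tab.
  by rewrite clamp_id// in tu; rewrite -ler_distlC.
rewrite lebesgue_measure_itv/= lte_fin; case: ltP => _.
  by rewrite -EFinB lee_fin; lra.
by rewrite lee_fin; lra.
Qed.

End Clamp.

(** If two dilated vectors are near and so are the dilations, then the vectors themselves are near.
    This recovers Frostman balls from [near_pairs]. *)
Lemma near_of_scaled (R : realFieldType) (L l l' c c' e1 e2 rho : R) :
  0 < L -> L <= l -> `|l * c - l' * c'| <= e1 -> `|l - l'| <= e2 -> `|c'| <= rho ->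
  `|c - c'| <= (e1 + e2 * rho) / L.
Proof.
move=> L0 Ll H1 H2 H3; rewrite ler_pdivlMr//.
apply: (@le_trans _ _ (`|c - c'| * l)); first by rewrite ler_wpM2l.
have l0 : 0 <= l by apply: le_trans Ll; exact: ltW.
rewrite -[l in X in X <= _](ger0_norm l0) -normrM.
have -> : (c - c') * l = (l * c - l' * c') - (l - l') * c' by ring.
apply: le_trans (ler_normB _ _) _; rewrite normrM lerD// ler_pM//.
Qed.

Lemma measurable_forall_le dT (T : measurableType dT) (R : realType) (I : finType)
    (f : I -> T -> R) (r : R) : (forall j, measurable_fun setT (f j)) ->
  measurable [set y | forall j, `|f j y| <= r].
Proof.
move=> mf.
have -> : [set y | forall j, `|f j y| <= r] = \bigcap_(j in [set: I]) [set y | `|f j y| <= r].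
  by apply/seteqP; split=> y /= H j; [move=> _; exact: H | exact: H].
apply: fin_bigcap_measurable => [|j _]; first exact: finite_finset.
rewrite -[X in measurable X]setTI.
apply: (measurable_fun_ler _ _ measurableT) => //.
exact: measurableT_comp.
Qed.

Section BorelVectors.
Context {R : realType} {d : nat}.
Local Notation rV := (borel_rV R d).

Lemma open_measurable_rV (U : set 'rV[R]_d) : open U -> measurable (U : set rV).
Proof. by move=> oU; exact: sub_sigma_algebra. Qed.

Lemma closed_measurable_rV (U : set 'rV[R]_d) : closed U -> measurable (U : set rV).
Proof.
by move=> cU; rewrite -(setCK U); apply: measurableC; apply: open_measurable_rV; exact: closed_openC.
Qed.

Lemma continuous_measurable_rV (f : 'rV[R]_d -> R) : continuous f ->
  measurable_fun setT (f : rV -> R).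
Proof.
move=> cf; apply: (measurability _ (RGenOpens.measurableE R)).
move=> _ [_ [a [b ->]] <-]; rewrite setTI; apply: open_measurable_rV.
by move/continuousP: cf; apply; exact: interval_open.
Qed.

Lemma measurable_coord (j : 'I_d) : measurable_fun setT (fun x : rV => x ord0 j).
Proof. by apply: continuous_measurable_rV; exact: coord_continuous. Qed.

End BorelVectors.

Section Frostman.
Context {R : realType} {d : nat}.
Local Notation rV := (borel_rV R d).
Local Notation RR := (measurableTypeR R).
Variables (mu : {finite_measure set rV -> \bar R}) (E : set rV) (rho A0 s : R).
Hypotheses (mE : measurable E) (muE : mu (~` E) = 0%E).
Hypotheses (rho_ge1 : 1 <= rho) (E_rho : forall (x : rV) j, E x -> `|x ord0 j| <= rho).
Hypothesis A0_ge0 : 0 <= A0.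
Hypothesis frost : forall (x : 'rV[R]_d) (r : R), 0 < r ->
  (mu (E `&` [set y : rV | forall j, `|x ord0 j - y ord0 j| <= r]%R) <= (A0 * r `^ s)%:E)%E.

(* Coordinates cut off outside E: everywhere bounded, and unchanged mu-almost everywhere. *)
Definition cutcoord (j : 'I_d) (x : rV) : R := x ord0 j * \1_E x.

Definition cutdot (x y : rV) : R := \sum_j cutcoord j x * cutcoord j y.

Lemma cutdotE x y : E x -> E y -> cutdot x y = dot x y.
Proof.
move=> Ex Ey; apply: eq_bigr => j _; rewrite /cutcoord !indicE !mem_set//=.
by rewrite !mulr1.
Qed.

Let measurable_cutcoord j : measurable_fun setT (cutcoord j).
Proof. by apply: measurable_funM; [exact: measurable_coord | exact: measurable_indic]. Qed.

Let cutcoord_le j x : `|cutcoord j x| <= rho.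
Proof.
rewrite /cutcoord indicE; case: (boolP (x \in E)) => [/set_mem Ex|_].
  by rewrite mulr1; exact: E_rho.
by rewrite mulr0 normr0; apply: le_trans rho_ge1.
Qed.

Lemma measurable_cutdot dT (T : measurableType dT) (f g : T -> rV) :
  measurable_fun setT f -> measurable_fun setT g ->
  measurable_fun setT (fun t => cutdot (f t) (g t)).
Proof.
move=> mf mg; apply: measurable_sum => j; apply: measurable_funM.
  exact: measurableT_comp (measurable_cutcoord j) mf.
exact: measurableT_comp (measurable_cutcoord j) mg.
Qed.

Let near x r : set rV := [set y | forall j, `|cutcoord j x - cutcoord j y| <= r].

Let measurable_near x r : measurable (near x r).
Proof. by apply: measurable_forall_le => j; exact: measurable_funB. Qed.

Let mu_near x r : 0 < r -> (mu (near x r) <= (A0 * r `^ s)%:E)%E.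
Proof.
(* The centre is the cut-off vector, which is 0 when x lies outside [E]; the Frostman bound is
   available for every centre. *)
move=> r0; pose x0 : 'rV[R]_d := \row_j cutcoord j x.
pose Q : set rV := [set y | forall j, `|x0 ord0 j - y ord0 j| <= r].
have mQ : measurable Q.
  by apply: measurable_forall_le => j; apply: measurable_funB => //; exact: measurable_coord.
have sub : near x r `<=` (E `&` Q) `|` ~` E.
  move=> y ny; have [Ey|] := pselect (E y); last by right.
  left; split => // j; have := ny j; rewrite /x0 mxE.
  by rewrite {2}/cutcoord indicE mem_set// mulr1.
have mEQ : measurable (E `&` Q) by exact: measurableI.
apply: (@le_trans _ _ (mu ((E `&` Q) `|` ~` E))).
  by apply: le_measure; rewrite ?inE//; apply: measurableU => //; exact: measurableC.
apply: le_trans (measureU2 _ mEQ (measurableC mE)) _.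
by rewrite [X in (_ + X)%E](_ : _ = 0%E) ?adde0; [exact: frost | exact: muE].
Qed.

Definition osc_kernel (t : R) T (p : (RR * rV) * (RR * rV)) : R :=
  cos (clamp 1 2 p.1.1 * clamp T (2 * T) p.2.1 * (cutdot p.1.2 p.2.2 - t)).

Lemma powR_half_subK (T : R) D : 1 <= T ->
  (T `^ (D%:R / 2 - s)) ^+ 2 = T ^+ D / (T `^ s) ^+ 2.
Proof.
move=> T1; have T0 : 0 < T by apply: lt_le_trans T1.
rewrite powRB; last by rewrite (gt_eqF T0) implybT.
rewrite expr_div_n; congr (_ / _).
by rewrite -(powR_mulrn 2) ?powR_ge0// -powRrM divfK// powR_mulrn// ltW.
Qed.

(* lam tau (x . y - t) is the inner product of lam (x, - t) and tau (y, 1) in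
   dimension d + 1; X and xi below are these vectors, index d being the last
   coordinate. *)
Lemma block_bound (a t1 : R) : 0 < a -> exists2 C : R, 0 <= C &
  forall (t T : R) (g : RR * rV -> R), a <= t <= t1 -> 1 <= T ->
    bmeas g -> (forall q, `|g q| <= 1) ->
    `|\int[finprod (finprod (leb_itv 1 2) mu) (finprod (leb_itv T (2 * T)) mu)]_p
       (g p.2 * osc_kernel t T p)| <= C * T `^ (d.+1%:R / 2 - s).
Proof.
move=> a0; have [r0' r0'0 sinc_ge] := @sinc_half R.
pose r0 := Num.min r0' 1; have r00 : 0 < r0 by rewrite /r0 lt_min r0'0 ltr01.
have rho0 : 0 < rho by apply: lt_le_trans rho_ge1.
(* With h = kap / T and |xi| <= 2 T rho, [kap] keeps |h xi| within [r0], where [sinc] is at least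
   1/2. The bound [r] on |X| comes from lam <= 2. *)
pose kap := r0 / (2 * rho); pose r := 2 * (rho + `|t1|).
have kap0 : 0 < kap by rewrite divr_gt0// mulr_gt0.
have kap1 : kap <= 1.
  rewrite ler_pdivrMr ?mulr_gt0// mul1r; apply: (@le_trans _ _ 1); first by rewrite ge_min lexx orbT.
  by have := rho_ge1; lra.
have rpos : 0 <= r by rewrite mulr_ge0// addr_ge0// ltW.
(* For |z| <= r + h <= r + 1 this gives |c z / 2| <= r0', hence [fejer c z] is at least c ^ 2 / 8,
   and [b] normalises that to 1. *)
pose c := 2 * r0' / (r + 1); pose b := 8 / c ^+ 2.
have c0 : 0 < c by rewrite divr_gt0 ?mulr_gt0// ltr_wpDl.
have b0 : 0 < b by rewrite divr_gt0// exprn_gt0.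
(* From [near_of_scaled] with errors 2 h and 2 h / a: the vectors x of near pairs differ by at most
   2 h (1 + rho / a) = kap2 / T. *)
pose kap2 := 2 * kap * (1 + rho / a).
have rhoa : 0 < 1 + rho / a by rewrite ltr_wpDr// divr_ge0// ltW.
have kap20 : 0 < kap2 by rewrite mulr_gt0// mulr_gt0.
pose M := mass mu; have M0 : 0 <= M by exact: mass_ge0.
pose B := b * (c * fejer_mass).
have B0 : 0 <= B by rewrite mulr_ge0 ?(ltW b0)// mulr_ge0 ?fejer_mass_ge0// ltW.
pose C1 := 4 * kap / a * A0 * kap2 `^ s * M.
have C10 : 0 <= C1.
  have ka : 0 <= 4 * kap / a by rewrite divr_ge0 ?(ltW a0)// mulr_ge0// ltW.
  by rewrite mulr_ge0// mulr_ge0 ?powR_ge0// mulr_ge0.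
pose C2 := 2 * c * A0 * (c * (1 + rho)) `^ s * M.
have c1 : 0 <= c * (1 + rho) by rewrite mulr_ge0 ?(ltW c0)// addr_ge0// ltW.
have C20 : 0 <= C2.
  have ka : 0 <= 2 * c by rewrite mulr_ge0// ltW.
  by rewrite mulr_ge0// mulr_ge0 ?powR_ge0// mulr_ge0.
pose Cst := (2 * B / kap) ^+ d.+1 * C1 * C2.
have Cst0 : 0 <= Cst.
  by rewrite mulr_ge0// mulr_ge0// exprn_ge0// divr_ge0 ?(ltW kap0)// mulr_ge0.
exists (Num.sqrt Cst); first exact: sqrtr_ge0.
move=> t T g /andP[at_ tt1] T1 bg g1.
have T0 : 0 < T by apply: lt_le_trans T1.
have t0 : 0 < t by apply: lt_le_trans at_.
pose h := kap / T; have h0 : 0 < h by rewrite divr_gt0.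
have h1 : h <= 1 by rewrite ler_pdivrMr// mul1r (le_trans kap1).
pose X (i : nat) (o : RR * rV) : R :=
  clamp 1 2 o.1 * (if insub i is Some j then cutcoord j o.2 else - t).
pose xi (i : nat) (q : RR * rV) : R :=
  clamp T (2 * T) q.1 * (if insub i is Some j then cutcoord j q.2 else 1).
have le12 : 1 <= 2 :> R by rewrite ler1n.
have leT2 : T <= 2 * T by rewrite ler_peMl// ltW.
have l12 (o : R) : 1 <= clamp 1 2 o <= 2 by exact: clamp_itv.
have lT (o : R) : T <= clamp T (2 * T) o <= 2 * T by exact: clamp_itv.
have mX i : measurable_fun setT (X i).
  apply: measurable_funM; first exact: measurableT_comp (measurable_clamp _ _) measurable_fst.
  case: insubP => [j _ _|_]; last exact: measurable_cst.
  exact: measurableT_comp (measurable_cutcoord j) measurable_snd.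
have mxi i : measurable_fun setT (xi i).
  apply: measurable_funM; first exact: measurableT_comp (measurable_clamp _ _) measurable_fst.
  case: insubP => [j _ _|_]; last exact: measurable_cst.
  exact: measurableT_comp (measurable_cutcoord j) measurable_snd.
have X_le i o : `|X i o| <= r.
  have /andP[la lb] := l12 o.1; rewrite /X normrM /r ler_pM//.
    by rewrite ger0_norm// (le_trans _ la).
  case: insubP => [j _ _|_]; first by rewrite (le_trans (cutcoord_le j _))// lerDl.
  rewrite normrN (gtr0_norm t0) (le_trans tt1)// (le_trans (ler_norm _))// lerDr ltW//.
have xi_le i o : `|xi i o| <= 2 * T * rho.
  have /andP[la lb] := lT o.1; rewrite /xi normrM ler_pM//.
    by rewrite ger0_norm// (le_trans _ la)// ltW.
  by case: insubP => [j _ _|_]; [exact: cutcoord_le | rewrite normr1].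
have fej z : `|z| <= r + h -> 1 <= b * fejer c z.
  move=> zr; have H : 2^-1 <= sinc (c * z / 2).
    apply: sinc_ge; rewrite (normrM (c * z)) (normrM c) (gtr0_norm c0) (@ger0_norm _ 2^-1)//.
    rewrite /c; apply: (@le_trans _ _ (2 * r0' / (r + 1) * (r + 1) / 2)).
      by rewrite ler_wpM2r// ler_wpM2l ?(ltW c0)// (le_trans zr)// lerD2l.
    by rewrite le_eqVlt; apply/orP; left; apply/eqP; field; rewrite gt_eqF// ltr_wpDl.
  have -> : b * fejer c z = 4 * sinc (c * z / 2) ^+ 2.
    by rewrite /b /fejer; field; rewrite gt_eqF.
  by nra.
have sxi i o : 2^-1 <= sinc (h * xi i o).
  apply: sinc_ge; rewrite normrM (gtr0_norm h0).
  apply: (@le_trans _ _ (h * (2 * T * rho))); first by rewrite ler_wpM2l// ltW.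
  have -> : h * (2 * T * rho) = r0.
    by rewrite /h /kap; field; rewrite !gt_eqF.
  by rewrite /r0 ge_min lexx.
have H := duality_bound (finprod (leb_itv 1 2) mu) (finprod (leb_itv T (2 * T)) mu)
  mX mxi h0 (ltW c0) (ltW b0) X_le fej sxi d.+1 bg g1.
set I := (X in `|X| <= _).
have {}H : I ^+ 2 <= ((2 * h) ^+ d.+1 *
     \int[finprod (finprod (leb_itv 1 2) mu) (finprod (leb_itv 1 2) mu)]_p
        near_pairs d.+1 X (2 * h) p) *
    ((b * (c * fejer_mass) / h ^+ 2) ^+ d.+1 *
     \int[finprod (finprod (leb_itv T (2 * T)) mu) (finprod (leb_itv T (2 * T)) mu)]_p
        near_pairs d.+1 xi c p).
  apply: le_trans H; rewrite le_eqVlt; apply/orP; left; apply/eqP; congr (_ ^+ 2).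
  apply: eq_Rintegral => p _; congr (_ * cos _).
  rewrite big_ord_recr/= /X /xi; case: insubP => [j|_]; first by rewrite ltnn.
  rewrite mulrBr mulr_sumr; congr (_ + _); last by ring.
  apply: eq_bigr => j _; rewrite valK; ring.
have mass12 : mass (leb_itv (1 : R) 2) = 1 by rewrite mass_leb_itv// addrK.
have massT : mass (leb_itv (T : R) (2 * T)) = T.
  by rewrite mass_leb_itv// mulr_natl mulr2n addrK.
have nX : \int[finprod (finprod (leb_itv 1 2) mu) (finprod (leb_itv 1 2) mu)]_p
    near_pairs d.+1 X (2 * h) p <=
    (2 * (2 * h / a)) * (A0 * (kap2 / T) `^ s) * (1 * M).
  have -> : 1 * M = mass (finprod (leb_itv (1 : R) 2) mu).
    by rewrite mass_finprod mass12.
  pose S (o : RR * rV) : set (RR * rV) :=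
    [set u | `|clamp 1 2 o.1 - clamp 1 2 u| <= 2 * h / a] `*` near o.2 (kap2 / T).
  have r1 : 0 <= 2 * h / a by rewrite divr_ge0 ?(ltW a0)// mulr_ge0// ltW.
  have r2 : 0 < kap2 / T by rewrite divr_gt0.
  have K0 : 0 <= A0 * (kap2 / T) `^ s by rewrite mulr_ge0 ?powR_ge0.
  apply: (near_pairs_bound (A := S)) => //.
  - by rewrite mulr_ge0// mulr_ge0.
  - by move=> o; apply: measurableX; [exact: measurable_clamp_near | exact: measurable_near].
  - move=> o; rewrite [leLHS]finprodX; [|exact: measurable_clamp_near | exact: measurable_near].
    rewrite EFinM; apply: lee_pmul => //; last exact: mu_near.
    exact: leb_itv_near.
  - move=> o q H1; have /andP[la lb] := l12 o.1.
    (* The last coordinates are - lam t, and t >= a: nearness within 2 h confines [lam] to a window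
       of length O(1/T). This is the place where t must stay away from 0. *)
    have ldiff : `|clamp 1 2 o.1 - clamp 1 2 q.1| <= 2 * h / a.
      rewrite ler_pdivlMr//; have := H1 d (ltnSn d); rewrite /X.
      case: insubP => [j|_]; first by rewrite ltnn.
      rewrite -mulrBl normrM normrN (gtr0_norm t0); apply: le_trans.
      by rewrite ler_wpM2l.
    split=> //= j; have := H1 j (ltnW (ltn_ord j)); rewrite /X valK => H2.
    have := near_of_scaled ltr01 la H2 ldiff (cutcoord_le j q.2).
    move=> /le_trans; apply; rewrite le_eqVlt; apply/orP; left; apply/eqP.
    by rewrite /kap2 /h; field; rewrite !gt_eqF.
have nxi : \int[finprod (finprod (leb_itv T (2 * T)) mu) (finprod (leb_itv T (2 * T)) mu)]_p
    near_pairs d.+1 xi c p <=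
    (2 * c) * (A0 * (c * (1 + rho) / T) `^ s) * (T * M).
  have -> : T * M = mass (finprod (leb_itv (T : R) (2 * T)) mu).
    by rewrite mass_finprod massT.
  pose S (o : RR * rV) : set (RR * rV) :=
    [set u | `|clamp T (2 * T) o.1 - clamp T (2 * T) u| <= c] `*` near o.2 (c * (1 + rho) / T).
  have r2 : 0 < c * (1 + rho) / T by rewrite divr_gt0// mulr_gt0// ltr_wpDr// ltW.
  have K0 : 0 <= A0 * (c * (1 + rho) / T) `^ s by rewrite mulr_ge0 ?powR_ge0.
  apply: (near_pairs_bound (A := S)) => //.
  - by rewrite mulr_ge0// mulr_ge0// ltW.
  - by move=> o; apply: measurableX; [exact: measurable_clamp_near | exact: measurable_near].
  - move=> o; rewrite [leLHS]finprodX; [|exact: measurable_clamp_near | exact: measurable_near].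
    rewrite EFinM; apply: lee_pmul => //; last exact: mu_near.
    by apply: leb_itv_near => //; exact: ltW.
  - move=> o q H1; have /andP[la lb] := lT o.1.
    (* Here the last coordinate is the dilation tau itself. *)
    have ldiff : `|clamp T (2 * T) o.1 - clamp T (2 * T) q.1| <= c.
      have := H1 d (ltnSn d); rewrite /xi.
      by case: insubP => [j|_]; rewrite ?ltnn// !mulr1.
    split=> //= j; have := H1 j (ltnW (ltn_ord j)); rewrite /xi valK => H2.
    have := near_of_scaled T0 la H2 ldiff (cutcoord_le j q.2).
    by rewrite mulrDr mulr1.
(* Powers of T: the factors (2 h) (B / h ^ 2) give T^(d + 1), the two Frostman balls give T^(- 2 s),
   and the window of [lam] of length O(1/T) cancels the length T of the block. *)
have {}H : I ^+ 2 <= Cst * (T `^ (d.+1%:R / 2 - s)) ^+ 2.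
  have c10 : 0 < 1 + rho by rewrite ltr_wpDr// ltW.
  have Ps : 0 < T `^ s by rewrite powR_gt0.
  apply: le_trans H _; rewrite powR_half_subK//.
  apply: (@le_trans _ _ (((2 * h) ^+ d.+1 *
      ((2 * (2 * h / a)) * (A0 * (kap2 / T) `^ s) * (1 * M))) *
      ((B / h ^+ 2) ^+ d.+1 * ((2 * c) * (A0 * (c * (1 + rho) / T) `^ s) * (T * M))))).
    have p1 : 0 <= (2 * h) ^+ d.+1 by rewrite exprn_ge0// mulr_ge0// ltW.
    have p2 : 0 <= (B / h ^+ 2) ^+ d.+1 by rewrite exprn_ge0// divr_ge0// sqr_ge0.
    apply: ler_pM; try (by rewrite mulr_ge0// near_pairs_int_ge0).
      by rewrite ler_wpM2l.
    by rewrite ler_wpM2l.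
  have TV : 0 <= T^-1 by rewrite invr_ge0 ltW.
  rewrite (powRM s (ltW kap20) TV) (powRM s c1 TV).
  have -> : T^-1 `^ s = (T `^ s)^-1 by rewrite -powR_inv1 ?(ltW T0)// -powRrM mulN1r powRN.
  have -> : Cst * (T ^+ d.+1 / T `^ s ^+ 2) = (2 * B / kap * T) ^+ d.+1 * (C1 * C2 / T `^ s ^+ 2).
    by rewrite exprMn /Cst; ring.
  have -> : 2 * B / kap * T = (2 * h) * (B / h ^+ 2).
    by rewrite /h; field; rewrite !gt_eqF.
  rewrite [in leRHS]exprMn /C1 /C2.
  move: ((2 * h) ^+ d.+1) ((B / h ^+ 2) ^+ d.+1) (kap2 `^ s) ((c * (1 + rho)) `^ s) => z1 z2 z3 z4.
  rewrite le_eqVlt; apply/orP; left; apply/eqP.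
  by rewrite /h; field; rewrite !gt_eqF.
rewrite -(@ler_pXn2r _ 2)// ?nnegrE ?normr_ge0 ?mulr_ge0 ?sqrtr_ge0 ?powR_ge0//.
by rewrite exprMn sqr_sqrtr// -normrX ger0_norm ?sqr_ge0.
Qed.

End Frostman.

(** * Poisson means *)

Section DampedCosine.
Context {R : realType}.
Local Notation leb := (@lebesgue_measure R).
Implicit Types del S w x y : R.

Definition poisson del w : R := del / (del ^+ 2 + w ^+ 2).

(* The integral of exp (- del tau) cos (tau w) over 0 <= tau <= S. *)
Definition damped del S w : R :=
  (del + expR (- (del * S)) * (w * sin (S * w) - del * cos (S * w))) / (del ^+ 2 + w ^+ 2).

Lemma denom_gt0 del w : 0 < del -> 0 < del ^+ 2 + w ^+ 2.
Proof. by move=> d0; rewrite ltr_pwDl ?exprn_gt0// sqr_ge0. Qed.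

Lemma poisson_ge0 del w : 0 < del -> 0 <= poisson del w.
Proof. by move=> d0; rewrite divr_ge0 ?(ltW d0)// ltW// denom_gt0. Qed.

Lemma poisson_le del w : 0 < del -> poisson del w <= del^-1.
Proof.
move=> d0; rewrite ler_pdivrMr ?denom_gt0// mulrDr expr2 mulKf ?gt_eqF// lerDl.
by rewrite mulr_ge0 ?sqr_ge0// invr_ge0 ltW.
Qed.

Lemma damped_continuousl del w : continuous (fun t : R => expR (- (del * t)) * cos (t * w)).
Proof.
move=> t; apply: cvgM.
  apply: (continuous_comp (f := fun t => - (del * t))); last exact: continuous_expR.
  by apply: cvgN; apply: cvgM; [exact: cvg_cst | exact: cvg_id].
have cc : {for t, continuous (cos \o (fun t : R => t * w))}.
  apply: continuous_comp; last exact: continuous_cos.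
  by apply: cvgM; [exact: cvg_id | exact: cvg_cst].
exact: cc.
Qed.

Lemma damped0 del w : damped del 0 w = 0.
Proof.
by rewrite /damped mulr0 oppr0 expR0 mul0r sin0 cos0 !mulr1 mulr0 sub0r mul1r subrr mul0r.
Qed.

Lemma integral_damped del S1 S w : 0 < del -> S1 <= S ->
  \int[leb]_(t in `[S1, S]) (expR (- (del * t)) * cos (t * w)) =
  damped del S w - damped del S1 w.
Proof.
move=> d0 S0; apply: (@Rintegral_derive R (fun S => damped del S w)) => //; last exact: damped_continuousl.
move=> t; have den0 := lt0r_neq0 (denom_gt0 w d0).
have dc k : is_derive t 1 (fun t => t * k) k.
  have d1 := is_deriveM (is_derive_id t (1 : R)) (is_derive_cst k t 1).
  by apply: (is_derive_eq d1); rewrite /GRing.scale/=; ring.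
have de : is_derive t 1 (fun t => expR (- (del * t))) (- del * expR (- (del * t))).
  have d1 : is_derive t 1 (fun t => - (del * t)) (- del).
    have d2 := is_deriveN (is_deriveM (is_derive_cst del t (1 : R)) (is_derive_id t 1)).
    by apply: (is_derive_eq d2); rewrite /GRing.scale/=; ring.
  have d2 := @is_derive1_comp R expR (fun t => - (del * t)) t _ _ (is_derive_expR _) d1.
  by apply: (is_derive_eq d2); ring.
have ds : is_derive t 1 (fun t => sin (t * w)) (w * cos (t * w)).
  have d2 := @is_derive1_comp R sin (fun t => t * w) t _ _ (is_derive_sin _) (dc w).
  by apply: (is_derive_eq d2); ring.
have dco : is_derive t 1 (fun t => cos (t * w)) (- w * sin (t * w)).
  have d2 := @is_derive1_comp R cos (fun t => t * w) t _ _ (is_derive_cos _) (dc w).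
  by apply: (is_derive_eq d2); ring.
have dA : is_derive t 1 (fun t => w * sin (t * w) - del * cos (t * w))
    (w * (w * cos (t * w)) + del * (w * sin (t * w))).
  have d1 := is_deriveB (is_deriveM (is_derive_cst w t (1 : R)) ds) (is_deriveM (is_derive_cst del t (1 : R)) dco).
  by apply: (is_derive_eq d1); rewrite /GRing.scale/= /cst; ring.
have dB : is_derive t 1 (fun t => del + expR (- (del * t)) * (w * sin (t * w) - del * cos (t * w)))
    (expR (- (del * t)) * ((del ^+ 2 + w ^+ 2) * cos (t * w))).
  have d1 := is_deriveD (is_derive_cst del t (1 : R)) (is_deriveM de dA).
  by apply: (is_derive_eq d1); rewrite /GRing.scale/=; ring.
have dC := is_deriveM dB (is_derive_cst (del ^+ 2 + w ^+ 2)^-1 t (1 : R)).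
by apply: (is_derive_eq dC); rewrite /GRing.scale/= /cst; field.
Qed.

Lemma norm_Rintegral_itv_le (f : R -> R) a b C : continuous f -> a <= b ->
  (forall t, a <= t <= b -> `|f t| <= C) ->
  `|\int[leb]_(t in `[a, b]) f t| <= C * (b - a).
Proof.
move=> cf ab fC.
have icf (g : R -> R) : continuous g -> leb.-integrable `[a, b] (EFin \o g).
  move=> cg; apply: continuous_compact_integrable; first exact: segment_compact.
  exact: continuous_subspaceT.
apply: le_trans (le_normr_Rintegral _ (icf _ cf)) _ => //.
have -> : C * (b - a) = \int[leb]_(t in `[a, b]) (cst C t).
  rewrite Rintegral_cst//; congr (_ * _).
  by rewrite -(mass_leb_itv ab) /mass /leb_itv /= /mfrestr /mrestr setTI.
apply: le_Rintegral => //.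
- by apply: (icf (fun t => `|f t|)) => t; apply: cvg_norm; exact: cf.
- by apply: icf => t; exact: cvg_cst.
Qed.

(** The integral form gives a bound uniform in [del] and [w], which the closed formula hides near
    del = w = 0. *)
Lemma damped_le del S w : 0 < del -> 0 <= S -> `|damped del S w| <= S.
Proof.
move=> d0 S0; rewrite -[X in `|X|]subr0 -(damped0 del w) -integral_damped//.
rewrite -[leRHS]mul1r -[in leRHS](subr0 S).
apply: norm_Rintegral_itv_le => //; first exact: damped_continuousl.
move=> t /andP[t0 tS]; rewrite normrM -[leRHS]mul1r ler_pM// ?cos_max//.
by rewrite ger0_norm ?expR_ge0// -expR0 ler_expR oppr_le0 mulr_ge0// ltW.
Qed.

Lemma cos_lip x y : `|cos x - cos y| <= `|x - y|.
Proof.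
wlog xy : x y / y <= x.
  move=> H; have [|/ltW] := leP y x; first exact: H.
  by rewrite distrC (distrC x); exact: H.
have cc : {within `[y, x], continuous (@cos R)}.
  by apply: continuous_subspaceT; exact: continuous_cos.
have [c _ ->] := @MVT_segment R cos (fun t => - sin t) y x xy (fun t _ => is_derive_cos t) cc.
by rewrite normrM ler_piMl// normrN sin_max.
Qed.

Lemma expRN_lip x y : 0 <= x -> 0 <= y -> `|expR (- x) - expR (- y)| <= `|x - y|.
Proof.
wlog xy : x y / y <= x.
  move=> H x0 y0; have [|/ltW] := leP y x => h; first exact: H.
  by rewrite distrC (distrC x); exact: H.
move=> x0 y0; rewrite ler0_norm ?subr_le0 ?ler_expR ?lerN2// opprB ger0_norm ?subr_ge0//.
have -> : expR (- x) = expR (- y) * expR (- (x - y)).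
  by rewrite -expRD; congr expR; ring.
have ey : expR (- y) <= 1 by rewrite -expR0 ler_expR oppr_le0.
have e1 : 1 - (x - y) <= expR (- (x - y)) by exact: expR_ge1Dx.
have e2 : expR (- (x - y)) <= 1 by rewrite -expR0 ler_expR oppr_le0 subr_ge0.
have e3 := expR_ge0 (- y); nra.
Qed.

(** A change of [del] or [w] changes the integrand at t by at most t <= S times that change;
    integration over [0, S] costs another factor S. *)
Lemma damped_lip del del' S w w' : 0 < del -> 0 < del' -> 0 <= S ->
  `|damped del S w - damped del' S w'| <= S ^+ 2 * (`|del - del'| + `|w - w'|).
Proof.
move=> d0 d0' S0.
have E d v : 0 < d -> damped d S v = \int[leb]_(t in `[0, S]) (expR (- (d * t)) * cos (t * v)).
  by move=> ?; rewrite integral_damped// damped0 subr0.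
have icf (g : R -> R) : continuous g -> leb.-integrable `[0, S] (EFin \o g).
  move=> cg; apply: continuous_compact_integrable; first exact: segment_compact.
  exact: continuous_subspaceT.
have cd (d v : R) : continuous (fun t : R => expR (- (d * t)) * cos (t * v)) by exact: damped_continuousl.
rewrite !E// -RintegralB//; [|exact: icf|exact: icf].
have -> : S ^+ 2 * (`|del - del'| + `|w - w'|) = (S * (`|del - del'| + `|w - w'|)) * (S - 0).
  by ring.
apply: norm_Rintegral_itv_le => //; first by move=> t; apply: cvgB; exact: cd.
move=> t /andP[t0 tS].
have -> : expR (- (del * t)) * cos (t * w) - expR (- (del' * t)) * cos (t * w') =
  (expR (- (del * t)) - expR (- (del' * t))) * cos (t * w) +
  expR (- (del' * t)) * (cos (t * w) - cos (t * w')) by ring.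
rewrite [leRHS]mulrDr; apply: le_trans (ler_normD _ _) _; rewrite !normrM; apply: lerD.
  apply: (@le_trans _ _ (`|del * t - del' * t| * 1)).
    by rewrite ler_pM// ?cos_max// expRN_lip// mulr_ge0// ltW.
  by rewrite mulr1 -mulrBl normrM mulrC (ger0_norm t0) ler_wpM2r.
apply: (@le_trans _ _ (1 * `|t * w - t * w'|)).
  rewrite ler_pM// ?cos_lip// ger0_norm ?expR_ge0// -expR0 ler_expR oppr_le0.
  by rewrite mulr_ge0// ltW.
by rewrite mul1r -mulrBr normrM (ger0_norm t0) ler_wpM2r.
Qed.

(** The difference is the tail of the integral beyond S. The bound degenerates as [del] tends to 0,
    but it is used only for fixed [del] and S tending to infinity. *)
Lemma poisson_damped_le del S w : 0 < del -> 0 <= S ->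
  `|poisson del w - damped del S w| <= 2 / del * expR (- (del * S)).
Proof.
move=> d0 S0; have dn := denom_gt0 w d0.
have -> : poisson del w - damped del S w =
    expR (- (del * S)) * ((del * cos (S * w) - w * sin (S * w)) / (del ^+ 2 + w ^+ 2)).
  by rewrite /poisson /damped; field; exact: lt0r_neq0.
rewrite normrM (ger0_norm (expR_ge0 _)) mulrC ler_wpM2r ?expR_ge0//.
rewrite normrM normfV (gtr0_norm dn) ler_pdivrMr//.
apply: (@le_trans _ _ (del + `|w|)).
  apply: le_trans (ler_normB _ _) _; rewrite !normrM (gtr0_norm d0).
  by rewrite lerD// ler_piMr ?(ltW d0)// ?cos_max ?sin_max.
rewrite -(@ler_pM2r _ del)//.
have -> : 2 / del * (del ^+ 2 + w ^+ 2) * del = 2 * (del ^+ 2 + `|w| ^+ 2).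
  by rewrite real_normK ?num_real//; field; rewrite gt_eqF.
have := normr_ge0 w; move: `|w| => z z0; nra.
Qed.

End DampedCosine.

(** Centres are spaced by the radius e = 2 r1 / n, and the integer part of (x - (m - r1)) / e
    selects a box containing x. The right endpoint has index n, hence n + 1 boxes. *)
Lemma box_cover (R : realType) (m r1 : R) n x : 0 < r1 -> (0 < n)%N ->
  box r1 m x <= \sum_(i < n.+1) box (2 * r1 / n%:R) (m - r1 + 2 * r1 / n%:R * i%:R) x.
Proof.
move=> r1_gt0 n0; rewrite {1}/box; case: (leP `|x - m| r1) => [xm|_]; last first.
  by apply: sumr_ge0 => i _; exact: box_ge0.
have nR : 0 < n%:R :> R by rewrite ltr0n.
pose e := 2 * r1 / n%:R; have e0 : 0 < e by rewrite divr_gt0// mulr_gt0.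
pose y := (x - (m - r1)) / e.
move: xm; rewrite ler_distl => /andP[x1 x2].
have y0 : 0 <= y by rewrite divr_ge0 ?(ltW e0)// subr_ge0.
have yn : y <= n%:R.
  rewrite ler_pdivrMr// /e mulrC divfK ?gt_eqF//; lra.
have /andP[k1 k2] := truncn_itv y0.
have kn : (Num.truncn y < n.+1)%N by rewrite ltnS -(@ler_nat R) (le_trans k1).
rewrite (bigD1 (Ordinal kn))//= -[leLHS]addr0 lerD//; last first.
  by apply: sumr_ge0 => i _; exact: box_ge0.
rewrite /box -/e; suff -> : (`|x - (m - r1 + e * (Num.truncn y)%:R)| <= e)%R by [].
have -> : x - (m - r1 + e * (Num.truncn y)%:R) = e * (y - (Num.truncn y)%:R).
  by rewrite /y; field; rewrite gt_eqF.
rewrite normrM (gtr0_norm e0) ler_piMr ?(ltW e0)// ger0_norm ?subr_ge0//.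
by rewrite lerBlDl -natr1 in k2 *; exact: ltW.
Qed.

Lemma near_in_itv (R : realFieldType) (a b x y t0 t eta : R) :
  `|t - t0| <= eta -> x <= t0 -> t0 <= y -> eta <= x - a -> eta <= b - y -> a <= t <= b.
Proof. by rewrite ler_norml => /andP[*]; apply/andP; split; lra. Qed.

(** * From decay of dyadic blocks to mass on short intervals *)

Section PoissonArgument.
Context {dO : measure_display} {O : measurableType dO} {R : realType}.
Variables (P : {finite_measure set O -> \bar R}) (lam v : O -> R).
Hypotheses (mlam : measurable_fun setT lam) (mv : measurable_fun setT v).
Hypothesis lam_itv : forall o, 1 <= lam o <= 2.

Let w t o := lam o * (v o - t).

Let mw t : measurable_fun setT (w t).
Proof. by apply: measurable_funM => //; exact: measurable_funB. Qed.

Let minv (del : R) t : 0 < del -> measurable_fun setT (fun o => (del ^+ 2 + w t o ^+ 2)^-1).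
Proof.
move=> d0; apply: (@measurableT_comp _ _ _ _ _ _ (fun x : R => (del ^+ 2 + x ^+ 2)^-1)) => //.
apply: continuous_measurable_fun => x; apply: cvgV; first exact: lt0r_neq0 (denom_gt0 x d0).
by apply: cvgD; [exact: cvg_cst | exact: exprn_continuous].
Qed.

Let bpoisson (del : R) t : 0 < del -> bmeas (fun o => poisson del (w t o)).
Proof.
move=> d0; split; first by apply: measurable_funM => //; exact: minv.
exists del^-1 => o; rewrite ger0_norm ?poisson_ge0//; exact: poisson_le.
Qed.

Lemma bmeas_damped (del S : R) t : 0 < del -> 0 <= S -> bmeas (fun o => damped del S (w t o)).
Proof.
move=> d0 S0; split; last by exists S => o; exact: damped_le.
apply: measurable_funM; last exact: minv.
apply: measurable_funD => //; apply: measurable_funM => //.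
have mSw : measurable_fun setT (fun o => S * w t o) by exact: measurable_funM.
apply: measurable_funB; apply: measurable_funM => //.
  exact: measurableT_comp (continuous_measurable_fun (@continuous_sin R)) mSw.
exact: measurableT_comp (continuous_measurable_fun (@continuous_cos R)) mSw.
Qed.

Lemma bmeas_box r t : bmeas (fun o => box r t (v o)).
Proof.
split; last by exists 1 => o; exact: norm_box_le1.
by apply: measurable_box.
Qed.

Definition poisson_mean (del t : R) : R := \int[P]_o poisson del (w t o).

(** On the box |w| <= 2 del because lam <= 2, so del ^ 2 + w ^ 2 <= 5 del ^ 2. *)
Lemma poisson_box del t o : 0 < del -> box del t (v o) <= 5 * del * poisson del (w t o).
Proof.
move=> d0; have dn := denom_gt0 (w t o) d0; rewrite /box; case: (leP `|v o - t| del) => [vt|_]; last first.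
  by rewrite mulr_ge0 ?poisson_ge0// mulr_ge0// ltW.
rewrite /poisson mulrA ler_pdivlMr// mul1r.
have -> : w t o ^+ 2 = lam o ^+ 2 * `|v o - t| ^+ 2.
  by rewrite real_normK ?num_real// /w exprMn.
have /andP[l1 l2] := lam_itv o; have := normr_ge0 (v o - t).
move: `|v o - t| vt => z zd z0.
have : lam o * z <= 2 * del by apply: ler_pM => //; exact: le_trans l1.
have : 0 <= lam o * z by rewrite mulr_ge0// (le_trans _ l1).
rewrite -exprMn; move: (lam o * z) => y; nra.
Qed.

(** Outside the box |w| >= K del because lam >= 1, and there the kernel at scale [del] is at most 2
    / K times the kernel at scale [K * del]. As the means are bounded uniformly in the scale, a
    large K makes this part negligible. *)
Lemma poisson_le_box del K t o : 0 < del -> 0 < K ->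
  poisson del (w t o) <= box (K * del) t (v o) / del + 2 / K * poisson (K * del) (w t o).
Proof.
move=> d0 K0; have Kd0 : 0 < K * del by rewrite mulr_gt0.
rewrite /box; case: (leP `|v o - t| (K * del)) => [_|vt].
  rewrite mul1r; apply: le_trans (poisson_le _ d0) _.
  by rewrite lerDl mulr_ge0 ?poisson_ge0// divr_ge0// ltW.
rewrite mul0r add0r /poisson.
have dn := denom_gt0 (w t o) d0; have dn' := denom_gt0 (w t o) Kd0.
rewrite ler_pdivrMr// mulrA.
have -> : 2 / K * (K * del) / ((K * del) ^+ 2 + w t o ^+ 2) * (del ^+ 2 + w t o ^+ 2) =
   del * (2 * (del ^+ 2 + w t o ^+ 2) / ((K * del) ^+ 2 + w t o ^+ 2)).
  by field; rewrite !gt_eqF.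
rewrite ler_peMr ?(ltW d0)// ler_pdivlMr// mul1r.
have : (K * del) ^+ 2 <= w t o ^+ 2.
  rewrite -[leRHS]real_normK ?num_real// ler_pXn2r ?nnegrE ?(ltW Kd0)//.
  apply: le_trans (ltW vt) _; rewrite /w normrM ler_peMl//.
  by have /andP[l1 _] := lam_itv o; rewrite ger0_norm// (le_trans _ l1).
have := sqr_ge0 del; lra.
Qed.

Variables (a b C q : R).
Hypotheses (C_ge0 : 0 <= C) (q_ge0 : 0 <= q) (q_lt1 : q < 1).
Hypothesis block : forall t del j, a <= t <= b -> 0 < del ->
  `|\int[P]_o (damped del (2 * 2 ^+ j) (w t o) - damped del (2 ^+ j) (w t o))| <= C * q ^+ j.

(** Telescoping over the blocks beyond 2 ^ j and summing the geometric series; the remainder after k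
    blocks tends to 0 by [poisson_damped_le]. *)
Lemma poisson_tail t del j : a <= t <= b -> 0 < del ->
  `|\int[P]_o (poisson del (w t o) - damped del (2 ^+ j) (w t o))| <= C / (1 - q) * q ^+ j.
Proof.
move=> tab d0; have q1 : 0 < 1 - q by rewrite subr_gt0.
pose T j := `|\int[P]_o (poisson del (w t o) - damped del (2 ^+ j) (w t o))|.
have p2 i : 0 <= 2 ^+ i :> R by rewrite exprn_ge0.
have step i : T i <= C * q ^+ i + T i.+1.
  rewrite /T; have -> : \int[P]_o (poisson del (w t o) - damped del (2 ^+ i) (w t o)) =
     \int[P]_o (damped del (2 * 2 ^+ i) (w t o) - damped del (2 ^+ i) (w t o)) +
     \int[P]_o (poisson del (w t o) - damped del (2 ^+ i.+1) (w t o)).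
    rewrite -fintD; last 2 first.
    - by apply: bmeasB; apply: bmeas_damped => //; rewrite mulr_ge0.
    - by apply: bmeasB; [exact: bpoisson | exact: bmeas_damped].
    by apply: eq_Rintegral => o _; rewrite exprS; ring.
  by apply: le_trans (ler_normD _ _) _; rewrite lerD2r; exact: block.
have far k : T j <= C / (1 - q) * q ^+ j + T (j + k)%N.
  elim: k j => [|k IH] i.
    by rewrite addn0 lerDr mulr_ge0 ?exprn_ge0// divr_ge0// ltW.
  apply: le_trans (step i) _; apply: le_trans (lerD (lexx _) (IH i.+1)) _.
  rewrite addSnnS addrA lerD2r le_eqVlt; apply/orP; left; apply/eqP.
  by rewrite exprS; field; exact: lt0r_neq0.
apply/ler_addgt0Pr => e e0.
pose M := 2 / del * mass P.
have M0 : 0 <= M by rewrite mulr_ge0 ?mass_ge0// divr_ge0// ltW.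
(* The number of blocks may depend on [del], since the bound already obtained does not involve k.
   The estimates exp (- x) <= 1 / x and k <= 2 ^ (j + k) suffice. *)
have [k Hk] : exists k : nat, M / (e * del) <= k%:R.
  exists (Num.bound (M / (e * del))); apply/ltW/archi_boundP.
  by rewrite divr_ge0// mulr_ge0// ltW.
apply: le_trans (far k) _; rewrite lerD2l /T.
apply: (@le_trans _ _ (2 / del * expR (- (del * 2 ^+ (j + k))) * mass P)).
  apply: fint_normle; first by apply: bmeasB; [exact: bpoisson | exact: bmeas_damped].
  by move=> o; exact: poisson_damped_le.
have kj : k%:R <= 2 ^+ (j + k) :> R.
  by rewrite -natrX ler_nat; apply: leq_trans (leq_addl j k) _; apply/ltnW/ltn_expl.
have x0 : 0 < del * 2 ^+ (j + k) by rewrite mulr_gt0// exprn_gt0.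
apply: (@le_trans _ _ (M / (del * 2 ^+ (j + k)))).
  rewrite mulrAC -/M ler_wpM2l// expRN lef_pV2 ?posrE ?expR_gt0//.
  by apply: le_trans (expR_ge1Dx _); rewrite lerDr.
rewrite ler_pdivrMr// mulrA -ler_pdivrMl ?mulr_gt0// mulrC.
exact: le_trans Hk kj.
Qed.

Let Cq := C / (1 - q).

Let Cq_ge0 : 0 <= Cq.
Proof. by rewrite divr_ge0// subr_ge0 ltW. Qed.

Lemma poisson_mean_le t del : a <= t <= b -> 0 < del -> poisson_mean del t <= Cq + mass P.
Proof.
move=> tab d0; have := poisson_tail 0 tab d0; rewrite !expr0 mulr1 -/Cq.
rewrite fintB; [|exact: bpoisson|exact: bmeas_damped].
rewrite -/(poisson_mean del t) => /(le_trans (ler_norm _)) H1.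
have H2 : `|\int[P]_o damped del 1 (w t o)| <= 1 * mass P.
  by apply: fint_normle; [exact: bmeas_damped | move=> o; exact: damped_le].
by have := ler_norm (\int[P]_o damped del 1 (w t o)); rewrite mul1r in H2; lra.
Qed.

(** Both means are cut at frequency 2 ^ j: the two tails cost 2 Cq q ^ j, and the remaining parts
    are Lipschitz by [damped_lip]. The factor 2 before |t - t'| is the upper bound of [lam]. *)
Lemma poisson_mean_lip j t t' del del' : a <= t <= b -> a <= t' <= b -> 0 < del -> 0 < del' ->
  `|poisson_mean del t - poisson_mean del' t'| <=
  2 * Cq * q ^+ j + (2 ^+ j) ^+ 2 * mass P * (`|del - del'| + 2 * `|t - t'|).
Proof.
move=> tab tab' d0 d0'; have p2 : 0 <= 2 ^+ j :> R by rewrite exprn_ge0.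
have H1 := poisson_tail j tab d0; have H2 := poisson_tail j tab' d0'.
have b1 := bpoisson t d0; have b2 := bpoisson t' d0'.
have b3 := bmeas_damped t d0 p2; have b4 := bmeas_damped t' d0' p2.
have H3 : `|\int[P]_o (damped del (2 ^+ j) (w t o) - damped del' (2 ^+ j) (w t' o))| <=
    ((2 ^+ j) ^+ 2 * (`|del - del'| + 2 * `|t - t'|)) * mass P.
  apply: fint_normle; first exact: bmeasB.
  move=> o; apply: le_trans (damped_lip _ _ d0 d0' p2) _.
  rewrite ler_wpM2l ?sqr_ge0// lerD2l /w -mulrBr normrM.
  have -> : v o - t - (v o - t') = - (t - t') by ring.
  rewrite normrN ler_wpM2r//; have /andP[l1 l2] := lam_itv o.
  by rewrite ger0_norm// (le_trans _ l1).
rewrite fintB// in H1; rewrite fintB// in H2; rewrite fintB// in H3.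
rewrite -/(poisson_mean del t) -/Cq in H1; rewrite -/(poisson_mean del' t') -/Cq in H2.
move: H1 H2 H3; move: (poisson_mean del t) (poisson_mean del' t') => x y.
move: (\int[P]_o damped del _ _) (\int[P]_o damped del' _ _) => z u H1 H2 H3.
have -> : x - y = (x - z) - (y - u) + (z - u) by ring.
apply: le_trans (ler_normD _ _) _; apply: lerD; last by rewrite [leRHS]mulrAC.
by apply: le_trans (ler_normB _ _) _; rewrite -mulrA mulrDl mul1r -{2}[Cq]/Cq lerD.
Qed.

Variables (m r1 : R).
Hypotheses (r1_gt0 : 0 < r1) (am : a < m - r1) (mb : m + r1 < b).
Hypothesis box_pos : 0 < \int[P]_o box r1 m (v o).

(** In 20 r1, a factor 5 comes from [poisson_box], a factor 2 r1 from the radius 2 r1 / n, and a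
    factor 2 from n + 1 <= 2 n. *)
Let c1 := (\int[P]_o box r1 m (v o)) / (20 * r1).

Let c1_gt0 : 0 < c1. Proof. by rewrite divr_gt0// mulr_gt0. Qed.

(* Covering [m - r1, m + r1] by n + 1 boxes of radius 2 r1 / n, one carries its share of the mass. *)
Let pigeonhole n : (0 < n)%N ->
  exists2 t, m - r1 <= t <= m + r1 & c1 <= poisson_mean (2 * r1 / n%:R) t.
Proof.
move=> n0; have nR : 0 < n%:R :> R by rewrite ltr0n.
pose e := 2 * r1 / n%:R; have e0 : 0 < e by rewrite divr_gt0// mulr_gt0.
pose p0 := \int[P]_o box r1 m (v o).
pose t (i : 'I_n.+1) := m - r1 + e * i%:R.
have [i Hi] : exists i, p0 / n.+1%:R <= \int[P]_o box e (t i) (v o).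
  apply: contrapT => /forallNP H.
  have : p0 < \sum_(i < n.+1) (p0 / n.+1%:R).
    apply: (@le_lt_trans _ _ (\sum_(i < n.+1) \int[P]_o box e (t i) (v o))).
      rewrite -fint_sum; last by move=> i; exact: bmeas_box.
      apply: fint_le; [exact: bmeas_box | by apply: bmeas_sum => i; exact: bmeas_box |].
      by move=> o; exact: box_cover.
    apply: ltr_sum; first by apply/hasP; exists ord0; rewrite ?mem_index_enum.
    by move=> i _; rewrite ltNge; apply/negP; exact: H.
  by rewrite sumr_const card_ord -[X in _ < X]mulr_natr divfK ?ltxx// pnatr_eq0.
exists (t i).
  have i0 : 0 <= e * i%:R by rewrite mulr_ge0// ltW.
  have : e * i%:R <= e * n%:R by rewrite ler_wpM2l ?(ltW e0)// ler_nat -ltnS.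
  rewrite {2}/e divfK ?gt_eqF// /t => H; apply/andP; split; lra.
have H : \int[P]_o box e (t i) (v o) <= 5 * e * poisson_mean e (t i).
  rewrite -fintZl; last exact: bpoisson.
  apply: fint_le; [exact: bmeas_box | by apply: bmeasM; [exact: bmeas_cst | exact: bpoisson] |].
  by move=> o; exact: poisson_box.
have {}H := le_trans Hi H.
have e5 : 0 < 5 * e by rewrite mulr_gt0.
rewrite -(ler_pM2l e5); apply: le_trans H.
have -> : 5 * e * c1 = p0 / (2 * n%:R).
  by rewrite /c1 -/p0 /e; field; rewrite !gt_eqF.
rewrite ler_wpM2l ?(ltW box_pos)// lef_pV2 ?posrE ?mulr_gt0// -natrM ler_nat.
by rewrite mul2n -addnn -addn1 leq_add2l.
Qed.

(** The bound of [poisson_mean_lip] involves the difference of the scales and not their ratio, so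
    one fine scale [e] controls every [del <= e]. *)
Theorem interval_lower_bound : exists t0 eta c r0 : R,
  [/\ 0 < eta, 0 < c, 0 < r0 & forall t r, `|t - t0| < eta -> 0 < r <= r0 ->
     c * r <= \int[P]_o box r t (v o)].
Proof.
have M0 := mass_ge0 P; set M := mass P in M0.
(* Budget: c1 / 4 for the two tails, c1 / 8 for the change of scale and c1 / 8 for the change of t,
   which leaves c1 / 2. The cutoff j is fixed first because [A], and with it [n] and [eta], depends
   on it. *)
have [j Hj] : exists j, 2 * Cq * q ^+ j <= c1 / 4.
  have h1 : 0 < 2 * Cq + 1 by rewrite ltr_wpDl// mulr_ge0.
  have e0 : 0 < c1 / 4 / (2 * Cq + 1).
    by rewrite divr_gt0// divr_gt0.
  have /cvgrPdist_lt/(_ _ e0) [j _ /(_ j (leqnn j))] : q ^+ n @[n --> \oo] --> (0 : R).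
    by apply: cvg_expr; rewrite ger0_norm.
  rewrite /= sub0r normrN ger0_norm ?exprn_ge0// => Hj; exists j.
  move: Hj; rewrite ltr_pdivlMr// => /ltW; apply: le_trans.
  by rewrite mulrC ler_wpM2l ?exprn_ge0// lerDl.
pose A := (2 ^+ j) ^+ 2 * M; have A0 : 0 <= A by rewrite mulr_ge0// sqr_ge0.
pose n := (Num.bound (16 * r1 * A / c1)).+1.
have nR : 0 < n%:R :> R by rewrite ltr0n.
have Hn : 16 * r1 * A / c1 <= n%:R.
  have x0 : 0 <= 16 * r1 * A / c1.
    by rewrite divr_ge0 ?(ltW c1_gt0)// mulr_ge0// mulr_ge0// ltW.
  by apply: le_trans (ltW (archi_boundP x0)) _; rewrite ler_nat /n leqnSn.
have [t0 /andP[t01 t02] Ht0] := pigeonhole (ltn0Sn _ : (0 < n)%N).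
pose e := 2 * r1 / n%:R; have e0 : 0 < e by rewrite divr_gt0// mulr_gt0.
rewrite -/e in Ht0.
have t0ab : a <= t0 <= b by rewrite (le_trans (ltW am) t01) (le_trans t02 (ltW mb)).
have Ae : A * e <= c1 / 8.
  rewrite /e mulrA ler_pdivrMr//; move: Hn; rewrite ler_pdivrMr// => Hn; nra.
(* The first entry pays for the change of t; the other two keep t inside [a, b], where the block
   estimates hold. *)
pose eta := Num.min (c1 / (16 * (A + 1))) (Num.min (m - r1 - a) (b - (m + r1))).
have A1 : 0 < A + 1 by rewrite ltr_wpDl.
have eta0 : 0 < eta by rewrite !lt_min !subr_gt0 am mb divr_gt0// mulr_gt0.
have Aeta : A * (2 * eta) <= c1 / 8.
  apply: (@le_trans _ _ (A * (2 * (c1 / (16 * (A + 1)))))).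
    by rewrite ler_wpM2l// ler_wpM2l// ge_min lexx.
  have -> : A * (2 * (c1 / (16 * (A + 1)))) = c1 / 8 * (A / (A + 1)).
    by field; rewrite gt_eqF.
  have AA : A / (A + 1) <= 1 by rewrite ler_pdivrMr// mul1r lerDl.
  have c8 : 0 <= c1 / 8 by rewrite divr_ge0// ltW.
  by rewrite ler_piMr.
have C20 : 0 < Cq + M.
  exact: lt_le_trans c1_gt0 (le_trans Ht0 (poisson_mean_le t0ab e0)).
(* Makes the tail term 2 / K * (Cq + M) of [poisson_le_box] equal to c1 / 4, so at least c1 / 4 must
   come from the box. *)
pose K := 8 * (Cq + M) / c1; have K0 : 0 < K by rewrite divr_gt0// mulr_gt0.
exists t0, eta, (c1 / (4 * K)), (K * e); split => //.
- by rewrite divr_gt0// mulr_gt0.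
- by rewrite mulr_gt0.
move=> t r tt0 /andP[r0 rKe].
have tab : a <= t <= b.
  have h1 : eta <= m - r1 - a by rewrite /eta !ge_min lexx orbT.
  have h2 : eta <= b - (m + r1) by rewrite /eta !ge_min lexx !orbT.
  exact: near_in_itv (ltW tt0) t01 t02 h1 h2.
pose del := r / K; have del0 : 0 < del by rewrite divr_gt0.
have dele : del <= e by rewrite ler_pdivrMr// mulrC.
have Kdel : K * del = r by rewrite mulrC divfK// gt_eqF.
have low : c1 / 2 <= poisson_mean del t.
  have := poisson_mean_lip j t0ab tab e0 del0; rewrite -/A -/M.
  have h1 : `|e - del| <= e by rewrite ger0_norm ?subr_ge0// lerBlDr lerDl ltW.
  have h2 : `|t0 - t| <= eta by rewrite distrC ltW.
  have h3 : A * (`|e - del| + 2 * `|t0 - t|) <= c1 / 8 + c1 / 8.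
    apply: le_trans (lerD Ae Aeta); rewrite -mulrDr ler_wpM2l// lerD// ler_wpM2l//.
  move=> /(le_trans (ler_norm _)).
  move: Ht0 Hj h3; move: (poisson_mean e t0) (poisson_mean del t) => x y; rewrite /A /M; lra.
have up : poisson_mean del t <= (\int[P]_o box r t (v o)) / del + c1 / 4.
  apply: (@le_trans _ _ (\int[P]_o (box r t (v o) / del + 2 / K * poisson r (w t o)))).
    apply: fint_le; first exact: bpoisson.
      apply: bmeasD; apply: bmeasM; try exact: bmeas_cst; [exact: bmeas_box | exact: bpoisson].
    by move=> o; have := poisson_le_box t o del0 K0; rewrite Kdel.
  rewrite fintD; last 2 first.
  - by apply: bmeasM; [exact: bmeas_box | exact: bmeas_cst].
  - by apply: bmeasM; [exact: bmeas_cst | exact: bpoisson].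
  rewrite (fintZr _ _ (bmeas_box r t)) (fintZl _ _ (bpoisson t r0)) lerD2l.
  apply: (@le_trans _ _ (2 / K * (Cq + M))).
    have K2 : 0 <= 2 / K by rewrite divr_ge0// ltW.
    exact: (ler_wpM2l K2 (poisson_mean_le tab r0)).
  by rewrite le_eqVlt; apply/orP; left; apply/eqP; rewrite /K; field; rewrite !gt_eqF.
have : c1 / 4 * del <= \int[P]_o box r t (v o).
  by rewrite -ler_pdivlMr//; lra.
by apply: le_trans; rewrite le_eqVlt; apply/orP; left; apply/eqP; rewrite /del; field; rewrite gt_eqF.
Qed.

End PoissonArgument.

Lemma powRX (R : realType) (x e : R) j : 0 <= x -> (x ^+ j) `^ e = (x `^ e) ^+ j.
Proof.
by move=> x0; rewrite -(powR_mulrn j x0) -(powR_mulrn j (powR_ge0 x e)) -!powRrM mulrC.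
Qed.

(** * The theorem for a single edge *)

Section EdgeBound.
Context {R : realType} {d : nat}.
Local Notation rV := (borel_rV R d).
Local Notation RR := (measurableTypeR R).
Variables (mu : {finite_measure set rV -> \bar R}) (E : set rV) (rho A0 s : R).
Hypotheses (mE : measurable E) (muE : mu (~` E) = 0%E).
Hypotheses (rho_ge1 : 1 <= rho) (E_rho : forall (x : rV) j, E x -> `|x ord0 j| <= rho).
Hypotheses (A0_ge0 : 0 <= A0) (s_gt : d.+1%:R / 2 < s).
Hypothesis frost : forall (x : 'rV[R]_d) (r : R), 0 < r ->
  (mu (E `&` [set y : rV | forall j, `|x ord0 j - y ord0 j| <= r]%R) <= (A0 * r `^ s)%:E)%E.
Hypothesis mass_gt0 : 0 < mass mu.

Let s_gt0 : 0 < s.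
Proof. by apply: lt_trans s_gt; rewrite divr_gt0. Qed.

Let P : {finite_measure set ((RR * rV) * rV)%type -> \bar R} := finprod (finprod (leb_itv 1 2) mu) mu.
Let lam (o : (RR * rV) * rV) : R := clamp 1 2 o.1.1.
Let v (o : (RR * rV) * rV) : R := cutdot E o.1.2 o.2.

Let mlam : measurable_fun setT lam.
Proof. exact: measurableT_comp (measurable_clamp 1 2) (measurableT_comp measurable_fst measurable_fst). Qed.

Let mv : measurable_fun setT v.
Proof.
apply: measurable_cutdot => //.
exact: measurableT_comp measurable_snd measurable_fst.
Qed.

Let lam_itv o : 1 <= lam o <= 2.
Proof. by apply: clamp_itv; rewrite ler1n. Qed.

(** The difference of two damped integrals is an integral over tau in [T, 2T] with T = 2 ^ j. The
    weight exp (- del tau) is at most 1 and goes into the function [g] of [block_bound], which makes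
    the estimate uniform in [del]. *)
Let block_damped (a b : R) : 0 < a -> exists2 C : R, 0 <= C &
  forall t del j, a <= t <= b -> 0 < del ->
  `|\int[P]_o (damped del (2 * 2 ^+ j) (lam o * (v o - t)) -
               damped del (2 ^+ j) (lam o * (v o - t)))| <= C * (2 `^ (d.+1%:R / 2 - s)) ^+ j.
Proof.
move=> a0.
have [C C0 HC] := block_bound mE muE rho_ge1 E_rho A0_ge0 frost b a0.
exists C => // t del j tab d0; pose T : R := 2 ^+ j.
have T1 : 1 <= T by rewrite exprn_ege1// ler1n.
have T0 : 0 < T by apply: lt_le_trans T1.
have T2 : T <= 2 * T by rewrite ler_peMl ?(ltW T0)// ler1n.
pose g (q : RR * rV) : R := expR (- (del * clamp T (2 * T) q.1)).
have clT x : T <= clamp T (2 * T) x <= 2 * T by exact: clamp_itv.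
have g1 q : `|g q| <= 1.
  rewrite ger0_norm ?expR_ge0// -expR0 ler_expR oppr_le0 mulr_ge0 ?(ltW d0)//.
  by have /andP[h _] := clT q.1; apply: le_trans h; exact: ltW.
have bg : bmeas g.
  split; last by exists 1.
  apply: (measurableT_comp (@measurable_expR R)); apply: measurableT_comp => //.
  apply: measurable_funM => //.
  exact: measurableT_comp (measurable_clamp _ _) measurable_fst.
have bF : bmeas (fun p : (RR * rV) * (RR * rV) => g p.2 * osc_kernel E t T p).
  apply: bmeasM; first exact: bmeas_snd.
  apply: bmeas_cos; apply: measurable_funM; first apply: measurable_funM.
  - exact: measurableT_comp (measurable_clamp _ _) (measurableT_comp measurable_fst measurable_fst).
  - exact: measurableT_comp (measurable_clamp _ _) (measurableT_comp measurable_fst measurable_snd).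
  apply: measurable_funB => //; apply: measurable_cutdot => //.
    exact: measurableT_comp measurable_snd measurable_fst.
  exact: measurableT_comp measurable_snd measurable_snd.
have := HC t T g tab T1 bg g1.
have -> : T `^ (d.+1%:R / 2 - s) = (2 `^ (d.+1%:R / 2 - s)) ^+ j.
  exact: powRX.
congr (`|_| <= _); rewrite [RHS]fint_finprod; last first.
  apply: bmeasB; apply: (bmeas_damped mlam mv) => //; exact: ltW.
rewrite fint_finprod//; apply: eq_Rintegral => o _.
rewrite fint_finprod; last first.
  by apply: (bmeas_compr (h := fun q => (o, q)) _ bF); exact: measurable_pair1.
(* Integrating tau before y turns the inner integral into the damped cosine. *)
rewrite (@fint_swap _ _ _ _ _ (leb_itv T (2 * T)) mu (fun q => g q * osc_kernel E t T (o, q))); last first.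
  by apply: (bmeas_compr (h := fun q => (o, q)) _ bF); exact: measurable_pair1.
apply: eq_Rintegral => y _; set w := lam _ * _.
rewrite -integral_damped// -/T fint_leb_itv; last first.
  apply: (bmeas_compr (h := fun x => (o, (x, y))) _ bF).
  apply: measurable_fun_pair => //; exact: measurable_pair2.
apply: eq_Rintegral => x; rewrite inE/= in_itv/= => xT.
rewrite /g /osc_kernel /= (clamp_id xT) /w /lam /v /=; congr (_ * cos _); ring.
Qed.

Let bcut (r t : R) : bmeas (fun p : rV * rV => box r t (cutdot E p.1 p.2)).
Proof.
split; last by exists 1 => p; exact: norm_box_le1.
by apply: measurable_box => //; exact: measurable_cutdot.
Qed.

(** A cube around the origin does not carry the whole mass, by the Frostman condition. The rest of
    [E] is covered by small cubes, one of which has positive mass; for x and y in it, x . y = |x| ^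
    2 - x . (x - y) is at least rho0 ^ 2 - rho0 ^ 2 / 2. *)
Lemma small_positive_piece : exists (D rho0 : R) (f : rV -> R),
  [/\ bmeas f /\ (forall x, 0 <= f x <= 1), 0 < \int[mu]_x f x, 0 < rho0, rho0 ^+ 2 / 2 < D &
   forall x y, 0 < f x -> 0 < f y -> rho0 ^+ 2 / 2 <= cutdot E x y <= D].
Proof.
(* Chosen so that A0 rho0 ^ s = A0 * x0 is less than the total mass; A0 + 1 avoids dividing by 0. *)
pose x0 := mass mu / (2 * (A0 + 1)); pose rho0 := x0 `^ s^-1.
have A1 : 0 < A0 + 1 by rewrite ltr_wpDl.
have x00 : 0 < x0 by rewrite divr_gt0// mulr_gt0.
have rho00 : 0 < rho0 by rewrite powR_gt0.
have rho0s : A0 * rho0 `^ s < mass mu.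
  rewrite /rho0 -powRrM mulVf ?gt_eqF// powRr1 ?(ltW x00)// /x0 mulrA ltr_pdivrMr ?mulr_gt0//.
  rewrite mulrC ltr_pM2l//; lra.
pose Q : set rV := [set y | forall j, `|y ord0 j| <= rho0].
have mQ : measurable Q.
  by apply: measurable_forall_le => j; exact: measurable_coord.
have mEQ : measurable (E `&` Q) by exact: measurableI.
pose F : set rV := E `\` Q.
have mF : measurable F by exact: measurableD.
have F0 : 0 < \int[mu]_x \1_F x.
  rewrite fint_indic//.
  have e1 : (mu setT <= mu (E `&` Q) + mu F + mu (~` E))%E.
    have -> : setT = ((E `&` Q) `|` F) `|` ~` E.
      by rewrite /F setDE -setIUr setUv setIT setUv.
    apply: le_trans (measureU2 _ _ (measurableC mE)) _; first exact: measurableU.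
    by rewrite leeD2r// measureU2.
  have e2 : (mu (E `&` Q) <= (A0 * rho0 `^ s)%:E)%E.
    have -> : E `&` Q = E `&` [set y : rV | forall j, `|(0 : 'rV[R]_d) ord0 j - y ord0 j| <= rho0]%R.
      by congr (_ `&` _); apply/seteqP; split => y H j; have := H j; rewrite mxE sub0r normrN.
    exact: frost.
  have e3 : ((mass mu)%:E <= (A0 * rho0 `^ s)%:E + (fine (mu F))%:E)%E.
    rewrite -massE; apply: le_trans e1 _.
    rewrite [X in (_ + X)%E](_ : _ = 0%E) ?adde0; last exact: muE.
    by apply: leeD => //; rewrite fineK// fin_num_measure.
  by move: e3; rewrite -EFinD lee_fin; lra.
have rho_gt0 : 0 < rho by apply: lt_le_trans rho_ge1.
(* The mesh is fine enough for x . (x - y) <= d rho (2 e) <= rho0 ^ 2 / 2 within one cube. *)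
pose N := (Num.bound (8 * d.+1%:R * rho ^+ 2 / rho0 ^+ 2)).+1.
have NR : 0 < N%:R :> R by rewrite ltr0n.
pose e := 2 * rho / N%:R; have e0 : 0 < e by rewrite divr_gt0// mulr_gt0.
have he : d%:R * (rho * (2 * e)) <= rho0 ^+ 2 / 2.
  have x1 : 0 <= 8 * d.+1%:R * rho ^+ 2 / rho0 ^+ 2 by rewrite divr_ge0 ?sqr_ge0// mulr_ge0 ?sqr_ge0// mulr_ge0.
  have : 8 * d.+1%:R * rho ^+ 2 / rho0 ^+ 2 <= N%:R.
    by apply: le_trans (ltW (archi_boundP x1)) _; rewrite ler_nat /N leqnSn.
  rewrite ler_pdivrMr ?exprn_gt0// => HN.
  have -> : d%:R * (rho * (2 * e)) = 4 * d%:R * rho ^+ 2 / N%:R.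
    by rewrite /e; field; rewrite gt_eqF.
  rewrite ler_pdivrMr//; apply: (@le_trans _ _ (4 * d.+1%:R * rho ^+ 2)).
    by rewrite ler_wpM2r ?sqr_ge0// ler_wpM2l// ler_nat.
  move: HN; move: (d.+1%:R * rho ^+ 2) (mulrA 8 d.+1%:R (rho ^+ 2)) (mulrA 4 d.+1%:R (rho ^+ 2)) => z <- <-.
  lra.
pose c (i : 'I_N.+1) := 0 - rho + e * i%:R.
pose f (k : {ffun 'I_d -> 'I_N.+1}) (x : rV) := \1_F x * \prod_j box e (c (k j)) (x ord0 j).
have bf k : bmeas (f k).
  apply: bmeasM; first exact: bmeas_indic.
  apply: bmeas_prod => j; split; last by exists 1 => x; exact: norm_box_le1.
  by apply: measurable_box => //; exact: measurable_coord.
have f01 k x : 0 <= f k x <= 1.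
  apply/andP; split; first by rewrite mulr_ge0// prodr_ge0// => j _; exact: box_ge0.
  rewrite -[leRHS]mulr1 ler_pM//.
  - by apply: prodr_ge0 => j _; exact: box_ge0.
  - by apply: prodr_ile1 => j _; rewrite box_ge0 box_le1.
(* Otherwise the small cubes would all be null. Distributing the product over coordinates, the sum
   of the cube indicators is a product of sums, each at least 1 by [box_cover]. *)
have [k fk] : exists k, 0 < \int[mu]_x f k x.
  apply: contrapT => /forallNP H.
  have : \int[mu]_x \1_F x <= \sum_k \int[mu]_x f k x.
    rewrite -fint_sum//; apply: fint_le; [exact: bmeas_indic | exact: bmeas_sum |].
    move=> x; rewrite /f -mulr_sumr -[leLHS]mulr1 indicE.
    case: (boolP (x \in F)) => [/set_mem [Ex _]|_]; last by rewrite !mul0r.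
    rewrite !mul1r -(bigA_distr_bigA (fun j i => box e (c i) (x ord0 j))).
    have box1 j : 1 <= \sum_(i < N.+1) box e (c i) (x ord0 j).
      have := @box_cover R 0 rho N (x ord0 j) rho_gt0 (ltn0Sn _).
      by rewrite {1}/box subr0 E_rho.
    rewrite -[leLHS](expr1n _ #|'I_d|) -prodr_const.
    by apply: ler_prod => j _; rewrite ler01 box1.
  rewrite leNgt => /negP; apply; apply: le_lt_trans F0.
  by apply: sumr_le0 => k _; rewrite leNgt; apply/negP; exact: H.
(* The dot products are at most d rho ^ 2; adding rho0 ^ 2 guarantees rho0 ^ 2 / 2 < D. *)
exists (d%:R * rho ^+ 2 + rho0 ^+ 2), rho0, (f k); split => //.
  have : 0 < rho0 ^+ 2 by rewrite exprn_gt0.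
  have : 0 <= d%:R * rho ^+ 2 by rewrite mulr_ge0// sqr_ge0.
  lra.
have fP x : 0 < f k x -> F x /\ forall j, `|x ord0 j - c (k j)| <= e.
  move=> fx; split.
    apply: contrapT => Fx; move: fx; rewrite /f indicE memNset// mul0r ltxx//.
  move=> j; rewrite leNgt; apply/negP => xj; move: fx.
  by rewrite /f (bigD1 j)//= /box leNgt xj mul0r mulr0 ltxx.
move=> x y /fP[[Ex Qx] Hx] /fP[[Ey Qy] Hy]; rewrite cutdotE//.
have xr j : `|x ord0 j| <= rho by exact: E_rho.
have yr j : `|y ord0 j| <= rho by exact: E_rho.
have [j0 Hj0] : exists j, rho0 < `|x ord0 j|.
  apply: contrapT => /forallNP H; apply: Qx => j; rewrite leNgt; apply/negP; exact: H.
apply/andP; split.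
  have -> : dot x y = \sum_j (x ord0 j ^+ 2) - \sum_j x ord0 j * (x ord0 j - y ord0 j).
    by rewrite /dot -sumrB; apply: eq_bigr => j _; ring.
  have h1 : rho0 ^+ 2 <= \sum_j x ord0 j ^+ 2.
    rewrite (bigD1 j0)//= -[leLHS]addr0 lerD//; last by apply: sumr_ge0 => j _; exact: sqr_ge0.
    by rewrite -[leRHS]real_normK ?num_real// ler_pXn2r ?nnegrE ?(ltW rho00)// ltW.
  have h2 : \sum_j x ord0 j * (x ord0 j - y ord0 j) <= d%:R * (rho * (2 * e)).
    apply: (@le_trans _ _ (\sum_(j < d) rho * (2 * e))).
      apply: ler_sum => j _; apply: le_trans (ler_norm _) _; rewrite normrM ler_pM//.
      have -> : x ord0 j - y ord0 j = (x ord0 j - c (k j)) - (y ord0 j - c (k j)) by ring.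
      by apply: le_trans (ler_normB _ _) _; rewrite mulrDl mul1r lerD.
    by rewrite sumr_const card_ord -[leLHS]mulr_natl.
  lra.
apply: (@le_trans _ _ (\sum_(j < d) rho ^+ 2)).
  apply: ler_sum => j _; apply: le_trans (ler_norm _) _; rewrite normrM expr2 ler_pM//.
by rewrite sumr_const card_ord -[leLHS]mulr_natl lerDl sqr_ge0.
Qed.

Theorem edge_lower_bound_cut : exists t0 eta c r0 : R,
  [/\ 0 < eta, 0 < c, 0 < r0 & forall t r, `|t - t0| < eta -> 0 < r <= r0 ->
     c * r <= \int[mu]_x (\int[mu]_y box r t (cutdot E x y))].
Proof.
have [D [rho0 [f [[bf f01] f0 rho00 rD fdot]]]] := small_positive_piece.
pose lo := rho0 ^+ 2 / 2; have lo0 : 0 < lo by rewrite divr_gt0// exprn_gt0.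
pose m := (lo + D) / 2; pose r1 := (D - lo) / 2.
have r10 : 0 < r1 by rewrite divr_gt0// subr_gt0.
have mlo : m - r1 = lo by rewrite /m /r1; field.
have mD : m + r1 = D by rewrite /m /r1; field.
have a0 : 0 < lo / 2 by rewrite divr_gt0.
have [C C0 HC] := block_damped (D + 1) a0.
(* [v] does not depend on the dilation, whose measure on [1, 2] has mass 1, so the dilation
   integrates out. *)
have PE r t : \int[P]_o box r t (v o) = \int[mu]_x (\int[mu]_y box r t (cutdot E x y)).
  have b1 : bmeas (fun o => box r t (v o)) by exact: bmeas_box.
  rewrite fint_finprod//.
  have b2 := bmeas_fint_snd mu mu (bcut r t).
  transitivity (\int[finprod (leb_itv (1 : R) 2) mu]_o (cst 1 o.1 * \int[mu]_y box r t (cutdot E o.2 y))).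
    by apply: eq_Rintegral => o _; rewrite mul1r.
  rewrite (fint_mul (leb_itv (1 : R) 2) mu (bmeas_cst 1) b2) fint_cst mass_leb_itv ?ler1n//.
  by rewrite addrK !mul1r.
have pos : 0 < \int[P]_o box r1 m (v o).
  rewrite PE; apply: (@lt_le_trans _ _ ((\int[mu]_x f x) * (\int[mu]_x f x))).
    by rewrite mulr_gt0.
  rewrite -(fint_mul mu mu bf bf) -(fint_finprod _ _ (bcut r1 m)).
  apply: fint_le => //; first exact: bmeasM (bmeas_fst bf) (bmeas_snd bf).
  move=> p; have /andP[fx0 fx1] := f01 p.1; have /andP[fy0 fy1] := f01 p.2.
  move: (fx0); rewrite le_eqVlt => /predU1P[<-|fx]; first by rewrite mul0r box_ge0.
  move: (fy0); rewrite le_eqVlt => /predU1P[<-|fy]; first by rewrite mulr0 box_ge0.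
  have -> : box r1 m (cutdot E p.1 p.2) = 1.
    by rewrite /box ler_distl mlo mD fdot.
  by rewrite -[leRHS]mulr1 ler_pM.
(* The strict inequality on [s] makes the ratio of consecutive blocks less than 1. *)
have q1 : 2 `^ (d.+1%:R / 2 - s) < 1 :> R.
  rewrite /powR gt_eqF// -[ltRHS]expR0 ltr_expR pmulr_llt0 ?subr_lt0 ?ln_gt0 ?ltr1n//.
have am : lo / 2 < m - r1 by rewrite mlo ltr_pdivrMr// ltr_pMr// ltr1n.
have mb : m + r1 < D + 1 by rewrite mD ltrDl.
have [t0 [eta [c [r0 [h1 h2 h3 h4]]]]] :=
  interval_lower_bound mlam mv lam_itv C0 (powR_ge0 _ _) q1 HC r10 am mb pos.
exists t0, eta, c, r0; split => // t r ht hr; rewrite -PE; exact: h4.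
Qed.

End EdgeBound.

Lemma compact_coord_bound (R : realType) d (E : set 'rV[R]_d) : compact E ->
  exists2 rho : R, 1 <= rho & forall x j, E x -> `|x ord0 j| <= rho.
Proof.
move=> /compact_bounded [M [_ HM]].
exists (Num.max 1 (M + 1)); first by rewrite le_max lexx.
move=> x j Ex; apply: (@le_trans _ _ `|x|).
  rewrite [leRHS]mx_normrE.
  by apply: (le_trans _ (le_bigmax _ (fun ij : 'I_1 * 'I_d => `|x ij.1 ij.2|) (ord0, j))).
by apply: HM => //; rewrite lt_max ltrDl ltr01 orbT.
Qed.

Section FrostmanFacts.
Context {R : realType} {d : nat}.
Local Notation rV := (borel_rV R d).

(** The factor d + 1 is crude, but it makes the inequality strict and stays positive for d = 0. *)
Lemma enorm_lt (x : 'rV[R]_d) r : 0 < r -> (forall j, `|x ord0 j| <= r) ->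
  enorm x < d.+1%:R * r.
Proof.
move=> r0 Hx; rewrite /enorm.
have H : dot x x < (d.+1%:R * r) ^+ 2.
  apply: (@le_lt_trans _ _ (\sum_(j < d) r ^+ 2)).
    apply: ler_sum => j _; apply: le_trans (ler_norm _) _.
    by rewrite normrM expr2 ler_pM.
  rewrite sumr_const card_ord -[ltLHS]mulr_natl exprMn ltr_pM2r ?exprn_gt0//.
  by rewrite -natrX ltr_nat expnS expn1 mulnS; apply: leq_trans (leq_addr _ _).
by rewrite -(@ltr_pXn2r _ 2)// ?nnegrE ?sqrtr_ge0 ?mulr_ge0 ?(ltW r0)// sqr_sqrtr//
  sumr_ge0// => j _; rewrite -expr2 sqr_ge0.
Qed.

Lemma measurable_eball (x : 'rV[R]_d) (r : R) : measurable (eball x r : set rV).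
Proof.
rewrite -[X in measurable X]setTI.
apply: (measurable_fun_ltr _ _ measurableT) => //.
apply: (measurableT_comp (continuous_measurable_fun (@sqrt_continuous R))).
have mc j : measurable_fun setT (fun y : rV => (y - x) ord0 j).
  under eq_fun do rewrite !mxE.
  by apply: measurable_funB => //; exact: measurable_coord.
by apply: measurable_sum => j; apply: measurable_funM.
Qed.

Lemma edge_lower_bound (E : set 'rV[R]_d) (s : R)
  (mu : {finite_measure set rV -> \bar R}) :
  compact E -> d.+1%:R / 2 < s -> frostman E s mu ->
  exists t0 eta c r0 : R,
  [/\ 0 < eta, 0 < c, 0 < r0 & forall t r, `|t - t0| < eta -> 0 < r <= r0 ->
     c * r <= \int[mu]_x (\int[mu]_y box r t (cutdot E x y))].
Proof.
move=> cE sgt [mu0 muE [A HA]].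
have mE : measurable (E : set rV).
  by apply: closed_measurable_rV; apply: compact_closed => //; exact: norm_hausdorff.
have [rho rho1 Erho] := compact_coord_bound cE.
(* The power of d + 1 pays for placing a coordinate cube inside a Euclidean ball; the absolute value
   is there because [frostman] says nothing about the sign of A. *)
pose A0 := `|A| * d.+1%:R `^ s.
have A00 : 0 <= A0 by rewrite mulr_ge0// powR_ge0.
have mass0 : 0 < mass mu.
  by rewrite lt_neqAle mass_ge0 andbT eq_sym -eqe -massE.
have frost : forall (x : 'rV[R]_d) (r : R), 0 < r ->
    (mu (E `&` [set y : rV | forall j, `|x ord0 j - y ord0 j| <= r]%R) <= (A0 * r `^ s)%:E)%E.
  move=> x r r0; have dr : 0 < d.+1%:R * r by rewrite mulr_gt0.
  pose Q : set rV := [set y | forall j, `|x ord0 j - y ord0 j| <= r].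
  have mQ : measurable Q.
    by apply: measurable_forall_le => j; apply: measurable_funB => //; exact: measurable_coord.
  apply: (@le_trans _ _ (mu (eball x (d.+1%:R * r)))).
    apply: le_measure; rewrite ?inE; [exact: measurableI | exact: measurable_eball |].
    move=> y [_ Qy]; rewrite /eball/=; apply: enorm_lt => // j.
    by rewrite !mxE distrC; exact: Qy.
  apply: le_trans (HA x _ dr) _; rewrite lee_fin powRM ?(ltW r0)// mulrA.
  by rewrite ler_wpM2r ?powR_ge0// ler_wpM2r ?powR_ge0// ler_norm.
exact: (edge_lower_bound_cut mE muE rho1 Erho A00 sgt frost mass0).
Qed.

End FrostmanFacts.

(** * Iterated integrals over vertices *)

Section IteratedIntegral.
Context {d : measure_display} {T : measurableType d} {R : realType}.
Variable mu : {finite_measure set T -> \bar R}.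
Local Open Scope ereal_scope.

Section OneIndexType.
Variable W : eqType.
Implicit Types (g : W -> T) (s : seq W) (F : (W -> T) -> \bar R).

Definition upd g (w : W) (x : T) : W -> T := fun v => if v == w then x else g v.

Lemma upd_swap g v w x y : v != w -> upd (upd g v x) w y = upd (upd g w y) v x.
Proof.
move=> vw; apply/funext => z; rewrite /upd.
by have [->|//] := eqVneq z w; rewrite eq_sym (negbTE vw).
Qed.

(** Integration over the listed vertices of an assignment W -> T, one at a time. Vertices outside
    the list keep their values in [g], which lets the same function express densities with a fixed
    root. *)
Fixpoint multint s F g : \bar R :=
  if s is w :: s' then \int[mu]_x multint s' F (upd g w x) else F g.

(* Joint measurability without a sigma-algebra on W -> T: F is measurable
   along every family of functions that is measurable at each index. *)
Definition meas_along F := forall dY (Y : measurableType dY) (G : Y -> W -> T),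
  (forall w, measurable_fun setT (fun y => G y w)) ->
  measurable_fun setT (fun y => F (G y)).

Lemma measurable_upd1 g w v : measurable_fun setT (fun x => upd g w x v).
Proof. by rewrite /upd; case: eqP => _; [exact: measurable_id | exact: measurable_cst]. Qed.

Lemma measurable_upd dY (Y : measurableType dY) (G : Y -> W -> T) w v :
  (forall w, measurable_fun setT (fun y => G y w)) ->
  measurable_fun setT (fun p : Y * T => upd (G p.1) w p.2 v).
Proof.
move=> mG; rewrite /upd; case: eqP => _; first exact: measurable_snd.
exact: measurableT_comp (mG v) measurable_fst.
Qed.

Lemma multint_ge0 s F g : (forall g, 0 <= F g) -> 0 <= multint s F g.
Proof. by move=> F0; elim: s g => //= w s IH g; apply: integral_ge0. Qed.

Lemma meas_along_multint s F : (forall g, 0 <= F g) -> meas_along F ->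
  meas_along (multint s F).
Proof.
move=> F0 mF; elim: s => //= w s IH dY Y G mG.
have := @measurable_fun_fubini_tonelli_F _ _ Y T R mu
  (fun p => multint s F (upd (G p.1) w p.2)).
apply; last by move=> p; exact: multint_ge0.
by apply: IH => v; exact: measurable_upd.
Qed.

Lemma measurable_multint_upd s F g w : (forall g, 0 <= F g) -> meas_along F ->
  measurable_fun setT (fun x => multint s F (upd g w x)).
Proof.
move=> F0 mF; apply: (meas_along_multint s F0 mF (G := fun x => upd g w x)) => v.
exact: measurable_upd1.
Qed.

Lemma multint_swap s F g v w : v != w -> (forall g, 0 <= F g) -> meas_along F ->
  multint [:: v, w & s] F g = multint [:: w, v & s] F g.
Proof.
move=> vw F0 mF /=.
have mG : measurable_fun setT (fun p : T * T => multint s F (upd (upd g v p.1) w p.2)).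
  apply: (meas_along_multint s F0 mF (G := fun p : T * T => upd (upd g v p.1) w p.2)) => z.
  by apply: (measurable_upd (G := fun x => upd g v x)) => u; exact: measurable_upd1.
pose H (p : T * T) := multint s F (upd (upd g v p.1) w p.2).
have H0 p : 0 <= H p by exact: multint_ge0.
transitivity (\int[mu]_x \int[mu]_y H (x, y)) => //.
rewrite (@fubini_tonelli _ _ T T R mu mu H mG H0).
by apply: eq_integral => y _; apply: eq_integral => x _; rewrite /H /= upd_swap.
Qed.

Lemma multint_front s1 s2 F g w : (forall g, 0 <= F g) -> meas_along F ->
  uniq (s1 ++ w :: s2) -> multint (s1 ++ w :: s2) F g = multint (w :: s1 ++ s2) F g.
Proof.
move=> F0 mF; elim: s1 g => [//|v s1 IH] g us.
have vw : v != w.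
  by apply: contraTneq us => ->; rewrite /= mem_cat mem_head orbT.
rewrite -(multint_swap _ _ vw F0 mF); apply: eq_integral => x _.
by apply: IH; case/andP: us.
Qed.

(** Tonelli, one transposition at a time. It allows the vertices to be listed as convenient: root
    first, or copy by copy. *)
Lemma multint_perm s t F g : (forall g, 0 <= F g) -> meas_along F ->
  uniq s -> perm_eq s t -> multint s F g = multint t F g.
Proof.
move=> F0 mF; elim: s t g => [|w s IH] t g us st.
  by move: st; rewrite perm_sym => /perm_nilP ->.
have wt : w \in t by rewrite -(perm_mem st) mem_head.
have ut : uniq t by rewrite -(perm_uniq st).
case/splitPr: t / wt st ut => t1 t2 st ut.
rewrite multint_front//=; apply: eq_integral => x _; apply: IH.
  by case/andP: us.
have : perm_eq (w :: s) (w :: (t1 ++ t2)).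
  by apply: (perm_trans st); rewrite perm_catC /= perm_cons perm_catC.
by rewrite perm_cons.
Qed.

Lemma multint_agree s F g g' : (forall w, w \notin s -> g w = g' w) ->
  multint s F g = multint s F g'.
Proof.
elim: s g g' => [|w s IH] g g' H /=.
  by congr F; apply/funext => w; exact: H.
apply: eq_integral => x _; apply: IH => v vs; rewrite /upd.
by case: eqP => // /eqP vw; apply: H; rewrite inE negb_or vw.
Qed.

Lemma multint_cat s t F g : multint (s ++ t) F g = multint s (multint t F) g.
Proof. by elim: s g => //= w s IH g; apply: eq_integral => x _. Qed.

Lemma eq_multint s F F' g : (forall g, F g = F' g) -> multint s F g = multint s F' g.
Proof. by move=> FF'; elim: s g => //= w s IH g; apply: eq_integral => x _. Qed.

Lemma multint_le s F g (C : R) : (forall g, 0 <= F g) -> meas_along F ->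
  (forall g, F g <= C%:E) -> multint s F g <= (C * mass mu ^+ size s)%:E.
Proof.
move=> F0 mF FC; elim: s g => [|w s IH] g /=; first by rewrite expr0 mulr1.
have C0 : (0 <= C)%R by rewrite -lee_fin (le_trans (F0 g)).
apply: (@le_trans _ _ (\int[mu]_x (C * mass mu ^+ size s)%:E)).
  apply: ge0_le_integral => //.
  - by move=> x _; exact: multint_ge0.
  - exact: measurable_multint_upd.
rewrite integral_cst// [X in _ * X]massE -EFinM lee_fin exprS.
by rewrite le_eqVlt; apply/orP; left; apply/eqP; ring.
Qed.

Definition indep s F := forall g w x, w \in s -> F (upd g w x) = F g.

Lemma indep_multint s t F : (forall w, w \in s -> w \notin t) -> indep s F ->
  indep s (multint t F).
Proof.
move=> st iF; elim: t st => [|v t IH] st g w x ws /=; first exact: iF.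
have vw : w != v by apply: contraNneq (st w ws) => ->; exact: mem_head.
apply: eq_integral => y _; rewrite upd_swap// IH// => z zs.
by have := st z zs; rewrite inE negb_or => /andP[].
Qed.

Lemma multint_mull s A B g : (forall g, 0 <= A g) -> (forall g, 0 <= B g) ->
  meas_along B -> indep s A ->
  multint s (fun g => A g * B g) g = A g * multint s B g.
Proof.
move=> A0 B0 mB; elim: s g => [//|w s IH] g iA /=.
have iA' : indep s A by move=> g' v x vs; apply: iA; rewrite inE vs orbT.
under eq_integral do rewrite IH// iA ?mem_head//.
rewrite ge0_integralZl//; first exact: measurable_multint_upd.
by move=> x _; exact: multint_ge0.
Qed.

Lemma multint_prod s t A B g : (forall g, 0 <= A g) -> (forall g, 0 <= B g) ->
  meas_along A -> meas_along B -> (forall w, w \in s -> w \notin t) ->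
  indep t A -> indep s B ->
  multint (s ++ t) (fun g => A g * B g) g = multint s A g * multint t B g.
Proof.
move=> A0 B0 mA mB st iA iB; rewrite multint_cat.
rewrite (eq_multint _ (F' := fun g => multint t B g * A g)); last first.
  by move=> g'; rewrite multint_mull// muleC.
rewrite multint_mull//; [by rewrite muleC | by move=> g'; exact: multint_ge0 |].
exact: indep_multint.
Qed.

End OneIndexType.

Lemma multint_map (W W' : eqType) (phi : W -> W') (s : seq W) (F : (W -> T) -> \bar R) g :
  injective phi -> multint (map phi s) (fun g' => F (g' \o phi)) g = multint s F (g \o phi).
Proof.
move=> inj; elim: s g => [//|w s IH] g /=; apply: eq_integral => x _.
rewrite IH; congr multint; apply/funext => v; rewrite /upd /=.
by rewrite (inj_eq inj).
Qed.

(** The recursion of [power_measure], carried over from sets to functions. *)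
Fixpoint tupint n : (n.-tuple T -> \bar R) -> \bar R :=
  match n with
  | 0 => fun F => F [tuple]
  | n'.+1 => fun F => \int[mu]_x tupint (fun t : n'.-tuple T => F (cons_tuple x t))
  end.

Lemma power_measureE n (A : set (n.-tuple T)) :
  power_measure mu n A = tupint (fun t => (\1_A t)%:E).
Proof.
elim: n A => [A|n IH A] /=; first by rewrite /dirac.
rewrite /pushforward /product_measure1; apply: eq_integral => x _.
rewrite [LHS]/= IH; congr tupint; apply/funext => t; congr (_%:R%:E).
by rewrite /xsection /=; congr nat_of_bool; apply/idP/idP; rewrite !inE/= ?inE.
Qed.

(** A tuple is read as an assignment through the position of a vertex in [s]; a vertex outside [s]
    has position [size s] and gets the default [g w]. *)
Lemma tupint_multint (W : eqType) n (s : seq W) (F : (W -> T) -> \bar R) g :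
  uniq s -> size s = n ->
  tupint (fun t : n.-tuple T => F (fun w => nth (g w) t (index w s))) = multint s F g.
Proof.
elim: n s F g => [|n IH] [|w s] F g //= us.
move=> [ss]; apply: eq_integral => x _; case/andP: us => ws us.
rewrite -IH//; congr tupint; apply/funext => t; congr F; apply/funext => v.
rewrite /upd; have [wv|wv] := eqVneq w v; last by [].
by rewrite -wv [RHS]nth_default// size_tuple -ss leqNgt index_mem ws.
Qed.

End IteratedIntegral.

(** * Homomorphism densities and symmetric covers *)

(** The convex power x ^ (q + 1) lies above its tangent at a. *)
Lemma tangent_power (R : realFieldType) q (x a : R) : 0 <= x -> 0 <= a ->
  q.+1%:R * a ^+ q * x <= x ^+ q.+1 + q%:R * a ^+ q.+1.
Proof.
move=> x0 a0; elim: q => [|q IH]; first by rewrite expr0 expr1 mul0r addr0 mulr1 mul1r.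
rewrite -subr_ge0 in IH; rewrite -subr_ge0.
have -> : x ^+ q.+2 + q.+1%:R * a ^+ q.+2 - q.+2%:R * a ^+ q.+1 * x =
    x * (x ^+ q.+1 + q%:R * a ^+ q.+1 - q.+1%:R * a ^+ q * x) + q.+1%:R * a ^+ q * (x - a) ^+ 2.
  by rewrite -[q.+2%:R]natr1 -[q.+1%:R]natr1 !exprS; ring.
apply: addr_ge0; first exact: mulr_ge0.
by apply: mulr_ge0; [apply: mulr_ge0 => //; exact: exprn_ge0 | exact: sqr_ge0].
Qed.

Lemma bmeasX d (T : measurableType d) (R : realType) (f : T -> R) q :
  bmeas f -> bmeas (fun x => f x ^+ q).
Proof.
move=> bf; elim: q => [|q IH]; first by under eq_fun do rewrite expr0; exact: bmeas_cst.
by under eq_fun do rewrite exprS; exact: bmeasM.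
Qed.

(** Jensen's inequality for a measure that is not normalised: integrate the tangent line of the
    power at the mean value [a]. *)
Lemma power_mean d (T : measurableType d) (R : realType)
    (mu : {finite_measure set T -> \bar R}) (f : T -> R) q :
  bmeas f -> (forall x, 0 <= f x) -> 0 < mass mu ->
  (\int[mu]_x f x) ^+ q.+1 / mass mu ^+ q <= \int[mu]_x (f x ^+ q.+1).
Proof.
move=> bf f0 M0; set M := mass mu in M0 *; pose a := (\int[mu]_x f x) / M.
have I0 : 0 <= \int[mu]_x f x by apply: Rintegral_ge0.
have a0 : 0 <= a by rewrite divr_ge0// ltW.
have : q.+1%:R * a ^+ q * \int[mu]_x f x <= \int[mu]_x (f x ^+ q.+1) + q%:R * a ^+ q.+1 * M.
  rewrite -fintZl// -fint_cst -fintD; [|exact: bmeasX|exact: bmeas_cst].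
  apply: fint_le; first exact: bmeasM (bmeas_cst _) bf.
    by apply: bmeasD; [exact: bmeasX | exact: bmeas_cst].
  by move=> x; exact: tangent_power.
have -> : \int[mu]_x f x = a * M by rewrite divfK// gt_eqF.
move: a {a0} => a; rewrite -lerBlDr; congr (_ <= _).
by rewrite exprMn -natr1 !exprS; field; apply/expf_neq0/lt0r_neq0.
Qed.

(** A vertex other than a is joined to a by a path, whose first edge must be the only edge {a,
    b}. *)
Lemma single_edge_tree (V : finType) (e : rel V) : is_tree e -> #|edge_set e| = 1%N ->
  exists a b, [/\ a != b, e a b & forall v, (v == a) || (v == b)].
Proof.
move=> [_ _ irr con _] /eqP/cards1P[A eA].
have : A \in edge_set e by rewrite eA set11.
rewrite inE => /existsP[a /existsP[b /andP[ab /eqP Aab]]].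
exists a, b; split => //; first by apply: contraTneq ab => ->; rewrite irr.
move=> v; have [//|va] := eqVneq v a; rewrite /=.
have /connectP[p] := con v a; case: p => [_ /= av|z p /= /andP[vz _] _].
  by rewrite av eqxx in va.
have : [set v; z]%SET \in edge_set e.
  by rewrite inE; apply/existsP; exists v; apply/existsP; exists z; rewrite vz eqxx.
rewrite eA inE => /eqP vzA; have : v \in [set v; z]%SET by rewrite set21.
by rewrite vzA Aab !inE (negbTE va).
Qed.

Section Homomorphisms.
Context {d : measure_display} {T : measurableType d} {R : realType}.
Variable mu : {finite_measure set T -> \bar R}.
Local Open Scope ereal_scope.

Section Target.
Variables (E : set T) (K : T -> T -> Prop).
Hypotheses (mE : measurable E) (mK : measurable [set p : T * T | K p.1 p.2]).

Definition hom_set (W : finType) (f : rel W) : set (W -> T) :=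
  [set g | (forall v, E (g v)) /\ (forall v w, f v w -> K (g v) (g w))].

Definition hom (W : finType) (f : rel W) (g : W -> T) : \bar R := (\1_(hom_set f) g)%:E.

Lemma hom_ge0 (W : finType) (f : rel W) g : 0 <= hom f g.
Proof. by rewrite lee_fin indicE. Qed.

Lemma hom_le1 (W : finType) (f : rel W) g : hom f g <= 1.
Proof. by rewrite lee_fin indicE; case: (_ \in _). Qed.

Lemma meas_along_hom (W : finType) (f : rel W) : meas_along (hom f).
Proof.
move=> dY Y G mG; apply/measurable_EFinP.
have -> : (fun y => \1_(hom_set f) (G y)) = \1_(G @^-1` hom_set f) :> (Y -> R).
  by apply/funext => y; rewrite !indicE.
apply: measurable_indic.
have -> : G @^-1` hom_set f =
    \bigcap_(v in [set: W]) ((fun y => G y v) @^-1` E) `&`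
    \bigcap_(p in [set p : W * W | f p.1 p.2])
      ((fun y => (G y p.1, G y p.2)) @^-1` [set q | K q.1 q.2]).
  apply/seteqP; split => [y [H1 H2]|y [H1 H2]]; split.
  - by move=> v _; exact: H1.
  - by move=> [v w] /= fvw; exact: H2.
  - by move=> v; exact: H1.
  - by move=> v w fvw; exact: (H2 (v, w)).
apply: measurableI; apply: fin_bigcap_measurable; try exact: finite_finset.
- by move=> v _; rewrite -[X in measurable X]setTI; exact: mG.
- move=> p _; rewrite -[X in measurable X]setTI.
  by apply: (measurable_fun_pair (mG p.1) (mG p.2)).
Qed.

Lemma meas_along_comp (W W' : eqType) (phi : W -> W') (F : (W -> T) -> \bar R) :
  meas_along F -> meas_along (fun g => F (g \o phi)).
Proof. by move=> mF dY Y G mG; apply: (mF _ _ (fun y => G y \o phi)) => w; exact: mG. Qed.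

Definition hom_density (W : finType) (f : rel W) : \bar R :=
  multint mu (enum W) (hom f) (fun=> point).

Section Rooted.
Variables (W : finType) (f : rel W) (r : W).

Let rest := [seq w <- enum W | w != r].

(** The constant assignment stands for any one with value x at the root, since all other vertices
    are integrated out. *)
Definition rooted_density (x : T) : R := fine (multint mu rest (hom f) (fun=> x)).

Lemma rooted_densityE g : multint mu rest (hom f) g = (rooted_density (g r))%:E.
Proof.
rewrite /rooted_density (@multint_agree _ _ _ _ _ _ _ _ g); last first.
  by move=> w; rewrite mem_filter mem_enum andbT negbK => /eqP ->.
rewrite fineK// ge0_fin_numE; last by apply: multint_ge0; exact: hom_ge0.
apply: (@le_lt_trans _ _ (1 * mass mu ^+ size rest)%:E); last exact: ltry.
by apply: multint_le; [exact: hom_ge0 | exact: meas_along_hom | exact: hom_le1].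
Qed.

Lemma rooted_density_ge0 x : (0 <= rooted_density x)%R.
Proof. by apply: fine_ge0; apply: multint_ge0; exact: hom_ge0. Qed.

Lemma bmeas_rooted_density : bmeas rooted_density.
Proof.
split.
  apply: (@measurableT_comp _ _ _ _ _ _ fine); first exact: fine_measurable.
  apply: (meas_along_multint mu rest (@hom_ge0 W f) (@meas_along_hom W f) (G := fun x _ => x)).
  by move=> w; exact: measurable_id.
exists (1 * mass mu ^+ size rest)%R => x; rewrite ger0_norm ?rooted_density_ge0// -lee_fin.
rewrite -(rooted_densityE (fun=> x)); apply: multint_le; [exact: hom_ge0 | exact: meas_along_hom |].
exact: hom_le1.
Qed.

Lemma hom_density_root : hom_density f = (\int[mu]_x rooted_density x)%:E.
Proof.
have pr : perm_eq (enum W) (r :: rest).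
  apply: uniq_perm; first exact: enum_uniq.
    by rewrite /= filter_uniq ?enum_uniq// mem_filter eqxx.
  by move=> w; rewrite in_cons mem_enum mem_filter mem_enum andbT; case: eqVneq.
rewrite /hom_density (multint_perm _ _ _ _ (enum_uniq _) pr); last 2 first.
- exact: hom_ge0.
- exact: meas_along_hom.
rewrite /= EFin_fint; last exact: bmeas_rooted_density.
apply: eq_integral => x _.
by rewrite rooted_densityE /upd eqxx.
Qed.

End Rooted.

(** * Copies of a graph glued at one vertex *)

Section Join.
Variables (I W : finType) (f : rel W) (r : W).

Let copy (i : I) (w : W) : option (I * {w : W | w != r}) := glue_vertex r (i, w).

Let copy_r i : copy i r = None.
Proof. by rewrite /copy /glue_vertex /= insubF ?eqxx. Qed.

Let copy_Some i (u : {w : W | w != r}) : copy i (val u) = Some (i, u).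
Proof. by rewrite /copy /glue_vertex /= valK. Qed.

(** Different copies meet only in the common vertex. *)
Let copy_inj2 i j w w' : w != r -> copy i w = copy j w' -> i = j /\ w = w'.
Proof.
move=> wr; rewrite /copy /glue_vertex /= (insubT (fun w => w != r) wr) /=.
by case: insubP => // u _ <- /= [-> <-].
Qed.

Let copy_inj i : injective (copy i).
Proof.
move=> w w'; have [->|wr] := eqVneq w r; last by move=> /(copy_inj2 wr)[].
have [->//|wr'] := eqVneq w' r => /esym/(copy_inj2 wr')[_] -> //.
Qed.

Let homs_set (s : seq I) : set (option (I * {w : W | w != r})%type -> T) :=
  [set g : option (I * {w : W | w != r})%type -> T |
    forall i, i \in s -> hom_set f (g \o copy i)].

Let homs (s : seq I) (g : option (I * {w : W | w != r})%type -> T) : \bar R :=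
  (\1_(homs_set s) g)%:E.

Let homs_cons i s g : homs (i :: s) g = hom f (g \o copy i) * homs s g.
Proof.
rewrite /homs /hom -EFinM; congr EFin; rewrite !indicE -natrM mulnb; congr (_%:R).
congr nat_of_bool; apply/idP/andP.
  move=> /set_mem H; split; apply/mem_set; first by apply: H; rewrite mem_head.
  by move=> j js; apply: H; rewrite inE js orbT.
move=> [/set_mem H1 /set_mem H2]; apply/mem_set => j; rewrite inE => /predU1P[->//|]; exact: H2.
Qed.

Let homs_ge0 s g : 0 <= homs s g. Proof. by rewrite lee_fin indicE. Qed.

Let meas_along_homs s : meas_along (homs s).
Proof.
elim: s => [|i s IH].
  move=> dY Y G mG; have -> : (fun y => homs [::] (G y)) = cst 1.
    by apply/funext => y; rewrite /homs indicE mem_set.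
  exact: measurable_cst.
move=> dY Y G mG; under eq_fun do rewrite homs_cons.
apply: emeasurable_funM; last exact: IH.
exact: (@meas_along_comp W _ (copy i) _ (@meas_along_hom W f) _ _ _ mG).
Qed.

(** The index [i0] guarantees at least one copy: without it no condition on the right would test the
    common vertex. *)
Let hom_joinE (i0 : I) g : hom (@join I W f r) g = homs (enum I) g.
Proof.
rewrite /hom /homs; congr EFin; rewrite !indicE; congr (nat_of_bool _)%:R.
apply/idP/idP => /set_mem H; apply/mem_set.
  move=> i _; split => [v|v w fvw]; first exact: H.1.
  apply: H.2; apply/existsP; exists (i, v); apply/existsP; exists (i, w).
  by rewrite !eqxx.
split=> [[[i u]|]|x y /existsP[[i v] /existsP[[j w]]]].
- by rewrite -copy_Some; apply: (H i _).1; rewrite mem_enum.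
- by rewrite -(copy_r i0); apply: (H i0 _).1; rewrite mem_enum.
- move=> /= /and3P[/eqP <- /eqP <- /andP[/eqP -> fvw]].
  by apply: (H j _).2 => //; rewrite mem_enum.
Qed.

Let rest := [seq w <- enum W | w != r].

Let blocks (s : seq I) := [seq copy i w | i <- s, w <- rest].

(** With the value at the common vertex fixed, different copies involve disjoint sets of integrated
    vertices. The integral therefore factors, each copy contributing one rooted density. *)
Let multint_blocks s g : uniq s ->
  multint mu (blocks s) (homs s) g = (rooted_density f r (g None) ^+ size s)%:E.
Proof.
elim: s g => [|i s IH] g.
  by move=> _; rewrite /homs /= indicE mem_set// expr0.
move=> /= /andP[is_ us].
have memr w : w \in rest -> w != r by rewrite mem_filter => /andP[].
rewrite (eq_multint _ _ (F' := fun g => hom f (g \o copy i) * homs s g)); last exact: homs_cons.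
rewrite /blocks allpairs_cons multint_prod.
- rewrite multint_map; last exact: copy_inj.
  by rewrite rooted_densityE /= copy_r IH// -EFinM exprS.
- by move=> g'; exact: hom_ge0.
- exact: homs_ge0.
- exact: meas_along_comp (@meas_along_hom W f).
- exact: meas_along_homs.
- move=> _ /mapP[w wr ->]; apply/negP => /allpairsP[[j w'] /= [js w'r]].
  move=> /(copy_inj2 (memr _ wr))[ij _]; by rewrite ij js in is_.
- move=> g' _ x /allpairsP[[j w] /= [js wr ->]]; congr hom; apply/funext => v /=.
  rewrite /upd; case: eqP => // /esym/(copy_inj2 (memr _ wr))[ji _].
  by rewrite -ji js in is_.
- move=> g' _ x /mapP[w wr ->]; rewrite /homs; congr EFin; rewrite !indicE.
  have E1 j : j \in s -> upd g' (copy i w) x \o copy j = g' \o copy j.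
    move=> js; apply/funext => v /=; rewrite /upd; case: eqP => //.
    by move=> /esym/(copy_inj2 (memr _ wr))[ij _]; rewrite ij js in is_.
  congr (nat_of_bool _)%:R; apply/idP/idP => /set_mem H; apply/mem_set => j js.
    by rewrite -E1//; exact: H.
  by rewrite /= E1//; exact: H.
Qed.

Lemma hom_density_join : (0 < #|I|)%N ->
  hom_density (@join I W f r) = (\int[mu]_x (rooted_density f r x ^+ #|I|))%:E.
Proof.
move=> /card_gt0P[i0 _].
have memr w : w \in rest -> w != r by rewrite mem_filter => /andP[].
have pr : perm_eq (enum {: option (I * {w : W | w != r})}) (None :: blocks (enum I)).
  apply: uniq_perm; first exact: enum_uniq.
    rewrite /=; apply/andP; split.
      apply/negP => /allpairsP[[j w] /= [_ wr]]; rewrite -(copy_r i0).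
      by move=> /esym/(copy_inj2 (memr _ wr))[_ wr']; rewrite wr' mem_filter eqxx in wr.
    apply: allpairs_uniq; [exact: enum_uniq | by rewrite filter_uniq ?enum_uniq|].
    move=> [j w] [j' w'] /allpairsP[[? ?] /= [_ wr [-> ->]]] _ /=.
    by move=> /(copy_inj2 (memr _ wr))[-> ->].
  move=> [[i u]|]; rewrite mem_enum !inE//=.
  apply/esym/allpairsP; exists (i, val u); split; rewrite ?mem_enum//=.
    by rewrite mem_filter mem_enum (valP u).
  by rewrite copy_Some.
rewrite /hom_density (multint_perm _ _ _ _ (enum_uniq _) pr); last 2 first.
- exact: hom_ge0.
- exact: meas_along_hom.
rewrite /= EFin_fint; last exact/bmeasX/bmeas_rooted_density.
apply: eq_integral => x _.
rewrite (eq_multint _ _ (F' := homs (enum I))); last exact: hom_joinE.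
by rewrite multint_blocks ?enum_uniq// /upd eqxx cardE.
Qed.

Lemma hom_density_join_ge (q : nat) : #|I| = q.+1 -> (0 < mass mu)%R ->
  ((fine (hom_density f)) ^+ q.+1 / mass mu ^+ q)%:E <= hom_density (@join I W f r).
Proof.
move=> Iq M0; rewrite hom_density_join ?Iq// (hom_density_root f r) lee_fin.
by apply: power_mean => //; [exact: bmeas_rooted_density | exact: rooted_density_ge0].
Qed.

End Join.

Lemma measurable_edges : measurable [set p : T * T | [/\ E p.1, E p.2 & K p.1 p.2]].
Proof.
have -> : [set p : T * T | [/\ E p.1, E p.2 & K p.1 p.2]] =
    (E `*` E) `&` [set p | K p.1 p.2].
  by apply/seteqP; split => p /=; [case=> ? ? ? | case=> -[]].
by apply: measurableI => //; exact: measurableX.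
Qed.

Definition edge_density : R :=
  \int[mu]_x (\int[mu]_y (\1_[set p : T * T | [/\ E p.1, E p.2 & K p.1 p.2]] (x, y)))%R.

(** The relation [e] contains the edge in both directions, whence the symmetry of [K]. The count of
    vertices gives the exponent 1 in the base case of [cover_density]. *)
Lemma hom_density_edge (V : finType) (e : rel V) :
  (forall x y, K x y -> K y x) -> is_tree e -> #|edge_set e| = 1%N ->
  hom_density e = edge_density%:E /\ #|V| = 2%N.
Proof.
move=> symK te e1; have [a [b [ab eab Vab]]] := single_edge_tree te e1.
have [_ sym irr _ _] := te.
have pr : perm_eq (enum V) [:: a; b].
  apply: uniq_perm; [exact: enum_uniq | by rewrite /= inE ab|].
  by move=> v; rewrite mem_enum !inE Vab.
split; last by rewrite cardE (perm_size pr).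
rewrite /hom_density (multint_perm _ _ _ _ (enum_uniq _) pr); last 2 first.
- exact: hom_ge0.
- exact: meas_along_hom.
have bS : bmeas (\1_[set p : T * T | [/\ E p.1, E p.2 & K p.1 p.2]] : T * T -> R).
  by apply: bmeas_indic; exact: measurable_edges.
rewrite /edge_density EFin_fint; last exact: bmeas_fint_snd.
apply: eq_integral => x _; rewrite EFin_fint; last first.
  by apply: (bmeas_compr (h := fun y => (x, y)) _ bS); exact: measurable_pair1.
apply: eq_integral => y _; rewrite /hom; congr EFin; rewrite !indicE.
congr (nat_of_bool _)%:R.
have ga : upd (upd (fun=> point) a x) b y a = x by rewrite /upd (negbTE ab) eqxx.
have gb : upd (upd (fun=> point) a x) b y b = y by rewrite /upd eqxx.
apply/idP/idP => /set_mem H; apply/mem_set.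
  have := conj (H.1 a) (conj (H.1 b) (H.2 a b eab)); rewrite ga gb.
  by move=> [Ea [Eb Kab]]; split.
case: H => /= Ex Ey Kxy; split=> [v|v w].
  by have /orP[/eqP ->|/eqP ->] := Vab v; rewrite ?ga ?gb.
have /orP[/eqP ->|/eqP ->] := Vab v; have /orP[/eqP ->|/eqP ->] := Vab w; rewrite ?irr// ?ga ?gb// => _.
exact: symK.
Qed.

Lemma edge_density_ge0 : (0 <= edge_density)%R.
Proof. by apply: Rintegral_ge0 => x _; apply: Rintegral_ge0 => y _; rewrite indicE. Qed.

End Target.

(* #|W|.-1 is the number of edges of the cover. *)
Theorem cover_density (V W : finType) (e : rel V) (f : rel W) (iota : V -> W) :
  (0 < mass mu)%R -> sym_cover e f iota ->
  exists2 C : R, (0 < C)%R &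
  forall (E : set T) (K : T -> T -> Prop), measurable E ->
    measurable [set p : T * T | K p.1 p.2] -> (forall x y, K x y -> K y x) ->
    (C * edge_density E K ^+ #|W|.-1)%:E <= hom_density E K f.
Proof.
move=> M0; elim=> {V W e f iota} [V e te e1|V e u b W f iota te deg _ _ _ [C C0 IH] r].
  exists 1%R => // E K mE mK sK.
  by have [-> ->] := hom_density_edge mE mK sK te e1; rewrite mul1r expr1.
have [q Iq] : exists q, #|{: {v : V | e u v}}| = q.+1.
  by rewrite card_sig; exists (degree e u).-1; rewrite prednK// ltnW.
(* The constant is fixed before [E] and [K], hence before t and eps, which enter through [K]. *)
exists (C ^+ q.+1 / mass mu ^+ q)%R; first by rewrite divr_gt0 ?exprn_gt0.
move=> E K mE mK sK.
apply: le_trans (hom_density_join_ge mE mK f r Iq M0).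
rewrite lee_fin.
(* The join has one common vertex and q + 1 copies of the remaining vertices, so the exponent is
   multiplied by q + 1, as the power in Jensen's inequality requires. *)
have -> : #|{: option ({v : V | e u v} * {w : W | w != r})}|.-1 = (q.+1 * #|W|.-1)%N.
  by rewrite card_option card_prod Iq card_sig /= cardC1.
have k0 := edge_density_ge0 E K.
rewrite mulrAC ler_wpM2r ?invr_ge0 ?exprn_ge0 ?(ltW M0)// mulnC exprM -exprMn.
have := IH E K mE mK sK; rewrite (hom_density_root mE mK f r) lee_fin /= => H.
by rewrite lerXn2r// nnegrE ?mulr_ge0 ?exprn_ge0 ?(ltW C0)// (le_trans _ H)// mulr_ge0 ?exprn_ge0// ltW.
Qed.

End Homomorphisms.

(** * From edge densities to the measure of tuples *)

Lemma edge_density_ge d (T : measurableType d) (R : realType)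
    (mu : {finite_measure set T -> \bar R}) (E : set T) (K : T -> T -> Prop) (F : T * T -> R) :
  measurable E -> measurable [set p : T * T | K p.1 p.2] -> mu (~` E) = 0%E ->
  bmeas F -> (forall p, F p <= 1) ->
  (forall x y, E x -> E y -> ~ K x y -> F (x, y) <= 0) ->
  \int[mu]_x (\int[mu]_y F (x, y)) <= edge_density mu E K.
Proof.
move=> mE mK muE bF F1 F0.
pose S := [set p : T * T | [/\ E p.1, E p.2 & K p.1 p.2]].
have mS : measurable S := measurable_edges mE mK.
have bS : bmeas (\1_S : T * T -> R) by exact: bmeas_indic.
have bN : bmeas (\1_(~` E) : T -> R) by apply: bmeas_indic; exact: measurableC.
have N0 : \int[mu]_x (\1_(~` E) x : R) = 0.
  by rewrite fint_indic ?muE//; exact: measurableC.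
have bN1 : bmeas (fun p : T * T => \1_(~` E) p.1 : R) by apply: bmeas_compr bN.
have bN2 : bmeas (fun p : T * T => \1_(~` E) p.2 : R) by apply: bmeas_compr bN.
(* Outside [E] nothing relates [F] to [K]; there the indicators of the complement dominate [F], and
   they integrate to 0. *)
pose G (p : T * T) : R := \1_S p + (\1_(~` E) p.1 + \1_(~` E) p.2).
have bG : bmeas G by apply: bmeasD => //; apply: bmeasD.
have FG p : F p <= G p.
  case: p => x y; rewrite /G /= !indicE !in_setC.
  have [/set_mem Ex|xE] := boolP (x \in E); last first.
    by apply: le_trans (F1 _) _; rewrite addrCA lerDl addr_ge0.
  have [/set_mem Ey|yE] := boolP (y \in E); last first.
    by apply: le_trans (F1 _) _; rewrite addrA lerDr addr_ge0.
  have [xyS|xyS] := boolP ((x, y) \in S); first by apply: le_trans (F1 _) _; rewrite lerDl.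
  rewrite !addr0; apply: F0 => // Kxy.
  by case/negP: xyS; apply/mem_set; split.
have sec (H : T * T -> R) x : bmeas H -> bmeas (fun y => H (x, y)).
  by apply: bmeas_compr; exact: measurable_pair1.
apply: (@le_trans _ _ (\int[mu]_x \int[mu]_y G (x, y))).
  apply: fint_le => [| |x]; [exact: bmeas_fint_snd | exact: bmeas_fint_snd |].
  by apply: fint_le => //; exact: sec.
have -> : (fun x => \int[mu]_y G (x, y)) =
    (fun x => \int[mu]_y \1_S (x, y) + \1_(~` E) x * mass mu).
  apply/funext => x; rewrite /G /= fintD; [|exact: (sec _ _ bS)|]; last first.
    by apply: bmeasD => //; exact: bmeas_cst.
  by rewrite fintD//; [rewrite N0 addr0 fint_cst | exact: bmeas_cst].
rewrite fintD; [|exact: bmeas_fint_snd|by apply: bmeasM => //; exact: bmeas_cst].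
by rewrite fintZr// N0 mul0r addr0.
Qed.

(** The labelling lists the vertices in the order in which [power_measure] integrates them, and
    [multint_perm] compares this with the enumeration of [W]. *)
Lemma power_measure_hom d (T : measurableType d) (R : realType)
    (mu : {finite_measure set T -> \bar R}) (E : set T) (K : T -> T -> Prop)
    (W : finType) (f : rel W) n (lab : 'I_n -> W) :
  measurable E -> measurable [set p : T * T | K p.1 p.2] -> bijective lab ->
  power_measure mu n [set x : n.-tuple T | (forall i, E (tnth x i)) /\
    (forall i j, f (lab i) (lab j) -> K (tnth x i) (tnth x j))] = hom_density mu E K f.
Proof.
move=> mE mK [lab' labK lab'K].
pose s := [seq lab i | i <- enum 'I_n].
have us : uniq s by rewrite map_inj_uniq ?enum_uniq//; exact: can_inj labK.
have ss : size s = n by rewrite size_map size_enum_ord.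
have ps : perm_eq s (enum W).
  apply: uniq_perm; rewrite ?enum_uniq// => w; rewrite mem_enum [RHS]inE.
  by apply/mapP; exists (lab' w); rewrite ?mem_enum// lab'K.
rewrite /hom_density -(multint_perm mu (fun=> point) _ _ us ps); last 2 first.
- exact: hom_ge0.
- exact: meas_along_hom.
rewrite power_measureE -(tupint_multint mu (hom E K f) (fun=> point) us ss).
congr tupint; apply/funext => x; rewrite /hom; congr EFin; rewrite !indicE.
have xE i : nth point x (index (lab i) s) = tnth x i.
  rewrite index_map; last exact: can_inj labK.
  by rewrite index_enum_ord (tnth_nth point).
congr (nat_of_bool _)%:R; apply/idP/idP => /set_mem[HE HK]; apply/mem_set; split.
- by move=> w; rewrite -(lab'K w) xE.
- by move=> v w; rewrite -(lab'K v) -(lab'K w) !xE; exact: HK.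
- by move=> i; rewrite -xE.
- by move=> i j fij; rewrite -!xE; exact: HK.
Qed.

Lemma measurable_dot (R : realType) d dT (T : measurableType dT) (f g : T -> borel_rV R d) :
  measurable_fun setT f -> measurable_fun setT g ->
  measurable_fun setT (fun t => dot (f t) (g t)).
Proof.
move=> mf mg; apply: measurable_sum => j; apply: measurable_funM.
  exact: (measurableT_comp (measurable_coord j) mf).
exact: (measurableT_comp (measurable_coord j) mg).
Qed.

Theorem theorem2 (R : realType) (d : nat)
  (V : finType) (T : rel V) (k : nat)
  (T_tree : is_tree T) (T_edges : #|edge_set T| = k) (k_gt0 : (0 < k)%N)
  (E : set 'rV[R]_d) (E_compact : compact E)
  (E_dim : ((d.+1%:R / 2)%:E < hausdorff_dim E)%E)
  (W : finType) (S : rel W) (S_cover : symmetric_tree_cover T S)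
  (m : nat) (S_edges : #|edge_set S| = m)
  (lab : 'I_m.+1 -> W) (lab_bij : bijective lab)
  (s : R) (s_gt : d.+1%:R / 2 < s)
  (mu : {finite_measure set (borel_rV R d) -> \bar R})
  (mu_frostman : frostman E s mu) :
  exists a b : R, a < b /\
    forall eps0 : R, 0 < eps0 ->
    exists c : R, 0 < c /\
      forall t eps : R, a < t < b -> 0 < eps <= eps0 ->
        ((c * eps ^+ m)%:E <
          power_measure mu m.+1
            [set x : m.+1.-tuple (borel_rV R d) |
              (forall i : 'I_m.+1, E (tnth x i)) /\
              (forall i j : 'I_m.+1, S (lab i) (lab j) ->
                 t - eps < dot (tnth x i) (tnth x j) < t + eps)%R])%E.
Proof.
have [t0 [eta [c [r0 [eta0 c0 r00 edge]]]]] := edge_lower_bound E_compact s_gt mu_frostman.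
have [mu0 muE _] := mu_frostman.
have mE : measurable (E : set (borel_rV R d)).
  by apply: closed_measurable_rV; apply: compact_closed => //; exact: norm_hausdorff.
have mass0 : 0 < mass mu.
  by rewrite lt_neqAle mass_ge0 andbT eq_sym -eqe -massE.
have [iota cover] := S_cover.
have [C C0 homC] := cover_density mass0 cover.
exists (t0 - eta), (t0 + eta); split; first by lra.
(* The edge bound holds for radii up to [r0], and the factor r0 / eps0 brings every eps <= eps0 into
   that range. The factor 1/2 puts the closed box of radius l eps inside the open window of radius
   eps. *)
move=> eps0 eps00; pose l := Num.min (1 / 2) (r0 / eps0).
have l0 : 0 < l by rewrite lt_min divr_gt0// divr_gt0.
(* Halving the constant makes the final inequality strict. *)
exists (C * (c * l) ^+ m / 2); split.
  by rewrite divr_gt0// mulr_gt0// exprn_gt0// mulr_gt0.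
move=> t eps t_itv /andP[e0 ee0].
pose K (x y : borel_rV R d) : Prop := t - eps < dot x y < t + eps.
have mK : measurable [set p : borel_rV R d * borel_rV R d | K p.1 p.2].
  have md : measurable_fun setT (fun p : borel_rV R d * borel_rV R d => dot p.1 p.2).
    exact: measurable_dot.
  have := md measurableT `]t - eps, t + eps[%classic (measurable_itv _).
  by congr measurable; rewrite setTI; apply/seteqP; split => p /=; rewrite in_itv.
have symK x y : K x y -> K y x.
  by rewrite /K /dot; under eq_bigr do rewrite mulrC.
(* The exponent in [cover_density] is one less than the number of vertices, which the labelling
   identifies with m. *)
have cardW : #|W|.-1 = m by rewrite -(bij_eq_card lab_bij) card_ord.
have tt0 : `|t - t0| < eta by rewrite ltr_distl; case/andP: t_itv => ? ?; lra.
have re0 : 0 < l * eps <= r0.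
  rewrite mulr_gt0//=; apply: (@le_trans _ _ (r0 / eps0 * eps0)); last by rewrite divfK ?gt_eqF.
  by apply: ler_pM => //; [exact: ltW | exact: ltW | rewrite ge_min lexx orbT].
have leps : l * eps < eps.
  by rewrite -[ltRHS]mul1r ltr_pM2r// gt_min; apply/orP; left; lra.
have dens : c * l * eps <= edge_density mu E K.
  rewrite -mulrA; apply: le_trans (edge _ _ tt0 re0) _.
  apply: (edge_density_ge (F := fun p => box (l * eps) t (cutdot E p.1 p.2))) => //.
  - split; last by exists 1 => p; exact: norm_box_le1.
    by apply: measurable_box => //; exact: measurable_cutdot.
  - by move=> p; rewrite /box lern1; case: (_ <= _).
  - move=> x y Ex Ey nK; rewrite /box cutdotE//.
    have [H|//] := boolP (`|dot x y - t| <= l * eps); case: nK.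
    by rewrite /K -ltr_distl (le_lt_trans H).
rewrite (power_measure_hom mu S mE mK lab_bij).
apply: lt_le_trans (homC E K mE mK symK); rewrite lte_fin cardW.
have p0 : 0 < C * ((c * l) ^+ m * eps ^+ m) by rewrite !mulr_gt0// exprn_gt0// mulr_gt0.
apply: (@lt_le_trans _ _ (C * ((c * l) ^+ m * eps ^+ m))); first by lra.
rewrite -exprMn ler_wpM2l ?(ltW C0)//.
apply: lerXn2r => //; rewrite nnegrE; last exact: edge_density_ge0.
by rewrite !mulr_ge0// ltW.
Qed.
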